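(* Let $g\ge 0$ be an integer and let $\Delta$ be a nonempty finite multiset with entries in $\mathbb{Z}\setminus\{0\}$ satisfying $\sum_{z\in\Delta}z=0$ and $\#\Delta-2+2g\ge 1$. Let $d$ be the sum of the positive entries of $\Delta$, let $\nu$ be the partition of $d$ given by the positive entries of $\Delta$, and let $\eta$ be the partition of $d$ given by the (absolute values of the) negative entries of $\Delta$. Then the degree of the tropical branch map $$br:\mathcal{M}_{g,\mathrm{trop}}(\mathbb{P}^1,\Delta)\to\mathbb{R}^{\#\Delta-2+2g},\qquad (\Gamma,h)\mapsto (h(V_1),\dots,h(V_{\#\Delta-2+2g})),$$ is equal to the double Hurwitz number: $$\deg(br)=H^g_d(\eta,\nu).$$
   Context: **Hurwitz number.** For partitions $\eta,\nu$ of $d$ with $\ell(\eta)$ and $\ell(\nu)$ parts, fix distinct points $p_1,p_2,q_1,\dots,q_s\in\mathbb{P}^1_{\mathbb{C}}$ with $s=2g-2+\ell(\eta)+\ell(\nu)$. $H^g_d(\eta,\nu)$ is the number of isomorphism classes of degree $d$ covers $\pi:C\to\mathbb{P}^1$ with $C$ a smooth connected curve of genus $g$, $\pi$ unramified outside the fixed points, with ramification profile $\eta$ over $p_1$, $\nu$ over $p_2$, and simple ramification over each $q_i$; each cover is counted with weight $1/|\mathrm{Aut}(\pi)|$ (preimages of $p_1,p_2$ are not marked). Equivalently, it is $1/d!$ times the number of tuples $(\sigma_\eta,\tau_1,\dots,\tau_s,\sigma_\nu)$ in $S_d$ with $\sigma_\nu\tau_s\cdots\tau_1\sigma_\eta=1$,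 $\sigma_\eta,\sigma_\nu$ of cycle types $\eta,\nu$, each $\tau_i$ a transposition, and generating a transitive subgroup. **Abstract tropical curves with $g$-labels.** Let $\Gamma$ be a connected finite graph without 2-valent vertices. Edges adjacent to a 1-valent vertex are called ends, other edges bounded edges; $\Gamma^1_0$ is the set of bounded edges; more than 1-valent vertices are called inner vertices, and $\Gamma^0_0$ is the set of inner vertices. A flag is a pair $(V,e)$ with $V\in\partial e$. An abstract tropical curve is such a $\Gamma$ with a length $l(e)$ on each edge, $l(e)=\infty$ for ends and $l(e)\in\mathbb{R}_{>0}$ for bounded edges; its genus is $h_1(\Gamma)$. An abstract tropical curve with $g$-labels is an abstract tropical curve $\Gamma$ of genus $g'\le g$ in which each inner vertex $V$ is labeled with $\mathrm{val}(V)-2+2k_V$ numbers for some $k_V\ge0$, and points $p$ in the interiors of edges are labeled with $2k_p$ numbers for some $k_p\ge0$, such that the disjoint union of all labels is $\{1,\dots,n-2+2g\}$, $n$ being the number of ends. $V_i$ denotes the vertex or point carrying label $i$. Isomorphisms are homeomorphisms preserving labels and mapping each edge bijectively onto an edge by an affine map of slope $\pm1$; isomorphic curves are identified. **Tropical curves in $\mathbb{P}^1$.** Tropical $\mathbb{P}^1$ is $\mathbb{R}\cup\{\pm\infty\}$. A (parametrized) tropical curve of degree $\Delta$ and genus $g$ in $\mathbb{P}^1$ is a pair $(\Gamma,h)$ with $\Gamma$ an abstract tropical curve with $g$-labels and $\#\Delta$ ends and $h:\Gamma\to\mathbb{R}\cup\{\pm\infty\}$ continuous such that: (a) $h$ maps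 the complement of the 1-valent vertices into $\mathbb{R}$; (b) $h$ maps each edge $e$ affinely onto a segment of length $\omega(e)l(e)$, where the weight $\omega(e)$ is a nonnegative integer; the direction of a flag $(V,e)$ is $v(V,e)=\omega(e)$ if $h$ increases along $e$ going away from $V$, and $-\omega(e)$ otherwise; the direction of an end is that of its flag at its inner vertex; (c) the multiset of directions of the ends is $\Delta$; (d) (balancing) $\sum_{e\,:\,V\in\partial e}v(V,e)=0$ at each inner vertex $V$. Curves $(\Gamma,h)$, $(\tilde\Gamma,\tilde h)$ are identified if there is an isomorphism $\varphi:\Gamma\to\tilde\Gamma$ with $\tilde h\circ\varphi=h$. The set of these curves is $M_{g,\mathrm{trop}}(\mathbb{P}^1,\Delta)$. The combinatorial type $\alpha$ of $(\Gamma,h)$ is the graph with its labels and all flag directions (lengths are forgotten). The cell $M^\alpha_{g,\mathrm{trop}}(\mathbb{P}^1,\Delta)$ of curves of type $\alpha$ is an open convex polyhedron with one coordinate for the image under $h$ of a root vertex (take $V_1$) and one coordinate for the length of each bounded edge, cut out by positivity of the lengths and by the equations of the loops, $\sum_{(V,e)}v(V,e)l(e)=0$ (sum over a chain of flags around the loop). Its expected dimension is $1+\#\Gamma^1_0-g_\alpha=\#\Delta-2+2g_\alpha-\sum_{V\in\Gamma_0^0}(\mathrm{val}(V)-3)$, $g_\alpha=h_1(\Gamma)$; $\alpha$ is regular if the cell has this dimension. **The space $\mathcal{M}_{g,\mathrm{trop}}(\mathbb{P}^1,\Delta)$.** It is the union of the cells of those types $\alpha$ such that: if the cell has dimension $\ge\#\Delta-2+2g$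 then $\alpha$ is regular; if the cell has dimension $<\#\Delta-2+2g$ then it is contained in (the closure of) a cell of a regular type of dimension $\#\Delta-2+2g$. Cells of dimension $\#\Delta-2+2g$ are called cells of highest dimension; for these $\Gamma$ is 3-valent of genus $g$. **Weights.** For a type $\alpha$ of highest dimension let $A_\alpha:\mathbb{Z}^{\#\Delta-2+3g}\to\mathbb{Z}^g$ be the matrix with columns indexed by the coordinate $h(V_1)$ and the $\#\Delta-3+3g$ bounded edge lengths, and one row for each element of a chosen basis of $H_1(\Gamma,\mathbb{Z})$, containing the coefficients of the corresponding loop equation. $I_\alpha$ is the index of $A_\alpha(\mathbb{Z}^{\#\Delta-2+3g})$ in $\mathbb{Z}^g$ (independent of the basis). The weight $w(\alpha)$ is the product of $I_\alpha$, a factor $\frac12$ for every vertex $V$ such that $\Gamma\setminus V$ has two connected components of the same combinatorial type (labels included), and a factor $\frac12$ for every cycle consisting of two edges of the same weight. **Degree of $br$.** $br$ is linear on each cell. For $C$ in a cell of highest dimension of type $\alpha$, $\mathrm{mult}_{br}(C)=w(\alpha)\cdot|\det(br|_\alpha)|$, where the determinant is that of the linear map induced by $br$ from the lattice $\ker A_\alpha\subset\mathbb{Z}^{\#\Delta-2+3g}$ to $\mathbb{Z}^{\#\Delta-2+2g}$, with respect to lattice bases. For $p\in\mathbb{R}^{\#\Delta-2+2g}$ with $p_i\neq p_j$ for all $i\ne j$, all curves in $br^{-1}(p)$ lie in cells of highest dimension, and $\deg_{br}(p)=\sum_{C\in br^{-1}(p)}\mathrm{mult}_{br}(C)$. This number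 is independent of such $p$ and is denoted $\deg(br)$. *)

(* Defs.v *)
From HB Require Import structures.
From mathcomp Require Import all_boot all_order all_algebra all_fingroup.
From mathcomp Require Import finmap.
From mathcomp Require Import boolp classical_sets functions cardinality.
From mathcomp Require Import reals constructive_ereal.

Set Implicit Arguments.
Unset Strict Implicit.
Unset Printing Implicit Defensive.

Import Order.TTheory GRing.Theory Num.Theory.
Local Open Scope ring_scope.

(** * Double Hurwitz numbers, by monodromy *)

(* Covers are counted through their monodromy: a cover of degree d with a
   labelling of the fibre over a base point is a tuple as below, connectedness
   is transitivity, and the genus enters through the number s of simple branch
   points (Riemann-Hurwitz).  Dividing by d! gives each cover the weight
   1/|Aut|. *)

Definition cycle_type (d : nat) (s : 'S_d) : seq nat :=
  [seq #|c| | c : {set 'I_d} <- enum (porbits s)].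

Definition is_transposition (d : nat) (t : 'S_d) : bool :=
  [exists x : 'I_d, exists y : 'I_d, (x != y) && (t == tperm x y)].

(* In ['S_d], [s * t] is "first s, then t", so the product below is the
   composition sigma_nu o tau_s o ... o tau_1 o sigma_eta. *)
Definition is_monodromy (d s : nat) (eta nu : seq nat)
    (m : 'S_d * {ffun 'I_s -> 'S_d} * 'S_d) : bool :=
  let: (se, tau, sn) := m in
  [&& perm_eq (cycle_type se) eta,
      perm_eq (cycle_type sn) nu,
      [forall i, is_transposition (tau i)],
      (se * (\prod_(i < s) tau i) * sn)%g == 1%g &
      [transitive <<[set se; sn] :|: [set tau i | i : 'I_s]>>%g,
        on [set: 'I_d] | 'P]].

Definition hurwitz (g d : nat) (eta nu : seq nat) : rat :=
  let s := (2 * g + size eta + size nu - 2)%N in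
  #|[set m | @is_monodromy d s eta nu m]|%:R / (d`!)%:R.

Definition pos_parts (D : seq int) : seq nat := [seq `|z|%N | z <- D & 0 < z].
Definition neg_parts (D : seq int) : seq nat := [seq `|z|%N | z <- D & z < 0].

(** * Combinatorial types of tropical curves in P^1 with labels 1, ..., r+1 *)

(* The 1-valent vertices are not listed: each end is an edge with one inner
   vertex.  A labelled point in the interior of an edge is listed as a 2-valent
   inner vertex; its position is then recorded by the lengths of the two pieces
   of the edge.  Balancing at such a vertex says that h is affine across it.
   So each labelled point adds one coordinate (its position) both to the cell of
   the type and to its expected dimension; regularity is not affected.
   A bounded edge e carries an auxiliary orientation from [src e] to [tgt e],
   and [dir e] is the direction of the flag (src e, e); that of (tgt e, e) is
   then [- dir e].  [lab i] is the vertex V_(i+1). *)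
Record ctype (r : nat) := CType {
  nvert : nat;
  nbedge : nat;
  nend : nat;
  src : 'I_nbedge -> 'I_nvert;
  tgt : 'I_nbedge -> 'I_nvert;
  dir : 'I_nbedge -> int;
  evert : 'I_nend -> 'I_nvert;
  edir : 'I_nend -> int;
  lab : 'I_r.+1 -> 'I_nvert }.

(* Flags (V, e) with V an inner vertex: [inl (e, false)] is (src e, e),
   [inl (e, true)] is (tgt e, e), and [inr e] is the flag of the end e. *)
Definition flag (r : nat) (a : ctype r) : finType :=
  ('I_(nbedge a) * bool + 'I_(nend a))%type.

Definition fvert (r : nat) (a : ctype r) (f : flag a) : 'I_(nvert a) :=
  match f with
  | inl (e, b) => if b then tgt e else src e
  | inr e => evert e
  end.

Definition fdir (r : nat) (a : ctype r) (f : flag a) : int :=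
  match f with
  | inl (e, b) => if b then - dir e else dir e
  | inr e => edir e
  end.

(* The other flag of the same edge, for a bounded edge. *)
Definition fopp (r : nat) (a : ctype r) (f : flag a) : flag a :=
  match f with
  | inl (e, b) => inl (e, ~~ b)
  | inr e => inr e
  end.

Definition valence (r : nat) (a : ctype r) (v : 'I_(nvert a)) : nat :=
  #|[set f : flag a | fvert f == v]|.

Definition nlab (r : nat) (a : ctype r) (v : 'I_(nvert a)) : nat :=
  #|[set i | lab a i == v]|.

Definition adj (r : nat) (a : ctype r) (P : pred (flag a)) :
    rel 'I_(nvert a) :=
  fun v w => [exists f : flag a, [&& P f, fvert f == v & fvert (fopp f) == w]].

(* The boundary map of the simplicial chain complex of the graph; the ends do
   not contribute to its homology. *)
Definition bdry (r : nat) (a : ctype r) : 'M[int]_(nvert a, nbedge a) :=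
  \matrix_(v, e) ((tgt e == v)%:R - (src e == v)%:R).

Definition h1 (r : nat) (a : ctype r) : nat :=
  \rank (kermx (map_mx intr (bdry a)^T : 'M[rat]_(nbedge a, nvert a))).

(* [0 < nlab v] only matters at the 2-valent vertices: an unlabelled point in
   the interior of an edge is not a vertex. *)
Record is_ctype (r : nat) (g : nat) (D : seq int) (a : ctype r) : Prop := {
  ctype_connected : forall v w, connect (adj (a := a) predT) v w;
  ctype_genus : (h1 a <= g)%N;
  ctype_valence : forall v : 'I_(nvert a), (1 < valence v)%N;
  ctype_labels : forall v : 'I_(nvert a),
    (0 < nlab v)%N /\ exists k, (nlab v + 2 = valence v + 2 * k)%N;
  ctype_balanced : forall v, \sum_(f : flag a | fvert f == v) fdir f = 0;
  ctype_degree : perm_eq [seq edir i | i : 'I_(nend a) <- enum 'I_(nend a)] D }.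

(** * Cells *)

(* A parametrized curve of type a: the values of h at the inner vertices and
   the lengths of the bounded edges. *)
Record curve (R : realType) (r : nat) (a : ctype r) := Curve {
  hv : 'I_(nvert a) -> R;
  len : 'I_(nbedge a) -> R }.

Definition flen (R : realType) (r : nat) (a : ctype r) (C : curve R a)
    (f : flag a) : \bar R :=
  match f with
  | inl (e, _) => (len C e)%:E
  | inr _ => +oo%E
  end.

Definition is_affine (R : realType) (r : nat) (a : ctype r) (C : curve R a) :
    Prop :=
  forall e : 'I_(nbedge a), hv C (tgt e) - hv C (src e) = (dir e)%:~R * len C e.

Definition cell (R : realType) (r : nat) (a : ctype r) : set (curve R a) :=
  [set C | is_affine C /\ forall e, 0 < len C e]%classic.

(* When [cell R a] is nonempty, this is its closure. *)
Definition closed_cell (R : realType) (r : nat) (a : ctype r) :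
    set (curve R a) :=
  [set C | is_affine C /\ forall e, 0 <= len C e]%classic.

Definition iso_curve (R : realType) (r : nat) (a b : ctype r)
    (C : curve R a) (C' : curve R b) : Prop :=
  exists (phiV : 'I_(nvert a) -> 'I_(nvert b)) (phiF : flag a -> flag b),
    (bijective phiV /\ bijective phiF) /\
    [/\ forall f, fvert (phiF f) = phiV (fvert f),
        forall f, fopp (phiF f) = phiF (fopp f) &
        forall i, lab b i = phiV (lab a i)] /\
    [/\ forall f, fdir (phiF f) = fdir f,
        forall f, flen C' (phiF f) = flen C f &
        forall v, hv C' (phiV v) = hv C v].

(* [C'] is obtained from [C] by contracting the edges of length 0; [phiF]
   identifies the flags of [C'] with the flags of [C] that survive. *)
Definition contracts_to (R : realType) (r : nat) (b a : ctype r)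
    (C : curve R b) (C' : curve R a) : Prop :=
  exists (phiV : 'I_(nvert b) -> 'I_(nvert a)) (phiF : flag a -> flag b),
    [/\ forall w, exists v, phiV v = w,
        forall v v', phiV v = phiV v' <->
          connect (adj (a := b) (fun f => flen C f == 0%:E)) v v',
        injective phiF &
        forall f, (exists f', phiF f' = f) <-> flen C f <> 0%:E] /\
    [/\ forall f, fvert f = phiV (fvert (phiF f)),
        forall f, fopp (phiF f) = phiF (fopp f) &
        forall i, lab a i = phiV (lab b i)] /\
    [/\ forall f, fdir f = fdir (phiF f),
        forall f, flen C' f = flen C (phiF f) &
        forall v, hv C' (phiV v) = hv C v].

Definition in_closure (R : realType) (r : nat) (a b : ctype r) : Prop :=
  forall C' : curve R a, cell C' ->
    exists2 C : curve R b, closed_cell C & contracts_to C C'.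

(** * Lattices and dimensions *)

(* The columns of B are a Z-basis of L. *)
Definition is_lattice_basis (n m : nat) (L : set 'cV[int]_n)
    (B : 'M[int]_(n, m)) : Prop :=
  (forall c : 'cV[int]_m, B *m c = 0 -> c = 0) /\
  (forall x, L x <-> exists c : 'cV[int]_m, x = B *m c).

(* A chosen basis; it is 0 if L has no basis of m elements. *)
Definition lattice_basis (n m : nat) (L : set 'cV[int]_n) : 'M[int]_(n, m) :=
  xget 0 [set B | is_lattice_basis L B]%classic.

(* The index of the image of A in Z^m; it is 0 if that index is infinite. *)
Definition image_index (m n : nat) (A : 'M[int]_(m, n)) : nat :=
  #|` fset_set [set K : set 'cV[int]_m | exists y,
        K = [set z | exists x : 'cV[int]_n, z = y + A *m x]]%classic |.

Definition cycle_basis (r : nat) (a : ctype r) : 'M[int]_(nbedge a, h1 a) :=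
  lattice_basis (h1 a) [set z | bdry a *m z = 0]%classic.

Definition dir_mx (r : nat) (a : ctype r) : 'M[int]_(nbedge a) :=
  diag_mx (\row_e dir e).

(* The first column is that of the coordinate h(V_1). *)
Definition loop_mx (r : nat) (a : ctype r) :
    'M[int]_(h1 a, 1 + nbedge a) :=
  row_mx 0 ((cycle_basis a)^T *m dir_mx a).

(* The dimension of the polyhedron with coordinates h(V_1) and the lengths of
   the bounded edges: it is open in the kernel of [loop_mx a]. *)
Definition cell_dim (r : nat) (a : ctype r) : nat :=
  (1 + nbedge a - \rank (map_mx intr (loop_mx a) : 'M[rat]_(_, _)))%N.

Definition regular (r : nat) (a : ctype r) : Prop :=
  cell_dim a = (1 + nbedge a - h1 a)%N.

(** * The moduli space and the branch map *)

(* The target of br has dimension r+1 = #D - 2 + 2g. *)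
Definition in_moduli (R : realType) (r g : nat) (D : seq int) (a : ctype r)
    (C : curve R a) : Prop :=
  [/\ is_ctype g D a,
      cell C,
      (r.+1 <= cell_dim a)%N -> regular a &
      (cell_dim a < r.+1)%N ->
        exists b : ctype r,
          [/\ is_ctype g D b, exists C' : curve R b, cell C',
              regular b, cell_dim b = r.+1 & in_closure R a b]].

Definition br (R : realType) (r : nat) (a : ctype r) (C : curve R a) :
    'rV[R]_r.+1 :=
  \row_i hv C (lab a i).

(** * Weights and multiplicities *)

(* Two flags are related if they belong to the same edge or share a vertex
   other than v.  The classes of the equivalence relation generated by this are
   the connected components of the complement of v. *)
Definition linked (r : nat) (a : ctype r) (v : 'I_(nvert a)) : rel (flag a) :=
  fun f f' => (f' == fopp f) || ((fvert f == fvert f') && (fvert f != v)).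

Definition component (r : nat) (a : ctype r) (v : 'I_(nvert a)) (f : flag a) :
    {set flag a} :=
  [set f' | connect (linked v) f f'].

(* The edges of a component that lead to v are half-open in it: v itself and
   its labels do not belong to the component. *)
Definition same_type (r : nat) (a : ctype r) (v : 'I_(nvert a))
    (K L : {set flag a}) : bool :=
  [exists phi : {ffun flag a -> flag a},
    [&& dinjectiveb phi (mem K), phi @: K == L &
      [forall f in K,
        [&& fopp (phi f) == phi (fopp f), fdir (phi f) == fdir f,
            (fvert (phi f) == v) == (fvert f == v),
            [forall f' in K,
              (fvert (phi f) == fvert (phi f')) == (fvert f == fvert f')] &
            (fvert f != v) ==>
              [forall i, (lab a i == fvert (phi f)) == (lab a i == fvert f)]]]]].

Definition twin_vertex (r : nat) (a : ctype r) (v : 'I_(nvert a)) : bool :=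
  [exists f, exists f', (component v f != component v f') &&
    same_type v (component v f) (component v f')].

(* The pairs of edges forming a cycle, listed in increasing order. *)
Definition twin_edges (r : nat) (a : ctype r)
    (p : 'I_(nbedge a) * 'I_(nbedge a)) : bool :=
  [&& (p.1 < p.2)%N, src p.1 != tgt p.1,
      [set src p.1; tgt p.1] == [set src p.2; tgt p.2] &
      `|dir p.1| == `|dir p.2|].

Definition weight (r : nat) (a : ctype r) : rat :=
  (image_index (loop_mx a))%:R
  * 2%:R^-1 ^+ #|[set v | twin_vertex (a := a) v]|
  * 2%:R^-1 ^+ #|[set p | twin_edges (a := a) p]|.

(* A chain of flags from V_1 to v. *)
Definition chain_to (r : nat) (a : ctype r) (v : 'I_(nvert a)) :
    'cV[int]_(nbedge a) :=
  xget 0 [set c | bdry a *m c = delta_mx v 0 - delta_mx (lab a ord0) 0]%classic.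

(* br in the coordinates of the cell: h(V_i) is the sum of h(V_1) and of the
   terms v(V,e) l(e) along a chain of flags from V_1 to V_i. *)
Definition br_mx (r : nat) (a : ctype r) : 'M[int]_(r.+1, 1 + nbedge a) :=
  \matrix_(i < r.+1)
    row_mx (1%:M : 'M_1) ((chain_to (lab a i))^T *m dir_mx a).

Definition br_det (r : nat) (a : ctype r) : int :=
  \det (br_mx a *m
    lattice_basis r.+1 [set x | loop_mx a *m x = 0]%classic).

Definition mult_br (r : nat) (a : ctype r) : rat :=
  weight a * `|br_det a|%:~R.

(* deg(br) is defined and equals q: for every p with pairwise distinct
   coordinates, the fibre of br over p consists of finitely many curves up to
   isomorphism, listed by [C], all lying in cells of highest dimension, and
   their multiplicities add up to q. *)
Definition degree_br_is (R : realType) (r g : nat) (D : seq int) (q : rat) :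
    Prop :=
  forall p : 'rV[R]_r.+1, injective (p ord0) ->
    exists (m : nat) (a : 'I_m -> ctype r) (C : forall j, curve R (a j)),
      [/\ forall j, in_moduli g D (C j) /\ br (C j) = p,
          forall j, cell_dim (a j) = r.+1,
          forall j k, iso_curve (C j) (C k) -> j = k,
          forall (b : ctype r) (C' : curve R b),
            in_moduli g D C' -> br C' = p -> exists j, iso_curve C' (C j) &
          \sum_(j < m) mult_br (a j) = q].

(* Main.v *)
Require Import Defs.
From mathcomp Require Import finmap classical_sets cardinality.
From mathcomp Require Import all_boot all_order all_algebra all_fingroup.
From mathcomp Require Import zify reals constructive_ereal.

(* Order the points p_i.  Both sides count monodromy graphs: trivalent graphs on
   the vertices 1, ..., r+1 (in this order on the line), with weighted edges going
   upwards and balanced at each vertex; such a graph contributes the product of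
   the weights of its bounded edges divided by the order of its automorphism group.

   Hurwitz side.  The cycles of the partial products sigma_eta, sigma_eta tau_1,
   ... of a factorization in S_d are the edges of such a graph, as multiplication
   by a transposition joins two cycles or cuts one.  Label the cycles by the edges
   of a fixed graph.  There are d! / (product of the weights of the initial ends)
   choices of sigma_eta with its labels, and at each vertex the number of choices
   of the transposition is the product of the weights of the incoming edges: w1 w2
   for a join, w for a cut.  This gives d! times the product of the weights of the
   bounded edges, and the automorphisms of the graph act simply transitively on
   the labellings of a given factorization.

   Tropical side.  A curve in the fibre over p is determined by its graph, since
   the heights of all vertices are given.  If A is the loop matrix, I |det br| is
   the absolute value of the determinant of A stacked on br; that matrix is a
   unimodular one (cycles and chains generate the lattice of all chains) times the
   diagonal matrix of the weights.  An automorphism fixes the vertices, hence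
   permutes edges of the same weight with the same ends; no three edges are
   parallel, so each twin vertex and each twin pair of edges gives a factor 2. *)

Set Implicit Arguments.
Unset Strict Implicit.
Unset Printing Implicit Defensive.

Import GroupScope.

(** * Cycles and transpositions *)

(** Since the vertices are numbered by height, an isomorphism class of monodromy graphs is a
    multiset of triples, and an automorphism is a permutation of the indices that preserves triples.
    The index type varies (cycles of a path, flags of a curve, positions in a list), hence the
    families [f : I -> edge], compared by [perm_eq] of their codomains. The obstacle on the Hurwitz
    side is that cycles have no names. Labelling sheets by edges makes the count local, and the
    labellings of a factorization form one orbit of the automorphisms because labels can be read off
    the permutations: trivalence and balance with positive weights forbid a change of label on an
    unchanged cycle. On the tropical side distinct heights force one label per vertex, hence valence
    3, and then no edge is contracted. So the diagonal matrix of weights has nonzero determinant,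
    and the same unimodular matrix yields the dimension of the cell, its regularity and the
    multiplicity. The bound r+1 > 0 serves to exclude edges from minus to plus infinity, which meet
    no vertex. *)

Section PorbitMerge.
Variables (T : finType).
Implicit Types (s : {perm T}) (x y z : T).

(** Iterating from [z], the product agrees with [s] until [s] first arrives at [x], since [y] is not
    on this cycle; there the transposition diverts it to [y]. *)
Lemma porbit_mul_tperm_reach s x y z :
  z \in porbit s x -> y \notin porbit s x -> y \in porbit (s * tperm x y) z.
Proof.
move=> zx yx.
have [i xi] : exists i, x == (s ^+ i.+1) z.
  have /porbitP[i def_x] : x \in porbit s (s z).
    by rewrite -[s]expg1 porbit_perm expg1 porbit_sym.
  by exists i; rewrite expgS permM -def_x.
case: (ex_minnP (ex_intro _ i xi : exists i, x == (s ^+ i.+1) z)) => n /eqP xn min_n.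
have sz j : (j <= n)%N -> ((s * tperm x y) ^+ j) z = (s ^+ j) z.
  elim: j => [|j IHj] ltjn; first by rewrite !expg0.
  rewrite !expgSr !permM IHj ?(ltnW ltjn) // -[s ((s ^+ j) z)]permM -expgSr.
  apply: tpermD; apply: contraTneq ltjn.
    by move/eqP/min_n; rewrite -leqNgt.
  move=> yj; case/negP: yx; rewrite yj.
  by rewrite -(eqP (_ : porbit s z == porbit s x)) ?mem_porbit // eq_porbit_mem.
apply/porbitP; exists n.+1.
by rewrite expgSr permM sz // permM -[s _]permM -expgSr -xn tpermL.
Qed.

Lemma porbit_stable s (U : {set T}) z :
  (forall u, u \in U -> s u \in U) -> z \in U -> porbit s z \subset U.
Proof.
move=> sU zU; apply/subsetP=> _ /porbitP[i ->].
by elim: i => [|i IHi]; rewrite ?expg0 ?perm1 // expgSr permM sU.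
Qed.

Lemma porbit_perm1 s x z : (s z \in porbit s x) = (z \in porbit s x).
Proof. by rewrite -!eq_porbit_mem -(porbit_perm s 1 z) expg1. Qed.

(** From the cycle of [x] one reaches [y] and from that of [y] one reaches [x], so the union is a
    single cycle; off the union the transposition is never felt. *)
Lemma porbit_merge s x y z : y \notin porbit s x ->
  porbit (s * tperm x y) z =
    if z \in porbit s x :|: porbit s y then porbit s x :|: porbit s y
    else porbit s z.
Proof.
move=> yx; set U := _ :|: _; set s' := s * _.
have xy : x \notin porbit s y by rewrite porbit_sym.
have xU : x \in U by rewrite inE porbit_id.
have yU : y \in U by rewrite inE porbit_id orbT.
have sU u : (s u \in U) = (u \in U) by rewrite !in_setU !porbit_perm1.
case: ifPn => zU.
  have s'U u : u \in U -> s' u \in U.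
    by rewrite permM -sU => uU; case: tpermP.
  have joinx u : u \in porbit s x -> y \in porbit s' u.
    by move=> ux; apply: porbit_mul_tperm_reach.
  have joiny u : u \in porbit s y -> x \in porbit s' u.
    by move=> uy; rewrite /s' tpermC porbit_mul_tperm_reach.
  have reach u : u \in U -> x \in porbit s' u.
    rewrite inE => /orP[ux|]; last exact: joiny.
    have := joinx _ ux; rewrite -eq_porbit_mem => /eqP <-.
    by apply: joiny; apply: porbit_id.
  apply/eqP; rewrite eqEsubset porbit_stable //=.
  apply/subsetP=> u uU; rewrite porbit_sym.
  by have /[!(porbit_sym s' x)] /[!(inE, =^~ eq_porbit_mem)] := reach z zU;
    move/eqP => ->; rewrite -(eqP (_ : porbit s' x == porbit s' u))
      ?porbit_id // eq_porbit_mem reach.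
have s'i i : (s' ^+ i) z = (s ^+ i) z.
  elim: i => [|i IHi]; first by rewrite !expg0.
  rewrite !expgSr !permM IHi.
  have iU : s ((s ^+ i) z) \notin U.
    rewrite sU; elim: i {IHi} => [|i IHi]; first by rewrite expg0 perm1.
    by rewrite expgSr permM sU.
  by rewrite tpermD //; apply: contraNneq iU => <-.
by apply/setP=> u; apply/porbitP/porbitP=> -[i ->]; exists i.
Qed.

(** If [y] were still on the cycle of [x], multiplying by the transposition would raise the number
    of cycles twice in a row, but doing it twice returns to [s]. *)
Lemma porbit_split s x y : x != y -> y \in porbit s x ->
  y \notin porbit (s * tperm x y) x.
Proof.
move=> xy yx; apply/negP=> yx'.
have E u : #|porbits (u * tperm x y)| + (x \notin porbit u y).*2 =
           #|porbits u| + (x != y).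
  rewrite -(porbitsV u) -(porbitV u) -porbits_mul_tperm; congr (#|pred_of_set _| + _)%N.
  by rewrite -porbitsV invMg tpermV.
have := E s; have := E (s * tperm x y).
rewrite -mulgA tperm2 mulg1 porbit_sym yx' porbit_sym yx xy /= !addn0 => ->.
by move/eqP; rewrite -addnA -{1}[#|_|]addn0 eqn_add2l.
Qed.

End PorbitMerge.

(** * Labelled cycles of a permutation *)

Lemma expg_porbit_mod (T : finType) (s : {perm T}) u i :
  (s ^+ (i %% #|porbit s u|)) u = (s ^+ i) u.
Proof.
set n := #|_|; have sn k : (s ^+ (k * n)) u = u.
  elim: k => [|k IHk]; first by rewrite expg0 perm1.
  by rewrite mulSn expgD permM [(s ^+ n) u]permX iter_porbit.
by rewrite [in RHS](divn_eq i n) expgD permM sn.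
Qed.

Lemma expg_porbit_eq (T : finType) (s : {perm T}) u i j :
  ((s ^+ i) u == (s ^+ j) u) = (i == j %[mod #|porbit s u|]).
Proof.
rewrite -(expg_porbit_mod s u i) -(expg_porbit_mod s u j).
have n_gt0 : (0 < #|porbit s u|)%N by rewrite lt0n card_porbit_neq0.
rewrite !permX -!(nth_traject s (n := #|porbit s u|)) ?ltn_mod //.
by rewrite nth_uniq ?size_traject ?ltn_mod ?uniq_traject_porbit.
Qed.

Section States.
Variables (T I : finType) (w : I -> nat).
Definition state := ({perm T} * {ffun T -> I})%type.
Implicit Types (x y : state) (A : {set I}) (p : {perm T}) (u v : T).

Definition fib x e : {set T} := [set u | x.2 u == e].

(** For positive weights the last clause makes every label of [A] occur, so a labelling is a
    bijection from the cycles to [A] that turns length into weight. *)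
Definition cyc_lab A : pred state := fun x =>
  [&& [forall u, forall v, (x.2 u == x.2 v) == (u \in porbit x.1 v)],
      [forall u, x.2 u \in A] & [forall e in A, #|fib x e| == w e]].

Lemma cyc_labP A x :
  reflect [/\ forall u v, (x.2 u == x.2 v) = (u \in porbit x.1 v),
              forall u, x.2 u \in A & forall e, e \in A -> #|fib x e| = w e]
    (cyc_lab A x).
Proof.
apply: (iffP and3P) => [[h1 h2 h3]|[h1 h2 h3]]; split.
- by move=> u v; exact: (eqP (forallP (forallP h1 u) v)).
- exact/forallP.
- by move=> e eA; exact: (eqP (forall_inP h3 e eA)).
- by apply/forallP=> u; apply/forallP=> v; apply/eqP; apply: h1.
- exact/forallP.
- by apply/forall_inP=> e /h3 ->.
Qed.

Lemma fib_porbit A x v : cyc_lab A x -> fib x (x.2 v) = porbit x.1 v.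
Proof. by case/cyc_labP=> h _ _; apply/setP=> u; rewrite inE h. Qed.

Lemma cyc_lab_perm A x u : cyc_lab A x -> x.2 (x.1 u) = x.2 u.
Proof. by case/cyc_labP=> h _ _; apply/eqP; rewrite h porbit_perm1 porbit_id. Qed.

Lemma cyc_lab_expg A x u i : cyc_lab A x -> x.2 ((x.1 ^+ i) u) = x.2 u.
Proof. by case/cyc_labP=> h _ _; apply/eqP; rewrite h mem_porbit. Qed.

Lemma card_porbit_lab A x u : cyc_lab A x -> #|porbit x.1 u| = w (x.2 u).
Proof. by move=> Ax; rewrite -(fib_porbit u Ax); case/cyc_labP: Ax => _ h1 h2; apply: h2. Qed.

Definition sact p x : state := (x.1 ^ p, [ffun u => x.2 (p^-1 u)]).

Lemma sactK p : cancel (sact p) (sact p^-1).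
Proof.
case=> s l; rewrite /sact /= conjgK; congr (_, _).
by apply/ffunP=> u; rewrite !ffunE invgK permK.
Qed.

Lemma sactKV p : cancel (sact p^-1) (sact p).
Proof. by move=> x; rewrite -{1}[p]invgK sactK. Qed.

Lemma sact_eqP p x y :
  reflect ((forall u, p (x.1 u) = y.1 (p u)) /\ (forall u, y.2 (p u) = x.2 u))
    (sact p x == y).
Proof.
apply: (iffP eqP) => [<-|[h1 h2]].
  by split=> u /=; rewrite ?permJ ?ffunE ?permK.
case: y h1 h2 => s l /= h1 h2; congr (_, _).
  by apply/permP=> u; rewrite -[u](permKV p) permJ h1.
by apply/ffunP=> u; rewrite ffunE -h2 permKV.
Qed.

Lemma sact_cyc_lab A p x : cyc_lab A x -> cyc_lab A (sact p x).
Proof.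
case/cyc_labP=> h1 h2 h3; apply/cyc_labP; split=> /= [u v|u|e /h3 <-].
- rewrite !ffunE h1 -{2}[u](permKV p) -{2}[v](permKV p).
  apply/porbitP/porbitP=> -[i E]; exists i.
    by rewrite E -conjXg permJ.
  by apply: (@perm_inj _ p); rewrite E -conjXg permJ.
- by rewrite ffunE.
rewrite -[RHS](card_imset _ (@perm_inj _ p)); apply: eq_card => u.
rewrite inE ffunE; apply/idP/imsetP=> [E|[v vE ->]].
  by exists (p^-1 u); rewrite ?inE ?permKV.
by rewrite permK; rewrite inE in vE.
Qed.

(** Such a [p] is determined by the image of one base point for each label, and this image can be
    any of the [w e] points with that label in [y]. *)
Lemma card_sact_eq A x y : (forall e, e \in A -> 0 < w e)%N ->
  cyc_lab A x -> cyc_lab A y -> #|[set p | sact p x == y]| = (\prod_(e in A) w e)%N.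
Proof.
move=> w_gt0 Ax Ay; have [xA1 xA2 xA3] := cyc_labP _ _ Ax.
have [yA1 yA2 yA3] := cyc_labP _ _ Ay.
(* Off [A] the only value is [None], so these labels contribute a factor 1. *)
pose F e : pred (option T) := if e \in A
  then [pred o | if o is Some u then y.2 u == e else false] else pred1 None.
have cardF e : #|F e| = if e \in A then w e else 1%N.
  rewrite /F; case: ifP => [eA|_]; last by rewrite card1.
  rewrite -(yA3 e eA) -[RHS](card_imset _ (@Some_inj _)); apply: eq_card => -[u|].
    by rewrite mem_imset ?inE //; exact: Some_inj.
  by rewrite !inE; apply/esym/imsetP=> -[].
have -> : (\prod_(e in A) w e)%N = #|family F|.
  rewrite card_family foldrE big_map big_enum big_mkcond.
  by apply: eq_bigr => e _; rewrite cardF.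
pose b e := odflt None (omap Some [pick u | x.2 u == e]).
have bP e : e \in A -> exists2 u, b e = Some u & x.2 u = e.
  move=> eA; rewrite /b; case: pickP => [u /eqP|no]; first by exists u.
  have := w_gt0 e eA; rewrite -xA3 // => /card_gt0P[u].
  by rewrite inE no.
pose G p : {ffun I -> option T} := [ffun e => if e \in A then omap p (b e) else None].
rewrite -(card_in_imset (f := G)).
  apply: eq_card => phi; apply/imsetP/familyP => [[p]|phiF].
    rewrite inE => /sact_eqP[p1 p2] -> e; rewrite ffunE /F.
    case: ifP => // eA; have [u -> ux] := bP e eA.
    by rewrite inE /= p2 ux.
  have phiP e : e \in A -> exists2 v, phi e = Some v & y.2 v = e.
    move=> eA; have := phiF e; rewrite /F eA inE.
    by case: (phi e) => // v /eqP <-; exists v.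
  pose idx u v := odflt ord0 [pick i : 'I_#|T|.+1 | (x.1 ^+ i) u == v].
  have idxP u v : v \in porbit x.1 u -> (x.1 ^+ idx u v) u = v.
    move=> /porbitP[i Ei]; rewrite /idx; case: pickP => [j /eqP //|/=].
    have lti : (i %% #|porbit x.1 u| < #|T|.+1)%N.
      apply: (@leq_trans #|porbit x.1 u|); last exact/leqW/max_card.
      by rewrite ltn_mod lt0n card_porbit_neq0.
    by move/(_ (Ordinal lti)); rewrite /= expg_porbit_mod -Ei eqxx.
  (* Write [u] as the [i]-th iterate of its base point and send it to the [i]-th iterate of the
     prescribed image; [i] matters only modulo the weight, the common length of the two cycles. *)
  pose q u := odflt u (obind (fun v => omap (fun v' => (y.1 ^+ idx v u) v') (phi (x.2 u))) (b (x.2 u))).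
  have qP u v v' i : b (x.2 u) = Some v -> phi (x.2 u) = Some v' ->
      (x.1 ^+ i) v = u -> q u = (y.1 ^+ i) v'.
    move=> bv phiv' iu; rewrite /q bv phiv' /=; apply/eqP.
    have [v1 [v1E v1x]] := bP _ (xA2 u).
    have [v2 [v2E v2y]] := phiP _ (xA2 u).
    move: v1x v2y; rewrite bv in v1E; case: v1E => <- vx.
    rewrite phiv' in v2E; case: v2E => <- vy.
    rewrite expg_porbit_eq (card_porbit_lab _ Ay) vy -vx.
    rewrite -(card_porbit_lab _ Ax) -expg_porbit_eq iu idxP //.
    by rewrite -iu mem_porbit.
  have decomp u : exists v v' i, [/\ b (x.2 u) = Some v, phi (x.2 u) = Some v',
      (x.1 ^+ i) v = u & y.2 v' = x.2 u].
    have [v bv vx] := bP _ (xA2 u); have [v' pv vy] := phiP _ (xA2 u).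
    have : u \in porbit x.1 v by rewrite -xA1 vx.
    by case/porbitP=> i ui; exists v, v', i.
  have q2 u : y.2 (q u) = x.2 u.
    have [v [v' [i [bv pv iu <-]]]] := decomp u.
    by rewrite (qP _ _ _ _ bv pv iu) (cyc_lab_expg _ _ Ay).
  have q1 u : q (x.1 u) = y.1 (q u).
    have [v [v' [i [bv pv iu _]]]] := decomp u.
    rewrite (qP _ _ _ _ bv pv iu) -permM -expgSr.
    rewrite (qP (x.1 u) v v' i.+1) ?(cyc_lab_perm _ Ax) //.
    by rewrite expgSr permM iu.
  have q_inj : injective q.
    move=> u1 u2 E.
    have Exu : x.2 u1 = x.2 u2 by rewrite -!q2 E.
    have [v [v' [i [bv pv iu v'y]]]] := decomp u1.
    have : u2 \in porbit x.1 v.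
      rewrite -xA1 -Exu; have [v1 E1 <-] := bP _ (xA2 u1).
      by move: E1; rewrite bv => -[->].
    case/porbitP=> j ju; rewrite Exu in bv pv.
    move: E; rewrite (qP u1 v v' i) ?Exu // (qP u2 v v' j) // => /eqP.
    rewrite expg_porbit_eq (card_porbit_lab _ Ay) v'y -iu (cyc_lab_expg _ _ Ax).
    by rewrite -(card_porbit_lab _ Ax) -expg_porbit_eq -ju iu => /eqP.
  exists (perm q_inj).
    by rewrite inE; apply/sact_eqP; split=> u; rewrite !permE.
  apply/ffunP=> e; rewrite ffunE; case: ifP => eA; last first.
    by have := phiF e; rewrite /F eA inE => /eqP.
  have [v bv vx] := bP e eA; have [v' pv _] := phiP e eA.
  rewrite bv pv /= permE (qP v v v' 0) ?vx ?expg0 ?perm1 //.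
move=> p p'; rewrite !inE => /sact_eqP[p1 p2] /sact_eqP[p1' p2'] E.
have pX i u : p ((x.1 ^+ i) u) = (y.1 ^+ i) (p u).
  by elim: i => [|i IHi]; rewrite ?expg0 ?perm1 // !expgSr !permM p1 IHi.
have pX' i u : p' ((x.1 ^+ i) u) = (y.1 ^+ i) (p' u).
  by elim: i => [|i IHi]; rewrite ?expg0 ?perm1 // !expgSr !permM p1' IHi.
apply/permP=> u; have [v bv vx] := bP _ (xA2 u).
have : u \in porbit x.1 v by rewrite -xA1 vx.
case/porbitP=> i ->; rewrite pX pX'; congr (_ _).
by move/ffunP/(_ (x.2 u)): E; rewrite !ffunE xA2 bv => -[].
Qed.

Lemma sact_trans A x y : (forall e, e \in A -> 0 < w e)%N ->
  cyc_lab A x -> cyc_lab A y -> exists p, sact p x = y.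
Proof.
move=> w_gt0 Ax Ay; have : (0 < #|[set p | sact p x == y]|)%N.
  by rewrite (card_sact_eq w_gt0 Ax Ay) prodn_cond_gt0.
by case/card_gt0P=> p; rewrite inE => /eqP; exists p.
Qed.

(** Orbit and stabilizer: the states form one orbit of the symmetric group, and the fibres of the
    orbit map of [x] all have the size found above. *)
Lemma card_cyc_lab_of A x : (forall e, e \in A -> 0 < w e)%N -> cyc_lab A x ->
  (#|cyc_lab A| * \prod_(e in A) w e)%N = #|T| `!.
Proof.
move=> w_gt0 Ax.
have -> : #|T| `! = #|[set: {perm T}]|.
  rewrite -[#|T|]cardsT -card_perm; apply: eq_card => p.
  by rewrite !inE; apply/subsetP.
rewrite -[RHS]sum1_card (partition_big (fun p => sact p x) (cyc_lab A)) /=; last first.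
  by move=> p _; apply: sact_cyc_lab.
rewrite -sum_nat_const; apply: eq_bigr => y Ay.
rewrite -(card_sact_eq w_gt0 Ax Ay) -sum1_card.
by apply: eq_bigl => p; rewrite !inE.
Qed.

End States.

(** The set is identified with a disjoint union of cyclic groups of order [w e] for [e] in [A], on
    which the permutation adds 1. *)
Lemma exists_cyc_lab (T I : finType) (w : I -> nat) (A : {set I}) :
  (\sum_(e in A) w e)%N = #|T| -> exists x : state T I, cyc_lab w A x.
Proof.
move=> sumw; pose w' e := if e \in A then w e else 0.
pose S := {e : I & 'I_(w' e)}.
have cardS : #|T| = #|{: S}|.
  rewrite card_tagged sumnE big_map big_enum -sumw big_mkcond /=.
  by apply: eq_bigr => e _; rewrite card_ord.
pose h u : S := enum_val (cast_ord cardS (enum_rank u)).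
pose g (z : S) : T := enum_val (cast_ord (esym cardS) (enum_rank z)).
have hK : cancel h g.
  by move=> u; rewrite /g /h enum_valK cast_ordK enum_rankK.
have gK : cancel g h.
  by move=> z; rewrite /g /h enum_valK cast_ordKV enum_rankK.
pose rt (z : S) : S := Tagged (fun e => 'I_(w' e)) (ordS (tagged z)).
have rt_inj : injective rt.
  by case=> e j [e' j'] /eqP; rewrite /rt -tag_eqE /tag_eq /= => /andP[/eqP E];
     subst e'; rewrite tagged_asE => /eqP/(can_inj (@ordSK _)) ->.
have s_inj : injective (fun u => g (rt (h u))).
  by move=> u v /(can_inj gK)/rt_inj/(can_inj hK).
pose s := perm s_inj.
have si i u : h ((s ^+ i) u) = iter i rt (h u).
  elim: i => [|i IHi]; first by rewrite expg0 perm1.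
  by rewrite expgSr permM permE gK IHi.
have tagi i z : tag (iter i rt z) = tag z by elim: i.
have vali i z : val (tagged (iter i rt z)) = ((tagged z + i) %% w' (tag z))%N.
  elim: i z => [|i IHi] z; first by rewrite addn0 modn_small.
  by rewrite iterSr IHi /= modnDml addSnnS.
have orbP u v : (u \in porbit s v) = (tag (h u) == tag (h v)).
  apply/porbitP/eqP => [[i ->]|]; first by rewrite si tagi.
  move: (gK (h u)) (gK (h v)); rewrite !hK.
  case Eu: (h u) => [e j]; case Ev: (h v) => [e' j'] /= _ _ E; subst e'.
  (* Adding [w' e] keeps the difference of [j] and [j'] from being truncated and does not change its
     class. *)
  exists (j + w' e - j')%N; apply: (can_inj hK); rewrite si Eu Ev.
  case E: (iter _ _ _) => [e1 j1].
  have E1 := tagi (j + w' e - j')%N (existT _ e j'); rewrite E /= in E1; subst e1.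
  congr existT; apply: val_inj; have := vali (j + w' e - j')%N (existT _ e j').
  rewrite E /= subnKC; last by rewrite ltnW // ltn_addl.
  by rewrite addnC modnDl modn_small.
exists (s, [ffun u => tag (h u)]); apply/cyc_labP; split=> /=.
- by move=> u v; rewrite !ffunE orbP.
- move=> u; rewrite ffunE; case: (h u) => e j /=; move: (ltn_ord j).
  by rewrite {2}/w'; case: ifP.
move=> e eA; rewrite -[w e]card_ord.
have [Ew] : w' e = w e by rewrite /w' eA.
rewrite -Ew -[LHS](card_imset _ (can_inj hK)).
have Tinj : injective (fun j => Tagged (fun e => 'I_(w' e)) (j : 'I_(w' e))).
  by move=> j j' /eqP; rewrite -tag_eqE /tag_eq /= tagged_asE eqxx => /eqP.
rewrite -[RHS](card_imset _ Tinj); apply: eq_card => z.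
apply/imsetP/imsetP => [[u]|[j _ ->]].
  by rewrite inE /= ffunE => /eqP <- ->; exists (tagged (h u)) => //; case: (h u).
by exists (g (Tagged (fun e => 'I_(w' e)) j)); rewrite ?inE /= ?ffunE gK.
Qed.

(** * Counting the successors of a labelled permutation *)

Section Step.
Variables (d : nat) (I : finType) (w : I -> nat).
Implicit Types (A B : {set I}) (x y : state 'I_d I).

Definition step A B x y :=
  is_transposition (x.1^-1 * y.1) &&
  [forall u, (x.2 u != y.2 u) ==> (x.2 u \notin B) && (y.2 u \notin A)].

Lemma is_transpositionP (t : 'S_d) :
  reflect (exists u v, u != v /\ t = tperm u v) (is_transposition t).
Proof.
apply: (iffP existsP) => [[u /existsP[v /andP[uv /eqP ->]]]|[u [v [uv ->]]]].
  by exists u, v.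
by exists u; apply/existsP; exists v; rewrite uv /=.
Qed.

Lemma stepP A B x y :
  reflect (exists u v, [/\ u != v, y.1 = x.1 * tperm u v &
             forall z, x.2 z != y.2 z -> x.2 z \notin B /\ y.2 z \notin A])
    (step A B x y).
Proof.
apply: (iffP andP) => [[/is_transpositionP[u [v [uv E]]] /forallP h]|].
  exists u, v; split=> // [|z xz]; first by rewrite -E mulKVg.
  by apply/andP; have := h z; rewrite xz.
case=> u [v [uv E h]]; split.
  by apply/is_transpositionP; exists u, v; rewrite E mulKg.
by apply/forallP=> z; apply/implyP=> /h[-> ->].
Qed.

Lemma step_sym A B x y : step A B x y = step B A y x.
Proof.
apply/stepP/stepP=> -[u [v [uv E h]]]; exists u, v; split=> //.
- by rewrite E -mulgA tperm2 mulg1.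
- by move=> z; rewrite eq_sym => /h[].
- by rewrite E -mulgA tperm2 mulg1.
- by move=> z; rewrite eq_sym => /h[].
Qed.

Lemma step_sact A B (p : 'S_d) x y : step A B (sact p x) (sact p y) = step A B x y.
Proof.
suff imp q x' y' : step A B x' y' -> step A B (sact q x') (sact q y').
  apply/idP/idP; last exact: imp.
  by move/(imp p^-1); rewrite !sactK.
case/stepP=> u [v [uv E h]]; apply/stepP; exists (q u), (q v); split.
- by rewrite (inj_eq perm_inj).
- by rewrite /= E conjMg tpermJ.
by move=> z; rewrite !ffunE => /h.
Qed.

Lemma step_fib A B x y e : step A B x y -> e \in A -> e \in B -> fib x e = fib y e.
Proof.
case/stepP=> u [v [_ _ h]] eA eB; apply/setP=> z; rewrite !inE.
by apply/eqP/eqP=> ze; apply/eqP; apply: contraTT isT => ne;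
  [have [] := h z | have [] := h z]; rewrite ?ze ?eA ?eB // eq_sym.
Qed.

Lemma join_succ A B e1 e2 e x : (forall e, e \in A -> 0 < w e)%N ->
  e1 != e2 -> A :\: B = [set e1; e2] -> B :\: A = [set e] ->
  w e = (w e1 + w e2)%N -> cyc_lab w A x ->
  #|[set y | cyc_lab w B y && step A B x y]| = (w e1 * w e2)%N.
Proof.
move=> w_gt0 ne12 dA dB we Ax; have [x1 x2 x3] := cyc_labP _ _ _ Ax.
have /andP[e1A e1B] : (e1 \in A) && (e1 \notin B).
  by have /setP/(_ e1) := dA; rewrite !inE eqxx andbC.
have /andP[e2A e2B] : (e2 \in A) && (e2 \notin B).
  by have /setP/(_ e2) := dA; rewrite !inE eqxx orbT andbC.
have /andP[eA eB] : (e \notin A) && (e \in B) by have /setP/(_ e) := dB; rewrite !inE eqxx.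
have inB f : f \in B -> (f \in A) || (f == e).
  by move=> fB; have /setP/(_ f) := dB; rewrite !inE fB andbT => <-; case: (f \in A).
have inA f : f \in A -> f \notin [set e1; e2] -> f \in B.
  by move=> fA; rewrite -dA !inE fA andbT negbK.
(* The relabelling is forced, so a successor amounts to its transposition: one point on the cycle
   [e1] and one on [e2]. *)
pose F (uv : 'I_d * 'I_d) : state 'I_d I := (x.1 * tperm uv.1 uv.2,
  [ffun z => if x.2 z \in [set e1; e2] then e else x.2 z]).
rewrite -(x3 e1 e1A) -(x3 e2 e2A) -cardsX -(card_in_imset (f := F)); last first.
  move=> [u v] [u' v'] /setXP[/=]; rewrite !inE => /eqP u1 /eqP v2.
  case/andP=> /= /eqP u1' /eqP v2'; rewrite /F /= => -[/mulgI/permP/(_ u) E].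
  move: E; rewrite tpermL; case: tpermP => [-> -> //|uE _|_ _ vu].
    by rewrite -u1 uE v2' eqxx in ne12.
  by rewrite -u1 -v2 vu eqxx in ne12.
have x12 z : x.2 z \notin B -> x.2 z \in [set e1; e2].
  by move=> xB; rewrite -dA inE xB x2.
have x12B z : x.2 z \in [set e1; e2] -> x.2 z \notin B.
  by rewrite -dA inE => /andP[].
apply: eq_card => y; rewrite inE; apply/andP/imsetP.
  case=> By /stepP[u [v [uv yE h]]]; have [y1 y2 y3] := cyc_labP _ _ _ By.
  have yB z : x.2 z \in B -> y.2 z = x.2 z.
    by move=> zB; apply/eqP; apply: contraTT zB => ne; case: (h z); rewrite // eq_sym.
  have y12 z : x.2 z \notin B -> y.2 z = e.
    move=> zB; have ne : x.2 z != y.2 z by apply: contraNneq zB => ->.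
    have [_ yA] := h z ne; have := inB _ (y2 z).
    by rewrite (negPf yA) => /eqP.
  have yF : y.2 = [ffun z => if x.2 z \in [set e1; e2] then e else x.2 z].
    apply/ffunP=> z; rewrite ffunE; case: ifPn => [/x12B/y12 //|z12].
    by apply: yB; apply: contraNT z12; apply: x12.
  (* If [a] carried a surviving label, the join would give this old label to [b], whose label may
     only become a new one. *)
  have notin a b : b \notin porbit x.1 a -> y.1 = x.1 * tperm a b -> x.2 a \notin B.
    move=> ba yab; apply/negP=> aB.
    have yba : y.2 b == y.2 a.
      by rewrite y1 yab porbit_merge // !in_setU !porbit_id ?orbT /= in_setU porbit_id ?orbT.
    rewrite (yB a aB) in yba; have [|_ bA] := h b.
      rewrite (eqP yba); apply: contraNneq ba => xba.
      by rewrite -x1 xba.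
    by rewrite (eqP yba) x2 in bA.
  (* A transposition within a cycle would cut it. But all points labelled [e1] or [e2] lie on one
     cycle of [y], and undoing a cut only merges cycles, so they would share a cycle of [x]. *)
  have vu : v \notin porbit x.1 u.
    apply/negP=> vu; have vu' := porbit_split uv vu; rewrite -yE in vu'.
    have xE : x.1 = y.1 * tperm u v by rewrite yE -mulgA tperm2 mulg1.
    have /card_gt0P[z1 z1E] : (0 < #|fib x e1|)%N by rewrite x3 ?w_gt0.
    have /card_gt0P[z2 z2E] : (0 < #|fib x e2|)%N by rewrite x3 ?w_gt0.
    rewrite !inE in z1E z2E; case/negP: ne12; rewrite -(eqP z1E) -(eqP z2E) x1 xE.
    have z12 : z1 \in porbit y.1 z2.
      by rewrite -y1 !y12 ?eqxx // ?(eqP z1E) ?(eqP z2E).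
    rewrite porbit_merge //; case: ifP => // z2U.
    move: z2U z12; rewrite !inE => /orP[]; rewrite -eq_porbit_mem => /eqP -> ->;
    by rewrite ?orbT.
  have uB := notin _ _ vu yE.
  have vB : x.2 v \notin B by apply: (notin v u); rewrite 1?porbit_sym // tpermC.
  have := x12 _ uB; have := x12 _ vB.
  have xuv : x.2 v != x.2 u by apply: contraNneq vu => E; rewrite -x1 E.
  rewrite !inE => /orP[]/eqP v12 /orP[]/eqP u12.
  - by rewrite u12 v12 eqxx in xuv.
  - exists (v, u); first by rewrite inE !inE u12 v12 !eqxx.
    by rewrite [LHS]surjective_pairing yF yE tpermC.
  - exists (u, v); first by rewrite inE !inE u12 v12 !eqxx.
    by rewrite [LHS]surjective_pairing yF yE.
  - by rewrite u12 v12 eqxx in xuv.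
case=> -[u v] /setXP[/=]; rewrite !inE => /eqP u1 /eqP v2 ->.
have vu : v \notin porbit x.1 u by rewrite -x1 v2 u1 eq_sym.
have U12 z : (z \in porbit x.1 u :|: porbit x.1 v) = (x.2 z \in [set e1; e2]).
  by rewrite !in_setU -!x1 u1 v2 !inE.
have eNA z : (e == x.2 z) = false by apply: contraNF eA => /eqP ->.
split; [apply/cyc_labP; split=> /=|apply/stepP].
- move=> z z'; rewrite porbit_merge // U12 !ffunE.
  case: (boolP (x.2 z' \in _)) => z'12.
    by rewrite U12; case: ifP => // z12; rewrite ?eqxx // eq_sym eNA.
  rewrite -x1; case: ifP => // z12; rewrite eNA; apply/esym.
  by apply: contraNF z'12 => /eqP <-.
- by move=> z; rewrite ffunE; case: ifPn => // z12; apply: inA.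
- move=> f fB; have [->|fe] := eqVneq f e.
    have -> : fib (F (u, v)) e = fib x e1 :|: fib x e2.
      apply/setP=> z; rewrite !inE ffunE !inE; case: ifP => //; first by rewrite eqxx.
      by move=> _; rewrite eq_sym eNA.
    rewrite cardsU (_ : _ :&: _ = set0) ?cards0 ?subn0 ?x3 //.
    apply/setP=> z; rewrite !inE; apply/negP=> /andP[/eqP-> /eqP E].
    by rewrite E eqxx in ne12.
  have fA : f \in A by move: (inB f fB); rewrite (negPf fe) orbF.
  rewrite -(x3 f fA); apply: eq_card => z; rewrite !inE ffunE !inE.
  case: ifP => //; rewrite [e == f]eq_sym (negPf fe).
  by case/orP=> /eqP ->; apply/esym; apply: contraTF fB => /eqP <-.
exists u, v; split=> //; first by apply: contraNneq vu => ->; rewrite porbit_id.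
move=> z /=; rewrite ffunE; case: ifPn => [/x12B|_]; last by rewrite eqxx.
by [].
Qed.

(* A cut is a join read backwards; as [S_d] acts transitively on the states,
   all states have the same number of successors, and counting the steps from
   both sides gives this number. *)
Lemma cut_succ A B e1 e2 e x : (forall e, e \in A -> 0 < w e)%N ->
  (forall e, e \in B -> 0 < w e)%N ->
  e1 != e2 -> A :\: B = [set e] -> B :\: A = [set e1; e2] ->
  w e = (w e1 + w e2)%N -> cyc_lab w A x ->
  #|[set y | cyc_lab w B y && step A B x y]| = w e.
Proof.
move=> wA wB ne12 dA dB we Ax.
have outdeg x' : cyc_lab w A x' -> #|[set y | cyc_lab w B y && step A B x' y]| =
    #|[set y | cyc_lab w B y && step A B x y]|.
  move=> Ax'; have [p <-] := sact_trans wA Ax Ax'.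
  rewrite -[RHS](card_imset _ (can_inj (sactK p))); apply: eq_card => y.
  rewrite inE; apply/idP/imsetP=> [/andP[By xy]|[z]]; last first.
    by rewrite inE => /andP[Bz xz] ->; rewrite sact_cyc_lab ?step_sact.
  exists (sact p^-1 y); last by rewrite sactKV.
  by rewrite inE sact_cyc_lab //= -(step_sact A B p) sactKV.
have dbl : (#|@cyc_lab 'I_d I w A| * #|[set y | cyc_lab w B y && step A B x y]| =
    #|@cyc_lab 'I_d I w B| * (w e1 * w e2))%N.
  rewrite -!sum_nat_const; transitivity
    (\sum_(x' in @cyc_lab 'I_d I w A) \sum_(y in @cyc_lab 'I_d I w B | step A B x' y) 1)%N.
    apply: eq_bigr => x' Ax'; rewrite -(outdeg x' Ax') sum1dep_card.
    by apply: eq_card => y; rewrite !inE.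
  rewrite (exchange_big_dep (mem (@cyc_lab 'I_d I w B))) //=; last by move=> ? ? _ /andP[].
  apply: eq_bigr => y By; rewrite -(join_succ wB ne12 dB dA we By).
  rewrite sum1dep_card; apply: eq_card => x'.
  by rewrite !in_set step_sym (_ : (y \in _) = true) ?andTb.
have prodA : (\prod_(e in A) w e = w e * \prod_(e in A :&: B) w e)%N.
  by rewrite (big_setID B) /= dA big_set1 mulnC.
have prodB : (\prod_(e in B) w e = w e1 * w e2 * \prod_(e in A :&: B) w e)%N.
  by rewrite (big_setID A) /= dB big_setU1 ?inE //= big_set1 mulnC setIC.
(* The cancellation below uses a state over [B]; one exists because the weights over [B] have the
   same sum [d] as those over [A]. *)
have [y /= By|noB] := pickP (@cyc_lab 'I_d I w B); last first.
  have dbl0 : #|@cyc_lab 'I_d I w B| = 0%N by apply: eq_card0.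
  have sumB : (\sum_(e in B) w e)%N = #|'I_d|.
    have [x1 x2 x3] := cyc_labP _ _ _ Ax.
    transitivity (\sum_(e in A) w e)%N.
      rewrite (big_setID A) [in RHS](big_setID B) /= dA dB setIC big_set1.
      by rewrite big_setU1 ?inE //= big_set1 we.
    rewrite -sum1_card (partition_big (fun u => x.2 u) (mem A)) //=.
    apply: eq_bigr => f fA; rewrite -x3 // -sum1_card.
    by apply: eq_bigl => u; rewrite inE.
  by have [y By] := exists_cyc_lab sumB; have := noB y; rewrite By.
have cA := card_cyc_lab_of wA Ax; have cB := card_cyc_lab_of wB By.
have fpos : (0 < #|'I_d| `!)%N by apply: fact_gt0.
apply/eqP; rewrite -(eqn_pmul2l fpos) -{1}cA -cB prodA prodB.
set n := #|[set y | _]| in dbl *; apply/eqP.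
move: dbl; set a := #|_|; set b := #|_|; set q := (\prod_(e in _) _)%N => dbl.
transitivity ((a * n) * (w e * q))%N; first by lia.
by rewrite dbl; lia.
Qed.

(** Balance with positive weights forbids three edges on one side, so the vertex is a join or a
    cut. *)
Lemma step_succ A B x : (forall e, e \in A -> 0 < w e)%N ->
  (forall e, e \in B -> 0 < w e)%N ->
  (#|A :\: B| + #|B :\: A| = 3)%N ->
  (\sum_(e in A :\: B) w e = \sum_(e in B :\: A) w e)%N -> cyc_lab w A x ->
  #|[set y | cyc_lab w B y && step A B x y]| = (\prod_(e in A :\: B) w e)%N.
Proof.
move=> wA wB c3 bal Ax.
have pos (C D : {set I}) : (forall e, e \in C -> 0 < w e)%N -> #|C :\: D| = 0 ->
    #|D :\: C| = 3 -> (forall e, e \in D -> 0 < w e)%N ->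
    (\sum_(e in C :\: D) w e)%N <> (\sum_(e in D :\: C) w e)%N.
  move=> wC C0 D3 wD; rewrite (cards0_eq C0) big_set0.
  have /card_gt0P[f fD] : (0 < #|D :\: C|)%N by rewrite D3.
  rewrite (bigD1 f) //=; have := wD f; move: fD; rewrite inE => /andP[_ ->] /(_ isT).
  by case: (w f).
have [|ne0A] := posnP #|A :\: B|.
  by move=> A0; case: (pos A B wA A0 _ wB bal); rewrite A0 in c3.
have [|ne0B] := posnP #|B :\: A|.
  by move=> B0; case: (pos B A wB B0 _ wA (esym bal)); rewrite B0 addn0 in c3.
have [A1|A1] := eqVneq #|A :\: B| 1%N.
  have /eqP/cards2P[e1 [e2 [ne12 dB]]] : #|B :\: A| = 2 by lia.
  have /eqP/cards1P[e dA] := A1; rewrite dA big_set1.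
  apply: (cut_succ (e1 := e1) (e2 := e2)) => //.
  by move: bal; rewrite dA dB big_set1 big_setU1 ?inE //= big_set1.
have /eqP/cards2P[e1 [e2 [ne12 dA]]] : #|A :\: B| = 2 by lia.
have /eqP/cards1P[e dB] : #|B :\: A| = 1%N by lia.
rewrite dA big_setU1 ?inE //= big_set1; apply: (join_succ (e := e)) => //.
by move: bal; rewrite dA dB big_set1 big_setU1 ?inE //= big_set1.
Qed.

End Step.

(** * Monodromy graphs and their realizations *)

Section Paths.
Variables (T : finType) (X : nat -> pred T) (R : nat -> rel T).

Definition paths n : {set {ffun 'I_n.+1 -> T}} :=
  [set x : {ffun 'I_n.+1 -> T} | [forall k : 'I_n.+1, X k (x k)] &&
           [forall k : 'I_n, R k (x (inord k)) (x (inord k.+1))]].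

Lemma pathsP n (x : {ffun 'I_n.+1 -> T}) :
  reflect ((forall k, k <= n -> X k (x (inord k))) /\
           (forall k, k < n -> R k (x (inord k)) (x (inord k.+1))))%N (x \in paths n).
Proof.
rewrite inE; apply: (iffP andP) => [[/forallP h1 /forallP h2]|[h1 h2]]; split.
- by move=> k lekn; have := h1 (inord k); rewrite inordK.
- by move=> k ltkn; apply: (h2 (Ordinal ltkn)).
- by apply/forallP=> k; rewrite -{2}[k]inord_val h1 // -ltnS.
- by apply/forallP=> k; apply: h2.
Qed.

Lemma card_paths (c : nat -> nat) n :
  (forall k x, k < n -> X k x -> #|[set y | X k.+1 y && R k x y]| = c k)%N ->
  #|paths n| = (#|X 0| * \prod_(k < n) c k)%N.
Proof.
elim: n => [|n IHn] outdeg.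
  rewrite big_ord0 muln1 -(card_in_imset (f := fun x : {ffun 'I_1 -> T} => x ord0)).
    apply: eq_card => y; apply/imsetP/idP => [[x /pathsP[h _] ->]|Xy].
      by have := h 0 isT; rewrite (_ : inord 0 = ord0) //; apply: val_inj; rewrite /= inordK.
    exists [ffun=> y]; last by rewrite ffunE.
    by apply/pathsP; split=> // -[|k] //; rewrite ffunE.
  by move=> x y _ _ E; apply/ffunP=> k; rewrite (ord1 k).
rewrite big_ord_recr mulnA -IHn; last by move=> k x ltkn; apply: outdeg; apply: ltnW.
pose restr (x : {ffun 'I_n.+2 -> T}) : {ffun 'I_n.+1 -> T} := [ffun k : 'I_n.+1 => x (inord k)].
have restrE x k : (k <= n)%N -> restr x (inord k) = x (inord k).
  by move=> lekn; rewrite ffunE inordK.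
rewrite -[LHS]sum1_card (partition_big restr (mem (paths n))) /=; last first.
  move=> x /pathsP[h1 h2]; apply/pathsP; split=> k lek; rewrite !restrE //.
  - by apply: h1; apply: leqW.
  - by apply: h2; apply: leqW.
  - exact: ltnW.
rewrite -sum_nat_const; apply: eq_bigr => z /pathsP[z1 z2].
rewrite -(outdeg n (z (inord n))) ?z1 // sum1dep_card.
rewrite -(card_in_imset (f := fun x : {ffun 'I_n.+2 -> T} => x (inord n.+1))).
  apply: eq_card => y; rewrite inE; apply/imsetP/andP => [[x]|[Xy Ry]].
    rewrite inE => /andP[/pathsP[h1 h2] /eqP <-] ->.
    by rewrite restrE // h1 // h2.
  pose x : {ffun 'I_n.+2 -> T} := [ffun k : 'I_n.+2 => if (k <= n)%N then z (inord k) else y].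
  have xE k : (k <= n)%N -> x (inord k) = z (inord k).
    by move=> lekn; rewrite ffunE inordK ?ltnS ?lekn // leqW.
  have xn : x (inord n.+1) = y by rewrite ffunE inordK // ltnn.
  exists x => //; rewrite inE; apply/andP; split; last first.
    by apply/eqP/ffunP=> k; rewrite -[k]inord_val restrE ?xE // -ltnS.
  apply/pathsP; split=> k; rewrite leq_eqVlt => /orP[/eqP k_eq|ltk].
  - by rewrite k_eq xn.
  - by rewrite xE // z1.
  - by case: k_eq => ->; rewrite xn xE.
  - by rewrite !xE ?z2 //; apply: ltnW.
move=> x y; rewrite !inE => /andP[_ /eqP xz] /andP[_ /eqP yz] E.
apply/ffunP=> k; rewrite -[k]inord_val; have := ltn_ord k.
rewrite ltnS leq_eqVlt => /orP[/eqP ->//|ltk].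
by rewrite -!restrE // xz yz.
Qed.

End Paths.

(* An edge is [(b, t, w)]: it leaves vertex [b - 1] (it comes from [-oo] if
   [b = 0]), it enters vertex [t] (it goes to [+oo] if [t] is the number of
   vertices) and has weight [w].  The edges with [b <= k <= t] are those over
   the points between the images of vertices [k - 1] and [k]. *)
Definition edge := (nat * nat * nat)%type.
Definition eb (e : edge) := e.1.1.
Definition et (e : edge) := e.1.2.
Definition ew (e : edge) := e.2.
Definition touches k (e : edge) := (et e == k) || (eb e == k.+1).

Lemma filter_codom (I : finType) (f : I -> edge) (p : pred edge) :
  [seq ew e | e <- codom f & p e] = [seq ew (f z) | z <- enum [set z | p (f z)]].
Proof.
rewrite codomE filter_map -map_comp; congr map.
rewrite [in RHS]/enum_mem -enumT; apply: eq_filter => z.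
exact/esym/(in_set (fun z => p (f z)) z).
Qed.

(** Connectedness is tested by two-valued functions on the edges, the form in which it meets
    invariant sets of sheets. The genus is implicit: trivalence and the number of ends determine
    it. *)
Record mgraph (s : nat) (eta nu : seq nat) (L : seq edge) : Prop := {
  mg_range : forall e, e \in L -> [/\ eb e <= et e, et e <= s & 0 < ew e]%N;
  mg_triv : forall k, (k < s)%N ->
    (count (fun e => et e == k) L + count (fun e => eb e == k.+1) L)%N = 3;
  mg_bal : forall k, (k < s)%N ->
    (\sum_(e <- L | et e == k) ew e = \sum_(e <- L | eb e == k.+1) ew e)%N;
  mg_conn : forall Q : pred edge,
    (forall k e e', (k < s)%N -> e \in L -> e' \in L ->
       touches k e -> touches k e' -> Q e = Q e') ->
    forall e e', e \in L -> e' \in L -> Q e = Q e';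
  mg_in : perm_eq [seq ew e | e <- L & eb e == 0] eta;
  mg_out : perm_eq [seq ew e | e <- L & et e == s] nu }.

Lemma mgraph_perm s eta nu L L' :
  perm_eq L L' -> mgraph s eta nu L -> mgraph s eta nu L'.
Proof.
move=> LL' [h1 h2 h3 h4 h5 h6]; have memL := perm_mem LL'.
split.
- by move=> e; rewrite -memL; apply: h1.
- by move=> k ltks; rewrite -(h2 k ltks); congr (_ + _)%N; apply/esym/(seq.permP LL').
- by move=> k ltks; rewrite -!(perm_big _ LL'); apply: h3.
- move=> Q hQ e e'; rewrite -!memL; apply: h4 => k e1 e2 ltks e1L e2L.
  by apply: hQ; rewrite -?memL.
- by apply: perm_trans h5; apply: perm_map; apply: perm_filter; rewrite perm_sym.
- by apply: perm_trans h6; apply: perm_map; apply: perm_filter; rewrite perm_sym.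
Qed.

Section Realizations.
Variables (s d : nat) (eta nu : seq nat) (I : finType) (f : I -> edge).
Hypothesis G : mgraph s eta nu (codom f).

Let w i := ew (f i).

Definition active k : {set I} := [set i | (eb (f i) <= k <= et (f i))%N].

Lemma f_range i : [/\ eb (f i) <= et (f i), et (f i) <= s & 0 < ew (f i)]%N.
Proof. exact/(mg_range G)/codom_f. Qed.

Lemma activeD k : active k :\: active k.+1 = [set i | et (f i) == k].
Proof. by apply/setP=> i; rewrite !inE; have [] := f_range i; lia. Qed.

Lemma activeDr k : active k.+1 :\: active k = [set i | eb (f i) == k.+1].
Proof. by apply/setP=> i; rewrite !inE; have [] := f_range i; lia. Qed.

Lemma active0 : active 0 = [set i | eb (f i) == 0].
Proof. by apply/setP=> i; rewrite !inE; have [] := f_range i; lia. Qed.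

Lemma count_codom (p : pred edge) : count p (codom f) = #|[set i | p (f i)]|.
Proof.
by rewrite codomE count_map -sum1_count big_enum_cond sum1dep_card.
Qed.

Lemma sum_codom (p : pred edge) (F : edge -> nat) :
  (\sum_(e <- codom f | p e) F e = \sum_(i in [set i | p (f i)]) F (f i))%N.
Proof. by rewrite codomE big_map big_enum_cond; apply: eq_bigl => i; rewrite inE. Qed.

Hypotheses (s_gt0 : (0 < s)%N) (d_eta : sumn eta = d).

Lemma sum_active0 : (\sum_(i in active 0) w i)%N = #|'I_d|.
Proof.
rewrite card_ord -d_eta -(perm_sumn (mg_in G)) sumnE big_map big_filter.
by rewrite (sum_codom (fun e => eb e == 0)) active0.
Qed.

(** An edge from minus to plus infinity meets no vertex, so the indicator of its triple is constant
    around each vertex; by connectedness all edges would have this triple, leaving vertex 0 without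
    edges. *)
Lemma no_through i : eb (f i) = 0 -> (et (f i) < s)%N.
Proof.
move=> b0; rewrite ltn_neqAle; have [_ -> _] := f_range i; rewrite andbT.
apply/eqP=> ts; pose Q : pred edge := pred1 (f i).
have noQ k e : (k < s)%N -> touches k e -> Q e = false.
  move=> ltks te; apply/negP=> /eqP E; move: te; rewrite E /touches b0 ts.
  by case/orP=> // /eqP E'; rewrite -E' ltnn in ltks.
have hQ e : e \in codom f -> Q e.
  move=> eL; rewrite (mg_conn G (Q := Q) _ eL (codom_f f i)); first exact: eqxx.
  by move=> k e1 e2 ltks _ _ t1 t2; rewrite !(noQ k).
have := mg_triv G s_gt0; case: (posnP (count (fun e => et e == 0) (codom f))).
  move=> -> c3; have /hasP[e eL eb1] : has (fun e => eb e == 1%N) (codom f).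
    by rewrite has_count; move: c3; rewrite add0n => ->.
  by have := hQ e eL; rewrite (noQ 0) // /touches eb1 orbT.
rewrite -has_count => /hasP[e eL et0] _.
by have := hQ e eL; rewrite (noQ 0) // /touches et0.
Qed.

Definition realizations : {set {ffun 'I_s.+1 -> state 'I_d I}} :=
  paths (fun k => cyc_lab w (active k)) (fun k => step (active k) (active k.+1)) s.

(** The factor at a vertex is the product of its incoming weights, so every edge that ends at a
    vertex is counted once; the initial ends among them cancel against the denominator in the number
    of initial states. *)
Lemma card_realizations :
  (#|realizations| = d`! * \prod_(i | (0 < eb (f i)) && (et (f i) < s)) w i)%N.
Proof.
have w_gt0 (A : {set I}) : forall i, i \in A -> (0 < w i)%N by move=> i _; have [] := f_range i.
rewrite (card_paths (c := fun k => (\prod_(i in active k :\: active k.+1) w i)%N)); last first.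
  move=> k x ltks kx; rewrite (step_succ (w := w)) //; try exact: w_gt0.
    by rewrite activeD activeDr -(count_codom (fun e => et e == k))
      -(count_codom (fun e => eb e == k.+1)) (mg_triv G).
  by rewrite activeD activeDr -(sum_codom (fun e => et e == k) ew)
    -(sum_codom (fun e => eb e == k.+1) ew) (mg_bal G).
have [x x0] := exists_cyc_lab sum_active0.
have cX := card_cyc_lab_of (@w_gt0 _) x0; rewrite card_ord in cX.
have p_gt0 : (0 < \prod_(i in active 0) w i)%N by rewrite prodn_cond_gt0 // => i /w_gt0.
apply/eqP; rewrite -(eqn_pmul2r p_gt0).
apply/eqP; rewrite mulnAC cX -mulnA; congr (_ * _)%N.
have -> : (\prod_(k < s) \prod_(i in active k :\: active k.+1) w i =
           \prod_(i | (et (f i) < s)%N) w i)%N.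
  rewrite (eq_bigr (fun k : 'I_s => \prod_(i | (et (f i) < s)%N && (et (f i) == k)) w i)%N).
    pose to i : 'I_s.-1.+1 := inord (et (f i)).
    have sE : s.-1.+1 = s by rewrite prednK.
    rewrite (partition_big (fun i => cast_ord sE (to i)) predT) //=.
    apply: eq_bigr => k _; apply: eq_bigl => i; apply: andb_id2l => lti.
    by rewrite -val_eqE /= inordK // sE.
  move=> k _; rewrite activeD; apply: eq_bigl => i; rewrite inE.
  by apply/idP/andP => [/eqP ->|[]//]; rewrite ltn_ord eqxx.
rewrite (bigID (fun i => (0 < eb (f i))%N)) /=; congr (_ * _)%N.
  by apply: eq_bigl => i; rewrite andbC.
(* Each initial end does end at a vertex, by [no_through]. *)
apply: eq_bigl => i; rewrite active0 inE -leqNgt leqn0 andbC.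
by case: eqP => //= /no_through ->.
Qed.

End Realizations.

(** * Automorphisms, and the uniqueness of labellings *)

Definition autg (I : finType) (f : I -> edge) : {set {perm I}} :=
  [set p : {perm I} | [forall i, f (p i) == f i]].

Section RealizationTheory.
Variables (s d : nat) (eta nu : seq nat) (I : finType) (f : I -> edge).
Hypotheses (G : mgraph s eta nu (codom f)).
Variables (x : {ffun 'I_s.+1 -> state 'I_d I}) (xf : x \in realizations s d f).
Let l k := (x (inord k)).2.
Let sg k := (x (inord k)).1.
Notation A := (active f).

Lemma realization_cyc k : (k <= s)%N -> cyc_lab (fun i => ew (f i)) (A k) (x (inord k)).
Proof. by case/pathsP: xf => h _; apply: h. Qed.

Lemma realization_step k : (k < s)%N -> step (A k) (A k.+1) (x (inord k)) (x (inord k.+1)).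
Proof. by case/pathsP: xf => _ h; apply: h. Qed.

Lemma realization_hit i k : (k <= s)%N -> i \in A k -> exists u, l k u = i.
Proof.
move=> leks iA; have [_ _ /(_ i iA)] := cyc_labP _ _ _ (realization_cyc leks).
have [_ _ w_gt0] := f_range G i => c.
have /card_gt0P[u] : (0 < #|fib (x (inord k)) i|)%N by rewrite c.
by rewrite inE => /eqP; exists u.
Qed.

Lemma realization_active k u : (k <= s)%N -> l k u \in A k.
Proof. by move/realization_cyc/cyc_labP=> [_ h _]. Qed.

Lemma realization_eq k u v : (k <= s)%N -> (l k u == l k v) = (u \in porbit (sg k) v).
Proof. by move/realization_cyc/cyc_labP=> [h _ _]; apply: h. Qed.

Lemma realization_change k u : (k < s)%N -> l k u != l k.+1 u ->
  (l k u \in A k :\: A k.+1) && (l k.+1 u \in A k.+1 :\: A k).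
Proof.
move=> ltks ne; have /stepP[_ [_ [_ _ h]]] := realization_step ltks.
have [n1 n2] := h u ne.
by rewrite !in_setD n1 n2 !realization_active // ltnW.
Qed.

(** This makes labels visible in the permutations. If a cycle survived as a set while its label
    changed, an incoming and an outgoing edge would have equal weight, and balance would leave
    weight 0 for the third edge at the vertex. *)
Lemma realization_keep k u : (k < s)%N ->
  (l k u == l k.+1 u) = (porbit (sg k) u == porbit (sg k.+1) u).
Proof.
move=> ltks; have cx := realization_cyc (ltnW ltks); have cy := realization_cyc ltks.
have fibE z := fib_porbit z cx; have fibE' z := fib_porbit z cy.
apply/eqP/eqP=> E.
  rewrite -/(sg k) -fibE -fibE' -/(l k u) E.
  apply: (step_fib (realization_step ltks)); last exact: realization_active.
  by rewrite -E; apply/realization_active/ltnW.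
apply/eqP; apply: contraT => ne.
case/andP: (realization_change ltks ne) => iA iB.
set i := l k u in ne iA; set i' := l k.+1 u in ne iB.
have wE : ew (f i) = ew (f i').
  by rewrite -(card_porbit_lab u cx) -(card_porbit_lab u cy) -/(sg k) E.
have c3 : (#|A k :\: A k.+1| + #|A k.+1 :\: A k| = 3)%N.
  by rewrite (activeD G) (activeDr G) -(count_codom _ (fun e => et e == k))
    -(count_codom _ (fun e => eb e == k.+1)) (mg_triv G).
have bal : (\sum_(i in A k :\: A k.+1) ew (f i) = \sum_(i in A k.+1 :\: A k) ew (f i))%N.
  by rewrite (activeD G) (activeDr G) -(sum_codom _ (fun e => et e == k) ew)
    -(sum_codom _ (fun e => eb e == k.+1) ew) (mg_bal G).
have pos (C D : {set I}) j j' : j \in C -> j' \in D -> (#|C| + #|D| = 3)%N -> (#|C| <= 1)%N ->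
    ew (f j) = ew (f j') -> (\sum_(i in C) ew (f i) = \sum_(i in D) ew (f i))%N -> False.
  move=> jC j'D cCD C1 jj'; rewrite (bigD1 j) // (bigD1 j' j'D) /= jj' => /addnI.
  have -> : (\sum_(i in C | i != j) ew (f i) = 0)%N.
    by apply: big1 => j1 /andP[j1C]; rewrite (card_le1_eqP C1 j1 j) ?eqxx.
  have /card_gt0P[j2] : (0 < #|D :\ j'|)%N by move: cCD; rewrite (cardsD1 j' D) j'D; lia.
  rewrite !inE => /andP[ne2 j2D]; rewrite (bigD1 j2) /=; last by apply/andP; split.
  by have [_ _] := f_range G j2; case: (ew _).
have [le1|gt1] := leqP #|A k :\: A k.+1| 1.
  by case: (pos _ _ _ _ iA iB c3 le1 wE bal).
by case: (pos _ _ _ _ iB iA _ _ (esym wE) (esym bal)); lia.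
Qed.

Lemma realization_back k u : (k < s)%N -> l k.+1 u \in A k -> l k u = l k.+1 u.
Proof.
move=> ltks iA; apply/eqP; apply: contraT => ne.
by case/andP: (realization_change ltks ne); rewrite !in_setD iA.
Qed.

End RealizationTheory.

Definition same_path (s d : nat) (I J : finType) (x : {ffun 'I_s.+1 -> state 'I_d I})
  (y : {ffun 'I_s.+1 -> state 'I_d J}) := forall k, (x k).1 = (y k).1.

Section Compare.
Variables (s d : nat) (eta nu eta' nu' : seq nat).
Variables (I J : finType) (f : I -> edge) (g : J -> edge).
Hypotheses (Gf : mgraph s eta nu (codom f)) (Gg : mgraph s eta' nu' (codom g)).
Variables (x : {ffun 'I_s.+1 -> state 'I_d I}) (y : {ffun 'I_s.+1 -> state 'I_d J}).
Hypotheses (xf : x \in realizations s d f) (yg : y \in realizations s d g).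
Hypothesis xy : same_path x y.

(** The edge is active from [k] to [k'], so its label at [u'] can be followed back in time; each
    step of this is seen on the cycles, which [x] and [y] share. *)
Lemma realization_transfer k k' u u' : (k <= k')%N -> (k' <= s)%N ->
  (x (inord k)).2 u = (x (inord k')).2 u' -> (y (inord k)).2 u = (y (inord k')).2 u'.
Proof.
elim: k' u' => [|k' IHk'] u'; rewrite leq_eqVlt => /orP[/eqP <-|].
- move=> leks /eqP; rewrite (realization_eq xf) // => uu'; apply/eqP.
  by rewrite (realization_eq yg) // -xy.
- by [].
- move=> leks /eqP; rewrite (realization_eq xf) // => uu'; apply/eqP.
  by rewrite (realization_eq yg) // -xy.
rewrite ltnS => lekk' ltks E.
have back : (x (inord k')).2 u' = (x (inord k'.+1)).2 u'.
  apply: (realization_back xf) => //.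
  have lek : (k <= s)%N by apply: leq_trans lekk' (ltnW ltks).
  have := realization_active xf u lek; have := realization_active xf u' ltks.
  by rewrite E !inE; lia.
rewrite (IHk' u') // ?back //; last exact: ltnW.
apply/eqP; rewrite (realization_keep Gg yg) // -!xy -(realization_keep Gf xf) //.
exact/eqP.
Qed.

Lemma realization_map : exists h : I -> J,
  forall k u, (k <= s)%N -> (y (inord k)).2 u = h ((x (inord k)).2 u).
Proof.
suff /fin_all_exists[h hP] : forall i, exists j, forall k u, (k <= s)%N ->
    (x (inord k)).2 u = i -> (y (inord k)).2 u = j.
  by exists h => k u leks; apply: hP.
move=> i; have [bt ts _] := f_range Gf i.
have [|u0 u0i] := realization_hit Gf xf (i := i) (k := eb (f i)) (leq_trans bt ts).
  by rewrite inE leqnn.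
(* The image is read at the first time at which [i] is active, so that every other occurrence is
   later. *)
exists ((y (inord (eb (f i)))).2 u0) => k u leks ui; apply/esym.
apply: realization_transfer => //; last by rewrite u0i ui.
by have := realization_active xf u leks; rewrite ui inE => /andP[].
Qed.

End Compare.

Lemma realization_iso s d eta nu eta' nu' (I J : finType) (f : I -> edge) (g : J -> edge)
  (x : {ffun 'I_s.+1 -> state 'I_d I}) (y : {ffun 'I_s.+1 -> state 'I_d J}) :
  mgraph s eta nu (codom f) -> mgraph s eta' nu' (codom g) ->
  x \in realizations s d f -> y \in realizations s d g -> same_path x y ->
  exists2 h : I -> J, bijective h &
    (forall i, g (h i) = f i) /\
    (forall k u, (k <= s)%N -> (y (inord k)).2 u = h ((x (inord k)).2 u)).
Proof.
move=> Gf Gg xf yg xy; have [h hP] := realization_map Gf Gg xf yg xy.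
have [h' h'P] := realization_map Gg Gf yg xf (fun k => esym (xy k)).
have exi i : exists k u, (k <= s)%N /\ (x (inord k)).2 u = i.
  have [bt ts _] := f_range Gf i; have leb := leq_trans bt ts.
  have [|u0 u0i] := realization_hit Gf xf (i := i) (k := eb (f i)) leb.
    by rewrite inE leqnn.
  by exists (eb (f i)), u0.
have exj j : exists k u, (k <= s)%N /\ (y (inord k)).2 u = j.
  have [bt ts _] := f_range Gg j; have leb := leq_trans bt ts.
  have [|u0 u0i] := realization_hit Gg yg (i := j) (k := eb (g j)) leb.
    by rewrite inE leqnn.
  by exists (eb (g j)), u0.
have hK : cancel h h'.
  by move=> i; have [k [u [leks <-]]] := exi i; rewrite -hP -?h'P.
have h'K : cancel h' h.
  by move=> j; have [k [u [leks <-]]] := exj j; rewrite -h'P -?hP.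
exists h; [by exists h' | split=> // i].
(* The triple of an edge can be recovered: its weight is a cycle length, and its two ends bound the
   times of activity. *)
have act k : (k <= s)%N -> (i \in active f k) = (h i \in active g k).
  move=> leks; apply/idP/idP=> ik.
    have [u <-] := realization_hit Gf xf leks ik.
    by rewrite -hP //; apply: (realization_active yg).
  have [u uE] := realization_hit Gg yg leks ik.
  by rewrite -[i]hK -uE -h'P //; apply: (realization_active xf).
have [bt ts _] := f_range Gf i; have [bt' ts' _] := f_range Gg (h i).
have := act _ ts; have := act _ ts'; have := act _ (leq_trans bt ts).
have := act _ (leq_trans bt' ts'); rewrite !inE.
have wE : ew (f i) = ew (g (h i)).
  have [k [u [leks <-]]] := exi i.
  rewrite -(card_porbit_lab u (realization_cyc xf leks)) xy.
  by rewrite (card_porbit_lab u (realization_cyc yg leks)) -hP.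
move: wE bt ts bt' ts'; rewrite /eb /et /ew; case: (f i) => [[b t] w].
case: (g (h i)) => [[b' t'] w'] /= ->; rewrite !leqnn /= => *.
congr (_, _, _); lia.
Qed.

Definition map_lab (s d : nat) (I J : finType) (h : I -> J)
  (x : {ffun 'I_s.+1 -> state 'I_d I}) : {ffun 'I_s.+1 -> state 'I_d J} :=
  [ffun k => ((x k).1, [ffun u => h ((x k).2 u)])].

Lemma map_lab_realization s d (I J : finType) (f : I -> edge) (g : J -> edge)
  (h : I -> J) (x : {ffun 'I_s.+1 -> state 'I_d I}) :
  bijective h -> (forall i, g (h i) = f i) ->
  x \in realizations s d f -> map_lab h x \in realizations s d g.
Proof.
case=> h' hK h'K gh /pathsP[x1 x2].
have act i k : (h i \in active g k) = (i \in active f k) by rewrite !inE gh.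
apply/pathsP; split=> k leks.
  have [c1 c2 c3] := cyc_labP _ _ _ (x1 k leks).
  apply/cyc_labP; split.
  - by move=> u v; rewrite !ffunE /= ?ffunE (inj_eq (can_inj hK)) c1.
  - by move=> u; rewrite !ffunE /= ?ffunE act.
  move=> j jA; rewrite -[j in RHS]h'K gh -c3 -?act ?h'K //.
  by apply: eq_card => u; rewrite !inE ffunE /= ?ffunE -{1}[j]h'K (inj_eq (can_inj hK)).
have /stepP[u [v [uv E hx]]] := x2 k leks.
apply/stepP; exists u, v; split=> // [|z].
  by rewrite !ffunE.
by rewrite !ffunE /= ?ffunE (inj_eq (can_inj hK)) !act; apply: hx.
Qed.

Section AutCount.
Variables (s d : nat) (eta nu : seq nat) (I : finType) (f : I -> edge).
Hypothesis (Gf : mgraph s eta nu (codom f)).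

Definition path_of (x : {ffun 'I_s.+1 -> state 'I_d I}) : {ffun 'I_s.+1 -> 'S_d} :=
  [ffun k => (x k).1].

(** [realization_iso] gives transitivity on the fibres of [path_of]; the action is free since every
    edge is the label of some sheet at its first active time. *)
Lemma card_realizations_aut :
  (#|path_of @: realizations s d f| * #|autg f| = #|realizations s d f|)%N.
Proof.
rewrite -[RHS]sum1_card (partition_big path_of (mem (path_of @: realizations s d f))) /=.
  rewrite -sum_nat_const; apply: eq_bigr => sg /imsetP[x xf ->].
  rewrite sum1dep_card -(card_in_imset (f := fun p : {perm I} => map_lab p x)).
    apply: eq_card => y; rewrite inE; apply/imsetP/andP => [[p]|[yf /eqP yx]].
      rewrite inE => /forallP pf ->; split; last first.
        by apply/eqP/ffunP=> k; rewrite !ffunE.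
      apply: (map_lab_realization (f := f)) => //.
        by exists (p^-1); [exact: permK | exact: permKV].
      by move=> i; apply/eqP.
    have xy : same_path x y.
      by move=> k; have /ffunP/(_ k) := yx; rewrite !ffunE.
    have [h /bij_inj h_inj [fh hP]] := realization_iso Gf Gf xf yf xy.
    exists (perm h_inj); first by rewrite inE; apply/forallP=> i; rewrite permE fh.
    apply/ffunP=> k; rewrite ffunE xy [LHS]surjective_pairing; congr (_, _).
    by apply/ffunP=> u; rewrite ffunE permE -[k]inord_val hP // -ltnS.
  move=> p q _ _ E; apply/permP=> i; have [bt ts _] := f_range Gf i.
  have [|u ui] := realization_hit Gf xf (i := i) (k := eb (f i)) (leq_trans bt ts).
    by rewrite inE leqnn.
  have /ffunP/(_ (inord (eb (f i)))) := E; rewrite !ffunE => -[/ffunP/(_ u)].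
  by rewrite !ffunE ui.
by move=> x xf; apply: imset_f.
Qed.

End AutCount.

Lemma sum_cyc_lab (T I : finType) (w : I -> nat) (A : {set I}) (x : state T I) :
  cyc_lab w A x -> (\sum_(i in A) w i)%N = #|T|.
Proof.
move=> Ax; have [_ x2 x3] := cyc_labP _ _ _ Ax.
rewrite -sum1_card (partition_big (fun u => x.2 u) (mem A)) //=.
apply: eq_bigr => f fA; rewrite -x3 // -sum1_card.
by apply: eq_bigl => u; rewrite inE.
Qed.

Lemma cycle_type_lab d (I : finType) (w : I -> nat) (A : {set I}) (x : state 'I_d I) :
  (forall i, i \in A -> 0 < w i)%N -> cyc_lab w A x ->
  perm_eq [seq w i | i <- enum A] (cycle_type x.1).
Proof.
move=> w_gt0 Ax; have [x1 x2 x3] := cyc_labP _ _ _ Ax.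
have -> : [seq w i | i <- enum A] = [seq #|pred_of_set c| | c <- [seq fib x i | i <- enum A]].
  by rewrite -map_comp; apply/eq_in_map => i; rewrite mem_enum /= => /x3.
apply: perm_map; apply: uniq_perm; last 1 first.
- move=> c; rewrite mem_enum; apply/mapP/imsetP => [[i]|[u _ ->]]; last first.
    by exists (x.2 u); rewrite ?mem_enum ?x2 ?(fib_porbit u Ax).
  rewrite mem_enum => iA ->; have /card_gt0P[u] : (0 < #|fib x i|)%N by rewrite x3 ?w_gt0.
  by rewrite inE => /eqP <-; exists u; rewrite ?(fib_porbit u Ax).
- rewrite map_inj_in_uniq ?enum_uniq // => i j; rewrite !mem_enum => iA jA E.
  have /card_gt0P[u ui] : (0 < #|fib x i|)%N by rewrite x3 ?w_gt0.
  by move: (ui); rewrite E !inE => /eqP <-; move: ui; rewrite inE => /eqP.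
- exact: enum_uniq.
Qed.

(** * Connected graphs and transitive groups *)

Definition transitive_path s d (sg : {ffun 'I_s.+1 -> 'S_d}) :=
  forall Z : {set 'I_d}, (forall k u, u \in Z -> sg k u \in Z) -> Z = set0 \/ Z = setT.

Definition touches_consistent s (L : seq edge) (Q : pred edge) :=
  forall k e e', (k < s)%N -> e \in L -> e' \in L ->
    touches k e -> touches k e' -> Q e = Q e'.

Section Connected.
Variables (s d : nat) (eta nu : seq nat) (I : finType) (f : I -> edge).
Variables (x : {ffun 'I_s.+1 -> state 'I_d I}) (xf : x \in realizations s d f).
Let l k := (x (inord k)).2.

(* A vertex-compatible colouring of the edges colours the sheets, through the
   edges that they lie over, independently of the point of the base. *)
Lemma connected_of_transitive (Q : pred edge) :
  (forall i, exists k u, (k <= s)%N /\ l k u = i) ->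
  (forall i, eb (f i) <= et (f i))%N ->
  transitive_path (path_of x) -> touches_consistent s (codom f) Q ->
  forall e e', e \in codom f -> e' \in codom f -> Q e = Q e'.
Proof.
move=> hit f_le tr Qc.
have const k u : (k <= s)%N -> Q (f (l k u)) = Q (f (l 0 u)).
  elim: k => // k IHk ltks; rewrite -IHk; last exact: ltnW.
  have [->//|ne] := eqVneq (l k u) (l k.+1 u).
  have := realization_change xf ltks ne; rewrite !inE => /andP[iA iB].
  apply: (Qc k) => //; try exact: codom_f; rewrite /touches.
    by rewrite -/(l _) in iB *; have := f_le (l k.+1 u); lia.
  by rewrite -/(l _) in iA *; have := f_le (l k u); lia.
case: (tr [set u | Q (f (l 0 u))]) => [k u|Z0|ZT].
- have leks : (k <= s)%N by rewrite -ltnS.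
  rewrite !inE -!(const k _ leks) ffunE.
  suff -> : l k ((x k).1 u) = l k u by [].
  apply/eqP; rewrite -[k in (x k)]inord_val (realization_eq xf) //.
  by rewrite porbit_perm1 porbit_id.
- move=> _ _ /codomP[i ->] /codomP[i' ->].
  have [k [u [leks <-]]] := hit i; have [k' [u' [leks' <-]]] := hit i'.
  by rewrite !const //; have /setP/(_ u) := Z0; have /setP/(_ u') := Z0; rewrite !inE => -> ->.
move=> _ _ /codomP[i ->] /codomP[i' ->].
have [k [u [leks <-]]] := hit i; have [k' [u' [leks' <-]]] := hit i'.
by rewrite !const //; have /setP/(_ u) := ZT; have /setP/(_ u') := ZT; rewrite !inE => -> ->.
Qed.

(** A stable set of sheets is a union of cycles at every time, and so colours the edges compatibly
    with the vertices; connectedness makes the colour constant. *)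
Lemma transitive_of_connected : (0 < s)%N -> mgraph s eta nu (codom f) ->
  transitive_path (path_of x).
Proof.
move=> s_gt0 G Z Zst.
have Zst1 k u v : v \in porbit (x k).1 u -> (u \in Z) = (v \in Z).
  move=> /porbitP[i ->]; set sk := (x k).1.
  have st z : z \in Z -> sk z \in Z by move/(Zst k); rewrite ffunE.
  have st' z j : z \in Z -> (sk ^+ j) z \in Z.
    by move=> zZ; elim: j => [|j IHj]; rewrite ?expg0 ?perm1 // expgSr permM st.
  apply/idP/idP; first exact: st'.
  (* This power of [sk] inverts [sk ^+ i]; the multiple of the order is large enough for the
     subtraction not to truncate. *)
  move/(st' _ (#[sk] * i.+1 - i)%N); rewrite -permM -expgD subnKC.
    by rewrite expgM expg_order expg1n perm1.
  by have := order_gt0 sk; nia.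
have same k k' u u' : (k <= k')%N -> (k' <= s)%N -> l k u = l k' u' -> (u \in Z) = (u' \in Z).
  elim: k' u' => [|k' IHk'] u'; rewrite leq_eqVlt => /orP[/eqP <-|] //.
  - by move=> leks /eqP; rewrite (realization_eq xf) // porbit_sym => /Zst1.
  - by move=> leks /eqP; rewrite (realization_eq xf) // porbit_sym => /Zst1.
  rewrite ltnS => lekk' ltks E; apply: (IHk' u') => //; first exact: ltnW.
  rewrite E; apply/esym/(realization_back xf) => //.
  have lek : (k <= s)%N by apply: leq_trans lekk' (ltnW ltks).
  have := realization_active xf u lek; have := realization_active xf u' ltks.
  by rewrite -!/(l _) E !inE; lia.
have [QI QIP] : exists QI : I -> bool, forall k u, (k <= s)%N -> QI (l k u) = (u \in Z).
  pose QI i := [exists k : 'I_s.+1, [exists u, (l k u == i) && (u \in Z)]].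
  exists QI => k u leks; apply/existsP/idP => [[k' /existsP[u' /andP[/eqP E u'Z]]]|uZ].
    have [lekk'|/ltnW lek'k] := leqP k k'.
      by rewrite (same k k' u u') // -ltnS.
    by rewrite -(same k' k u' u).
  by exists (inord k); apply/existsP; exists u; rewrite /l inordK ?ltnS // eqxx.
have touch i k : (k < s)%N -> touches k (f i) ->
    exists u, (l k u = i \/ l k.+1 u = i) /\ l k u != l k.+1 u.
  move=> ltks; have [bt ts _] := f_range G i; rewrite /touches => /orP[]/eqP E.
    have iA : i \in active f k by rewrite inE E leqnn andbT -E.
    have [u ui] := realization_hit G xf (ltnW ltks) iA; exists u; split; first by left.
    rewrite /l ui; apply/eqP=> Ei; have := realization_active xf u ltks.
    by rewrite -Ei inE; lia.
  have iA : i \in active f k.+1 by rewrite inE E leqnn -E.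
  have [u ui] := realization_hit G xf ltks iA; exists u; split; first by right.
  rewrite /l ui; apply/eqP=> Ei; have := realization_active xf u (ltnW ltks).
  by rewrite Ei inE; lia.
have consistent i i' k : (k < s)%N -> touches k (f i) -> touches k (f i') -> QI i = QI i'.
  move=> ltks ti ti'.
  have c3 : (#|active f k :\: active f k.+1| + #|active f k.+1 :\: active f k| = 3)%N.
    by rewrite (activeD G) (activeDr G) -(count_codom _ (fun e => et e == k))
      -(count_codom _ (fun e => eb e == k.+1)) (mg_triv G).
  have [u [ui ne]] := touch i k ltks ti; have [u' [ui' ne']] := touch i' k ltks ti'.
  have -> : QI i = (u \in Z) by case: ui => <-; rewrite QIP // ltnW.
  have -> : QI i' = (u' \in Z) by case: ui' => <-; rewrite QIP // ltnW.
  case/andP: (realization_change xf ltks ne) => a1 a2.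
  case/andP: (realization_change xf ltks ne') => b1 b2.
  (* One side of the vertex has a single edge, and both chosen sheets carry it on that side. *)
  have [le1|gt1] := leqP #|active f k :\: active f k.+1| 1.
    apply: (same k k) => //; first exact: ltnW.
    exact: (card_le1_eqP le1).
  apply: (same k.+1 k.+1) => //.
  have le1 : (#|active f k.+1 :\: active f k| <= 1)%N by lia.
  exact: (card_le1_eqP le1).
pose Q : pred edge := fun e => [exists i, (f i == e) && QI i].
(* Edges with the same triple share a vertex, as no edge passes through, so the colour depends only
   on the triple. *)
have QE i : Q (f i) = QI i.
  apply/existsP/idP => [[i' /andP[/eqP E QI']]|QIi]; last by exists i; rewrite eqxx.
  have [bt ts _] := f_range G i.
  case: (posnP (eb (f i))) => [b0|b_gt0].
    rewrite (consistent i i' (et (f i))) //; rewrite ?E /touches ?eqxx //.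
    exact: (no_through G).
  have b1 : (eb (f i)).-1.+1 = eb (f i) by rewrite prednK.
  rewrite (consistent i i' (eb (f i)).-1) //; last 2 first.
  - by rewrite /touches b1 eqxx orbT.
  - by rewrite E /touches b1 eqxx orbT.
  by rewrite b1 (leq_trans bt).
have Qconst := @mg_conn _ _ _ _ G Q _.
have {Qconst}QIconst i i' : QI i = QI i'.
  rewrite -!QE; apply: Qconst; rewrite ?codom_f //.
  move=> k _ _ ltks /codomP[j ->] /codomP[j' ->] tj tj'; rewrite !QE.
  exact: (consistent j j' k).
have [->|[u0 u0Z]] := set_0Vmem Z; [by left | right].
apply/setP=> u; rewrite [RHS]inE -(QIP 0 u) //.
by rewrite (QIconst _ (l 0 u0)) QIP.
Qed.

End Connected.

(** * The graph of a path of permutations *)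

Lemma porbits_merge (T : finType) (s : {perm T}) u v : v \notin porbit s u ->
  porbits s :\: porbits (s * tperm u v) = [set porbit s u; porbit s v] /\
  porbits (s * tperm u v) :\: porbits s = [set porbit s u :|: porbit s v].
Proof.
move=> vu; have mE z := porbit_merge z vu; set U := porbit s u :|: _ in mE *.
have uU : u \in U by rewrite inE porbit_id.
have vU : v \in U by rewrite inE porbit_id orbT.
split; apply/setP=> c; rewrite !inE.
  apply/andP/orP=> [[nc /imsetP[z _ cE]]|]; last first.
    have old z c' : c' = porbit s z -> z \in U -> ~~ (U \subset c') -> c' \notin porbits (s * tperm u v) /\ c' \in porbits s.
      move=> -> zU nU; split; last exact: imset_f.
      apply: contra nU => /imsetP[z' _ E].
      have : z' \in U by rewrite -[_ \in U]orbF; have := porbit_id (s * tperm u v) z';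
        rewrite -E -eq_porbit_mem => /eqP E'; move: zU; rewrite !in_setU -!eq_porbit_mem E' orbF.
      by move=> z'U; rewrite E mE z'U.
    case=> /eqP cE; [apply: (old u)|apply: (old v)] => //; rewrite cE; apply/negP=> /subsetP sU.
      by move: vu; rewrite (sU v vU).
    by move: vu; rewrite porbit_sym (sU u uU).
  have := mE z; case: ifP => [|_ E]; last by rewrite cE -E imset_f in nc.
  rewrite inE => /orP[]; rewrite -eq_porbit_mem => /eqP E _; rewrite cE E; by [left|right].
apply/andP/eqP=> [[nc /imsetP[z _ cE]]|->].
  have := mE z; case: ifP => [_|_ E]; first by rewrite -cE.
  by rewrite cE E imset_f in nc.
split; last by apply/imsetP; exists u; rewrite // mE uU.
apply/negP=> /imsetP[z _ E]; case/negP: vu.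
move: uU vU; rewrite E -!eq_porbit_mem => /eqP -> /eqP -> //.
Qed.

Lemma porbits_tperm (T : finType) (s : {perm T}) u v : u != v ->
  (#|porbits s :\: porbits (s * tperm u v)| +
   #|porbits (s * tperm u v) :\: porbits s| = 3)%N.
Proof.
move=> uv.
have main (r : {perm T}) : v \notin porbit r u ->
  (#|porbits r :\: porbits (r * tperm u v)| +
   #|porbits (r * tperm u v) :\: porbits r| = 3)%N.
  move=> vu; have [-> ->] := porbits_merge vu; rewrite cards1 cards2.
  suff -> : porbit r u != porbit r v by [].
  by rewrite eq_sym eq_porbit_mem.
have [vu|] := boolP (v \in porbit s u); last exact: main.
by have := main _ (porbit_split uv vu); rewrite -mulgA tperm2 mulg1 addnC.
Qed.

Section Canonical.
Variables (s d : nat) (sg : {ffun 'I_s.+1 -> 'S_d}).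

Definition cycles k : {set {set 'I_d}} := porbits (sg (inord k)).

Definition run j k (c : {set 'I_d}) :=
  [forall i : 'I_s.+1, (j <= i <= k)%N ==> (c \in porbits (sg i))].

Lemma runP j k c : (k <= s)%N ->
  reflect (forall i, (j <= i <= k)%N -> c \in cycles i) (run j k c).
Proof.
move=> leks; apply: (iffP forallP) => [h i /andP[ji ik]|h i].
  have lis : (i < s.+1)%N by rewrite ltnS (leq_trans ik).
  by have := h (inord i); rewrite inordK // ji ik.
by apply/implyP=> /h; rewrite /cycles inord_val.
Qed.

(** The same set of points can be a cycle during several separate intervals of time, and these are
    different edges; the interval meant here is the one that contains [k]. *)
Definition start k c : 'I_s.+1 := [arg min_(j < inord k | run j k c) j].

(* A cycle, with the time at which it appears, is an edge of the monodromy graph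
   of the path. *)
Definition born : {set 'I_s.+1 * {set 'I_d}} :=
  [set z : 'I_s.+1 * {set 'I_d} | (z.2 \in cycles z.1) && ((z.1 == 0 :> nat) || (z.2 \notin cycles z.1.-1))].

(** Times before [z.1] satisfy [run] vacuously; for [z] in [born] this does not affect the maximum,
    because [z.1] itself satisfies it. *)
Definition death (z : 'I_s.+1 * {set 'I_d}) := (\max_(k < s.+1 | run z.1 k z.2) k)%N.

Lemma startP k c : (k <= s)%N -> c \in cycles k ->
  [/\ (start k c <= k)%N, run (start k c) k c & (start k c, c) \in born].
Proof.
move=> leks ck; rewrite /start; case: arg_minnP => [|j rj minj].
  apply/runP=> // i; rewrite inordK //; rewrite -eqn_leq => /eqP <- //.
have lejk : (j <= k)%N.
  have := minj (inord k); rewrite inordK //; apply.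
  by apply/runP=> // i; rewrite -eqn_leq => /eqP <-.
split=> //; rewrite inE /=; apply/andP; split.
  by apply: (runP _ _ leks rj); rewrite leqnn.
case: (posnP j) => [->//|j_gt0]; apply/orP; right; apply/negP=> cj.
have ltjs : (j.-1 < s.+1)%N by apply: leq_ltn_trans (ltn_ord j); apply: leq_pred.
have := minj (Ordinal ltjs) => /=; rewrite leqNgt prednK // leqnn => h.
suff : false by []; apply: h; apply/runP=> // i /andP[ji ik].
have [E|ne] := eqVneq i j.-1; first by rewrite E.
by apply: (runP _ _ leks rj); rewrite ik andbT; lia.
Qed.

Lemma start_uniq k z : (k <= s)%N -> z \in born -> (z.1 <= k)%N -> run z.1 k z.2 ->
  start k z.2 = z.1.
Proof.
move=> leks; rewrite inE => /andP[zc zb] lezk rz.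
have ck : z.2 \in cycles k by apply: (runP _ _ leks rz); rewrite lezk leqnn.
have [lejk rj _] := startP leks ck.
apply/val_inj/eqP; rewrite eqn_leq; apply/andP; split.
  by rewrite /start; case: arg_minnP => [|j _]; [|apply];
    rewrite ?rz //; apply/runP=> // i; rewrite inordK // -eqn_leq => /eqP <-.
rewrite leqNgt; apply/negP=> ltz; case/orP: zb => [/eqP z0|/negP]; first by move: ltz; rewrite /= z0.
apply; apply: (runP _ _ leks rj).
have h a b m : (a < b)%N -> (b <= m)%N -> (a <= b.-1 <= m)%N by lia.
exact: h ltz lezk.
Qed.

Definition cedge := {z : 'I_s.+1 * {set 'I_d} | z \in born}.

Definition ctriple (z : cedge) : edge := (val (val z).1, death (val z), #|(val z).2|).

Lemma death_le z : (death z <= s)%N.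
Proof. by apply/bigmax_leqP=> k _; rewrite -ltnS. Qed.

Lemma active_ctriple k z : (k <= s)%N ->
  (z \in active ctriple k) = ((val z).1 <= k)%N && run (val z).1 k (val z).2.
Proof.
move=> leks; rewrite inE /eb /et /=; apply: andb_id2l => lezk.
apply/idP/idP=> [lekt|rz]; last first.
  have := @leq_bigmax_cond _ (fun i : 'I_s.+1 => run (val z).1 i (val z).2) (fun i => val i) (inord k).
  by rewrite /= inordK //; apply.
have [m rm mE] : {m : 'I_s.+1 | run (val z).1 m (val z).2 & death (val z) = m}.
  apply: (eq_bigmax_cond (A := fun k : 'I_s.+1 => run (val z).1 k (val z).2)).
  apply/card_gt0P; exists (val z).1; rewrite unfold_in.
  apply/runP=> [|i]; first by rewrite -ltnS.
  by rewrite -eqn_leq => /eqP <-; have := valP z; rewrite inE => /andP[].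
apply/runP=> // i /andP[zi ik]; have lem : (m <= s)%N by rewrite -ltnS.
by apply: (runP _ _ lem rm); rewrite zi (leq_trans ik) // -mE.
Qed.

Lemma cycles_porbit (k : 'I_s.+1) u : porbit (sg k) u \in cycles k.
Proof. by rewrite /cycles inord_val imset_f. Qed.

Lemma clab_born (k : 'I_s.+1) u :
  (start k (porbit (sg k) u), porbit (sg k) u) \in born.
Proof. by have [|] := startP (c := porbit (sg k) u) _ (cycles_porbit k u); rewrite -1?ltnS. Qed.

Definition clab (k : 'I_s.+1) u : cedge := exist (fun z => z \in born) _ (clab_born k u).

Definition canonical : {ffun 'I_s.+1 -> state 'I_d cedge} :=
  [ffun k => (sg k, [ffun u => clab k u])].

Lemma path_of_canonical : path_of canonical = sg.
Proof. by apply/ffunP=> k; rewrite !ffunE. Qed.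

Lemma clabE (k : 'I_s.+1) u z : z \in active ctriple k ->
  (clab k u == z) = (u \in (val z).2).
Proof.
have leks : (k <= s)%N by rewrite -ltnS.
rewrite active_ctriple // => /andP[lezk rz].
have /imsetP[v _ cE] : (val z).2 \in cycles k by apply: (runP _ _ leks rz); rewrite lezk leqnn.
rewrite inord_val in cE; have sE := start_uniq leks (valP z) lezk rz.
rewrite -val_eqE /= -pair_eqE /= cE -eq_porbit_mem andb_idl // => /eqP ->.
by rewrite -cE sE.
Qed.

Lemma canonical_cyc (k : 'I_s.+1) :
  cyc_lab (fun z => ew (ctriple z)) (active ctriple k) (canonical k).
Proof.
have leks : (k <= s)%N by rewrite -ltnS.
apply/cyc_labP; split=> [u v|u|z zA].
- rewrite !ffunE /= ?ffunE -val_eqE /= -pair_eqE /=.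
  by rewrite -eq_porbit_mem andb_idl // => /eqP ->.
- rewrite ffunE /= ?ffunE active_ctriple //=.
  by have [-> ->] := startP leks (cycles_porbit k u).
by rewrite /ew /=; apply: eq_card => u; rewrite inE ffunE /= ?ffunE clabE.
Qed.

Hypothesis tr : forall k, (k < s)%N -> is_transposition ((sg (inord k))^-1 * sg (inord k.+1)).

Lemma canonical_realization : canonical \in realizations s d ctriple.
Proof.
apply/pathsP; split=> k ltks.
  by have := canonical_cyc (inord k); rewrite inordK.
apply/andP; split; first by rewrite !ffunE /= tr.
apply/forallP=> u; apply/implyP; rewrite !ffunE /= ?ffunE => ne.
have in_clab k' : u \in (val (clab k' u)).2 by rewrite /= porbit_id.
apply/andP; split; apply: contra ne => zA; [rewrite eq_sym|]; rewrite clabE //; rewrite inordK //.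
by rewrite ltnS ltnW.
Qed.

(** At a fixed time an active edge is determined by its cycle, and it survives the step exactly when
    the cycle does. *)
Lemma card_active_cycles k : (k < s)%N ->
  #|active ctriple k :\: active ctriple k.+1| = #|cycles k :\: cycles k.+1| /\
  #|active ctriple k.+1 :\: active ctriple k| = #|cycles k.+1 :\: cycles k|.
Proof.
move=> ltks.
have inj k' : (k' <= s)%N -> {in active ctriple k' &, injective (fun z : cedge => (val z).2)}.
  move=> lek z z'; rewrite !active_ctriple // => /andP[l1 r1] /andP[l2 r2] E.
  apply/val_inj; rewrite [LHS]surjective_pairing [RHS]surjective_pairing.
  by rewrite -(start_uniq lek (valP z) l1 r1) -(start_uniq lek (valP z') l2 r2) /= E.
have inA k' z : (k' <= s)%N -> z \in active ctriple k' -> (val z).2 \in cycles k'.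
  by move=> lek; rewrite active_ctriple // => /andP[l1 /(runP _ _ lek)]; apply; rewrite l1 leqnn.
have ofA k' c : (k' <= s)%N -> c \in cycles k' -> exists2 z, z \in active ctriple k' & (val z).2 = c.
  move=> lek ck; have [l1 r1 b] := startP lek ck.
  by exists (exist (fun z => z \in born) _ b) => //; rewrite active_ctriple //= l1 r1.
have lek := ltnW ltks; have leks := ltks : (k.+1 <= s)%N.
split.
- rewrite -(card_in_imset (f := fun z : cedge => (val z).2)); last first.
    by move=> z z' /setDP[zA _] /setDP[zA' _]; apply: (inj k).
  apply: eq_card => c; rewrite inE; apply/imsetP/andP => [[z /setDP[zA zB] ->]|[cB cA]].
    split; last exact: inA; apply: contra zB => zc; move: zA.
    rewrite !active_ctriple // => /andP[l1 r1]; rewrite (leq_trans l1) //=.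
    apply/runP=> // i /andP[l2 l3]; have [->//|ne] := eqVneq i k.+1.
    by apply: (runP _ _ lek r1); rewrite l2 -ltnS ltn_neqAle ne.
  have [z zA zc] := ofA k c lek cA; exists z => //; apply/setDP; split=> //.
  by apply: contra cB => zB; rewrite -zc; apply: inA.
rewrite -(card_in_imset (f := fun z : cedge => (val z).2)); last first.
  by move=> z z' /setDP[zA _] /setDP[zA' _]; apply: (inj k.+1).
apply: eq_card => c; rewrite inE; apply/imsetP/andP => [[z /setDP[zA zB] ->]|[cB cA]].
  split; last exact: inA; apply/negP=> zc; case/negP: zB; move: zA.
  rewrite !active_ctriple // => /andP[l1 r1].
  have l2 : ((val z).1 <= k)%N.
    rewrite leqNgt; apply/negP=> lt; have E : (val z).1 = k.+1 :> nat by apply/eqP; rewrite eqn_leq l1.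
    by have := valP z; rewrite inE E /= => /andP[_ /negP[]].
  rewrite l2 /=; apply/runP=> // i /andP[l3 l4].
  by apply: (runP _ _ leks r1); rewrite l3 leqW.
have [z zA zc] := ofA k.+1 c leks cA; exists z => //; apply/setDP; split=> //.
by apply: contra cB => zB; rewrite -zc; apply: inA.
Qed.

Lemma canonical_mgraph : transitive_path sg ->
  mgraph s (cycle_type (sg ord0)) (cycle_type (sg ord_max)) (codom ctriple).
Proof.
move=> trans; have real := canonical_realization.
have range z : [/\ eb (ctriple z) <= et (ctriple z), et (ctriple z) <= s & 0 < ew (ctriple z)]%N.
  have bz := valP z; rewrite inE in bz; case/andP: bz => cz _.
  have lez : ((val z).1 <= s)%N by rewrite -ltnS.
  have : z \in active ctriple (val z).1.
    by rewrite active_ctriple // leqnn; apply/runP=> // i; rewrite -eqn_leq => /eqP <-.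
  rewrite inE => /andP[_ lt]; rewrite lt death_le; split=> //.
  by case/imsetP: cz => v _; rewrite /ew /= => ->; rewrite lt0n card_porbit_neq0.
have cyc k (leks : (k <= s)%N) := realization_cyc real leks.
have in_e k : active ctriple k :\: active ctriple k.+1 = [set z | et (ctriple z) == k].
  by apply/setP=> z; rewrite !inE; have [] := range z; lia.
have out_e k : active ctriple k.+1 :\: active ctriple k = [set z | eb (ctriple z) == k.+1].
  by apply/setP=> z; rewrite !inE; have [] := range z; lia.
split.
- by move=> e /codomP[z ->]; apply: range.
- move=> k ltks; rewrite !count_codom -in_e -out_e.
  have [-> ->] := card_active_cycles ltks.
  have /is_transpositionP[u [v [uv E]]] := tr ltks.
  by rewrite /cycles -[sg (inord k.+1)](mulKVg (sg (inord k))) E porbits_tperm.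
- move=> k ltks; rewrite !sum_codom -in_e -out_e.
  (* Both sets of active edges have total weight [d]; their common part cancels. *)
  apply/eqP; rewrite -(eqn_add2l (\sum_(z in active ctriple k :&: active ctriple k.+1) ew (ctriple z))).
  rewrite -big_setID /= setIC -big_setID /=.
  by rewrite (sum_cyc_lab (cyc _ (ltnW ltks))) (sum_cyc_lab (cyc _ ltks)).
- move=> Q hQ; apply: (connected_of_transitive real) => //.
  + move=> z; have [l1 l2 w_gt0] := range z; exists (eb (ctriple z)).
    have leks := leq_trans l1 l2; have [_ _ /(_ z) h] := cyc_labP _ _ _ (cyc _ leks).
    have /card_gt0P[u] : (0 < #|fib (canonical (inord (eb (ctriple z)))) z|)%N.
      by rewrite h // inE leqnn.
    by rewrite inE => /eqP; exists u.
  + by move=> z; have [] := range z.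
  by rewrite path_of_canonical.
- rewrite filter_codom; have := cycle_type_lab _ (cyc 0 isT); rewrite !ffunE /=.
  have -> : active ctriple 0 = [set z | eb (ctriple z) == 0].
    by apply/setP=> z; rewrite !inE; have [] := range z; lia.
  rewrite (_ : inord 0 = ord0); last by apply: val_inj; rewrite /= inordK.
  by apply=> z _; have [] := range z.
rewrite filter_codom; have := cycle_type_lab _ (cyc s (leqnn s)); rewrite !ffunE /=.
have -> : active ctriple s = [set z | et (ctriple z) == s].
  by apply/setP=> z; rewrite !inE; have [] := range z; lia.
rewrite (_ : inord s = ord_max); last by apply: val_inj; rewrite /= inordK.
by apply=> z _; have [] := range z.
Qed.

End Canonical.

(** Turns equality of multisets into an isomorphism of indexed graphs, through the permutation of
    positions supplied by [perm_iotaP]. *)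
Lemma perm_codomP (T : eqType) (I J : finType) (f : I -> T) (g : J -> T) :
  reflect (exists2 h : I -> J, bijective h & forall i, g (h i) = f i)
    (perm_eq (codom f) (codom g)).
Proof.
apply: (iffP idP) => [fg|[h [h' hK h'K] gh]]; last first.
  rewrite !codomE.
  have -> : [seq f i | i <- enum I] = [seq g j | j <- [seq h i | i <- enum I]].
    by rewrite -map_comp; apply: eq_map => i /=.
  apply: perm_map; apply: uniq_perm; rewrite ?enum_uniq //.
    by rewrite map_inj_uniq ?enum_uniq //; apply: can_inj hK.
  by move=> j; rewrite mem_enum -[j]h'K map_f ?mem_enum.
have cIJ : #|I| = #|J| by have := perm_size fg; rewrite !size_codom.
case: (pickP I) => [i0 _|I0]; last first.
  have J0 : #|J| = 0 by rewrite -cIJ; apply: eq_card0.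
  have noI (i : I) : False by have := I0 i.
  have noJ (j : J) : False by have := card0_eq J0 j.
  exists (fun i => False_rect J (noI i)) => [|i]; last by case: (noI i).
  by exists (fun j => False_rect I (noJ j)) => i; [case: (noI i) | case: (noJ i)].
have /perm_iotaP-/(_ (f i0))[Is Isp E] := fg.
have sIs : size Is = #|J| by rewrite (perm_size Isp) size_iota size_codom.
have ltIs (i : I) : (nth 0 Is (enum_rank i) < #|J|)%N.
  have : nth 0 Is (enum_rank i) \in Is by apply: mem_nth; rewrite sIs -cIJ.
  by rewrite (perm_mem Isp) mem_iota add0n size_codom => /andP[].
pose h i : J := enum_val (Ordinal (ltIs i)).
have gh i : g (h i) = f i.
  transitivity (nth (f i0) (codom f) (enum_rank i)).
    rewrite E (nth_map 0) ?sIs -?cIJ // codomE (nth_map (h i)) -?cardE ?ltIs //.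
    by congr g; rewrite [LHS](enum_val_nth (h i)).
  by rewrite codomE (nth_map i) -?cardE // nth_enum_rank.
exists h => //; apply: inj_card_bij; last by rewrite cIJ.
move=> i i' /enum_val_inj[/eqP]; rewrite nth_uniq ?sIs -?cIJ //; last first.
  by rewrite (perm_uniq Isp) iota_uniq.
by move=> /eqP/val_inj/enum_rank_inj.
Qed.

(** * Factorizations with a given graph *)

Definition good_path s d (eta nu : seq nat) (sg : {ffun 'I_s.+1 -> 'S_d}) :=
  [&& perm_eq (cycle_type (sg ord0)) eta,
      perm_eq (cycle_type (sg ord_max)) nu,
      [forall k : 'I_s, is_transposition ((sg (inord k))^-1 * sg (inord k.+1))] &
      [forall Z : {set 'I_d}, [forall k, forall u in Z, sg k u \in Z] ==>
         (Z == set0) || (Z == setT)]].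

Lemma good_pathP s d eta nu (sg : {ffun 'I_s.+1 -> 'S_d}) :
  reflect [/\ perm_eq (cycle_type (sg ord0)) eta,
              perm_eq (cycle_type (sg ord_max)) nu,
              forall k, (k < s)%N -> is_transposition ((sg (inord k))^-1 * sg (inord k.+1)) &
              transitive_path sg]
    (good_path eta nu sg).
Proof.
apply: (iffP and4P) => -[h1 h2 h3 h4]; split=> //.
- by move=> k ltks; have := forallP h3 (Ordinal ltks).
- move=> Z Zst; have /forallP/(_ Z)/implyP := h4.
  have Zst' : [forall k, forall u in Z, sg k u \in Z].
    by apply/forallP=> k; apply/forall_inP=> u; apply: Zst.
  by move/(_ Zst')/orP=> [/eqP->|/eqP->]; [left|right].
- by apply/forallP=> k; apply: h3.
apply/forallP=> Z; apply/implyP=> /forallP Zst.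
by case: (h4 Z) => [k u|->|->]; rewrite ?eqxx ?orbT //; apply: (forall_inP (Zst k)).
Qed.

Section Monodromy.
Variables (s d : nat) (eta nu : seq nat).
Hypothesis d_gt0 : (0 < d)%N.

Definition increments (sg : {ffun 'I_s.+1 -> 'S_d}) : {ffun 'I_s -> 'S_d} :=
  [ffun i : 'I_s => (sg (inord i))^-1 * sg (inord i.+1)].

(** A factorization is the sequence of its partial products; the relation makes the last entry the
    inverse of the final product, which has the same cycle type. *)
Definition monodromy_of (sg : {ffun 'I_s.+1 -> 'S_d}) :=
  (sg ord0, increments sg, (sg ord_max)^-1).

Lemma increments_prod (sg : {ffun 'I_s.+1 -> 'S_d}) k : (k <= s)%N ->
  sg ord0 * \prod_(i < k) ((sg (inord i))^-1 * sg (inord i.+1)) = sg (inord k).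
Proof.
elim: k => [|k IHk] ltks.
  by rewrite big_ord0 mulg1; congr (sg _); apply: val_inj; rewrite /= inordK.
by rewrite big_ord_recr /= mulgA IHk ?mulKVg // ltnW.
Qed.

Lemma inord_max n : inord n = ord_max :> 'I_n.+1.
Proof. by apply: val_inj; rewrite /= inordK. Qed.

Lemma is_monodromy_of sg : good_path eta nu sg = is_monodromy eta nu (monodromy_of sg).
Proof.
set Gr := <<[set sg ord0; (sg ord_max)^-1] :|: [set increments sg i | i : 'I_s]>>.
have memG k : sg k \in Gr.
  have : (k <= s)%N by rewrite -ltnS.
  rewrite -{2}[k]inord_val; elim: (val k) => [|j IHj] lejs.
    apply: mem_gen; rewrite !inE; apply/orP; left; apply/orP; left; apply/eqP.
    by congr (sg _); apply: val_inj; rewrite /= inordK.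
  rewrite -[sg (inord j.+1)](mulKVg (sg (inord j))) groupM ?IHj // ?(ltnW lejs) //.
  apply: mem_gen; rewrite inE; apply/orP; right; apply/imsetP.
  by exists (Ordinal lejs); rewrite // ffunE.
(* The entries of the tuple and the partial products generate the same group, so transitivity can be
   tested on sets stable under the partial products. *)
have transE : transitive_path sg <-> [transitive Gr, on [set: 'I_d] | 'P].
  split=> [tr|tr Z Zst].
    pose u0 := Ordinal d_gt0; apply/imsetP; exists u0 => //.
    case: (tr (orbit 'P Gr u0)) => // [k u /orbitP[p pG <-]|E].
      by apply/orbitP; exists (p * sg k); rewrite ?groupM // actM.
    by have := orbit_refl 'P Gr u0; rewrite E inE.
  have [->|[u uZ]] := set_0Vmem Z; [by left | right].
  have GZ : Gr \subset 'N(Z | 'P).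
    have sgN k : sg k \in 'N(Z | 'P).
      by rewrite !inE; apply/subsetP=> v vZ; rewrite !inE /= apermE Zst.
    rewrite gen_subG; apply/subsetP=> p; rewrite !in_setU !in_set1 => /orP[/orP[]/eqP->|] //.
      by rewrite groupV.
    by case/imsetP=> i _ ->; rewrite ffunE groupM ?groupV.
  apply/setP=> v; rewrite [RHS]inE.
  have : v \in orbit 'P Gr u by rewrite (atransP tr).
  by case/orbitP=> p pG <-; rewrite (acts_act GZ).
rewrite /monodromy_of /is_monodromy; apply/good_pathP/and5P=> [[h1 h2 h3 h4]|[h1 h2 h3 h4 h5]].
  split=> //; last by apply/transE.
  - by rewrite /cycle_type porbitsV.
  - by apply/forallP=> i; rewrite ffunE h3.
  - rewrite -eq_mulgV1 -inord_max -(increments_prod _ (leqnn s)); apply/eqP.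
    by congr (_ * _); apply: eq_bigr => i _; rewrite ffunE.
split=> //; last by apply/transE.
  by move: h2; rewrite /cycle_type porbitsV.
by move=> k ltks; have := forallP h3 (Ordinal ltks); rewrite ffunE.
Qed.

Lemma card_monodromy :
  #|[set m | @is_monodromy d s eta nu m]| = #|[set sg : {ffun 'I_s.+1 -> 'S_d} | good_path eta nu sg]|.
Proof.
rewrite -[RHS](card_in_imset (f := monodromy_of)); last first.
  move=> sg sg' _ _ [E0 E1 _]; apply/ffunP=> k; rewrite -[k]inord_val.
  have leks : (k <= s)%N by rewrite -ltnS.
  rewrite -!(increments_prod _ leks) E0; congr (_ * _).
  apply: eq_bigr => i _; have lti : (i < s)%N by apply: leq_trans (ltn_ord i) leks.
  by have /ffunP/(_ (Ordinal lti)) := E1; rewrite !ffunE.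
apply: eq_card => -[[se tau] sn]; rewrite inE.
apply/idP/imsetP => [mon|[sg]]; last by rewrite inE => gsg ->; rewrite -is_monodromy_of.
pose tn i := if insub i is Some o then tau o else 1.
pose sg : {ffun 'I_s.+1 -> 'S_d} := [ffun k : 'I_s.+1 => se * \prod_(i < k) tn i].
have E : (se, tau, sn) = monodromy_of sg.
  congr (_, _, _).
  - by rewrite ffunE big_ord0 mulg1.
  - apply/ffunP=> i; rewrite !ffunE !inordK ?ltnS //; last exact: ltnW.
    by rewrite big_ord_recr /= [se * (_ * _)]mulgA mulKg /tn valK.
  have /and5P[_ _ _ /eqP prod1 _] := mon.
  suff -> : sg ord_max = se * \prod_(i < s) tau i.
    by apply: (mulgI (se * \prod_(i < s) tau i)); rewrite mulgV.
  rewrite ffunE; congr (_ * _).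
  by apply: eq_bigr => i _; rewrite /tn valK.
by exists sg; rewrite // inE is_monodromy_of -E.
Qed.

Lemma good_mgraph sg : good_path eta nu sg -> mgraph s eta nu (codom (@ctriple s d sg)).
Proof.
case/good_pathP=> h1 h2 h3 h4; case: (canonical_mgraph h3 h4) => g1 g2 g3 g4 g5 g6.
by split=> //; [apply: perm_trans g5 h1 | apply: perm_trans g6 h2].
Qed.

Hypothesis s_gt0 : (0 < s)%N.
Variables (I : finType) (f : I -> edge).
Hypothesis (Gf : mgraph s eta nu (codom f)).

(** Any realization is matched with the canonical one by [realization_iso]; conversely, an
    isomorphism of graphs transports the canonical labelling. *)
Lemma path_of_realizations : @path_of s d I @: realizations s d f =
  [set sg : {ffun 'I_s.+1 -> 'S_d} | good_path eta nu sg && perm_eq (codom (@ctriple s d sg)) (codom f)].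
Proof.
apply/setP=> sg; rewrite inE; apply/imsetP/andP=> [[x xf ->]|[gsg /perm_codomP[h hb fh]]].
  have cyc k (leks : (k <= s)%N) := realization_cyc xf leks.
  have gsg : good_path eta nu (path_of x).
    have w_gt0 (A : {set I}) i : i \in A -> (0 < ew (f i))%N by have [] := f_range Gf i.
    apply/good_pathP; split.
    - have := cycle_type_lab (@w_gt0 _) (cyc 0 isT); rewrite perm_sym ffunE.
      rewrite (_ : inord 0 = ord0); last by apply: val_inj; rewrite /= inordK.
      by rewrite (active0 Gf) -(filter_codom f (fun e => eb e == 0)) => /perm_trans; apply; apply: mg_in Gf.
    - have := cycle_type_lab (@w_gt0 _) (cyc s (leqnn s)); rewrite perm_sym ffunE inord_max.
      have -> : active f s = [set z | et (f z) == s].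
        by apply/setP=> z; rewrite !inE; have [] := f_range Gf z; lia.
      by rewrite -(filter_codom f (fun e => et e == s)) => /perm_trans; apply; apply: mg_out Gf.
    - move=> k ltks; have /andP[] := realization_step xf ltks.
      by rewrite !ffunE.
    exact: (transitive_of_connected xf s_gt0 Gf).
  split=> //; apply/perm_codomP; have [_ _ h3 _] := good_pathP _ _ _ gsg.
  have [|h hb [fh _]] := realization_iso (good_mgraph gsg) Gf (canonical_realization h3) xf.
    by move=> k; rewrite !ffunE.
  by exists h.
have [_ _ h3 _] := good_pathP _ _ _ gsg.
exists (map_lab h (canonical sg)); last by apply/ffunP=> k; rewrite !ffunE.
exact: (map_lab_realization hb fh (canonical_realization h3)).
Qed.

Lemma card_good_paths_of : sumn eta = d ->
  (#|[set sg : {ffun 'I_s.+1 -> 'S_d} | good_path eta nu sg && perm_eq (codom (@ctriple s d sg)) (codom f)]| * #|autg f| =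
   d`! * \prod_(i | (0 < eb (f i)) && (et (f i) < s)) ew (f i))%N.
Proof.
move=> d_eta; rewrite -path_of_realizations (card_realizations_aut _ Gf).
exact: (card_realizations Gf).
Qed.

End Monodromy.

(** * Automorphisms of a graph without triple edges *)

Section Twins.
Variables (I : finType) (T : eqType) (f : I -> T) (o : I -> nat).
Hypotheses (o_inj : injective o)
  (f2 : forall i j k, f i = f j -> f j = f k -> [|| i == j, j == k | k == i]).

(* Contains exactly one element of each fibre of [f] with two elements. *)
Definition lower : {set I} := [set i | [exists j, (f i == f j) && (o i < o j)%N]].

Let twin i := odflt i [pick j | (j != i) && (f j == f i)].

Let f_twin i : f (twin i) = f i.
Proof. by rewrite /twin; case: pickP => //= j /andP[_ /eqP]. Qed.

Let twin_eq i j : f j = f i -> j != i -> j = twin i.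
Proof.
move=> ji ne; rewrite /twin; case: pickP => [k /andP[nk /eqP ki]|/(_ j)]; last first.
  by rewrite ne ji eqxx.
have := f2 (esym ji) (etrans ji (esym ki)).
by rewrite (negPf nk) orbF eq_sym (negPf ne) /= => /eqP.
Qed.

Let twinK : involutive twin.
Proof.
move=> i; have [E|ne] := eqVneq (twin i) i; first by rewrite !E.
by apply/esym/twin_eq; rewrite ?f_twin // eq_sym.
Qed.

Let lower_twin i : i \in lower -> twin i != i /\ (o i < o (twin i))%N.
Proof.
rewrite inE => /existsP[j /andP[/eqP ij lt]].
have ne : j != i by apply: contraTneq lt => ->; rewrite ltnn.
by rewrite -(twin_eq (esym ij) ne).
Qed.

Let not_lower i : i \notin lower -> twin i != i -> twin i \in lower.
Proof.
move=> ni ne; rewrite inE; apply/existsP; exists i; rewrite f_twin eqxx /=.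
rewrite ltn_neqAle (inj_eq o_inj) ne /= leqNgt; apply: contra ni => lt.
by rewrite inE; apply/existsP; exists (twin i); rewrite f_twin eqxx.
Qed.

(** An automorphism fixes or swaps each pair with equal values, independently; the part of [lower]
    that it moves records the swaps. *)
Lemma card_twin_aut :
  #|[set p : {perm I} | [forall i, f (p i) == f i]]| = (2 ^ #|lower|)%N.
Proof.
rewrite -card_powerset -(card_in_imset (f := fun p : {perm I} => [set i in lower | p i != i])).
  apply: eq_card => Z; rewrite powersetE; apply/imsetP/idP => [[p _ ->]|/subsetP ZL].
    by apply/subsetP=> i; rewrite inE => /andP[].
  pose q i := if (i \in Z) || (twin i \in Z) then twin i else i.
  have qK : involutive q.
    move=> i; rewrite {2}/q; case: ifPn => [h|/negPf h]; last by rewrite /q h.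
    by rewrite /q twinK orbC h.
  exists (perm (inv_inj qK)).
    by rewrite inE; apply/forallP=> i; rewrite permE /q; case: ifP; rewrite ?f_twin.
  apply/setP=> i; rewrite inE permE /q.
  apply/idP/andP=> [iZ|[iL]]; first by rewrite iZ ZL //; have [] := lower_twin (ZL i iZ).
  case: (boolP (i \in Z)) => //= _; case: ifP => [tZ _|]; last by rewrite eqxx.
  have [_] := lower_twin iL; have [_] := lower_twin (ZL _ tZ).
  by rewrite twinK => lt lt'; have := ltn_trans lt lt'; rewrite ltnn.
move=> p q; rewrite !inE => /forallP pf /forallP qf /setP E.
have two r i : [forall i, f (r i) == f i] -> r i = i \/ r i = twin i.
  move=> /forallP rf; have [->|ne] := eqVneq (r i) i; [by left | right].
  by apply: twin_eq => //; apply/eqP.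
have fixE (r : {perm I}) i : [forall i, f (r i) == f i] -> (r (twin i) == twin i) = (r i == i).
  move=> rf; apply/eqP/eqP=> ri.
    have [//|ri'] := two r i rf.
    by have := perm_inj (etrans ri' (esym ri)) => E'; rewrite {1}E' ri.
  have [//|ri'] := two r (twin i) rf; rewrite twinK in ri'.
  by have := perm_inj (etrans ri' (esym ri)) => ->; rewrite ri.
have pf' : [forall i, f (p i) == f i] by apply/forallP.
have qf' : [forall i, f (q i) == f i] by apply/forallP.
suff pq i : (p i == i) = (q i == i).
  apply/permP=> i; have [pi|ne] := eqVneq (p i) i.
    by rewrite pi; apply/esym/eqP; rewrite -pq pi.
  have [/eqP|->] := two p i pf'; first by rewrite (negPf ne).
  by have [/eqP|->] := two q i qf'; first by rewrite -pq (negPf ne).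
have pqL j : j \in lower -> (p j == j) = (q j == j).
  by move=> jL; have := E j; rewrite !in_set -!/(_ \in lower); rewrite inE in jL;
    rewrite jL /= => /negb_inj.
have [iL|niL] := boolP (i \in lower); first exact: pqL.
have [ti|ne] := eqVneq (twin i) i.
  by have [->|->] := two p i pf'; have [->|->] := two q i qf'; rewrite ?ti ?eqxx.
by rewrite -(fixE p) // -(fixE q) //; apply: pqL; apply: not_lower.
Qed.

End Twins.

(** Three equal edges would fill a vertex from one side, and balance would give them total weight 0.
    The vertex used is the upper one for initial ends and the lower one otherwise. *)
Lemma mgraph_fibre2 s eta nu (I : finType) (f : I -> edge) : (0 < s)%N ->
  mgraph s eta nu (codom f) ->
  forall i j k, f i = f j -> f j = f k -> [|| i == j, j == k | k == i].
Proof.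
move=> s_gt0 G i j k ij jk; apply: contraT; rewrite !negb_or => /and3P[nij njk nki].
have c3 (A : {set I}) : i \in A -> j \in A -> k \in A -> (3 <= #|A|)%N.
  move=> iA jA kA; rewrite (cardsD1 i) (cardsD1 j) (cardsD1 k) iA !inE eq_sym nij jA.
  by rewrite eq_sym njk nki kA.
have empty v (p q : pred edge) : (v < s)%N ->
    (count p (codom f) + count q (codom f) = 3)%N ->
    (\sum_(e <- codom f | p e) ew e = \sum_(e <- codom f | q e) ew e)%N ->
    p (f i) -> false.
  move=> ltv; rewrite !count_codom !sum_codom => c bal pi.
  have := c3 [set i | p (f i)]; rewrite !inE -jk -ij pi => /(_ isT isT isT) le3.
  have q0 : #|[set i | q (f i)]| = 0 by lia.
  move: bal; rewrite (cards0_eq q0) big_set0 (bigD1 i) ?inE //=.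
  by have [_ _] := f_range G i; case: (ew _).
have [b0|b_gt0] := posnP (eb (f i)).
  have lt := no_through G s_gt0 b0.
  exact: (empty _ (fun e => et e == et (f i)) _ lt (mg_triv G lt) (mg_bal G lt)).
have lt : ((eb (f i)).-1 < s)%N.
  by have [bt ts _] := f_range G i; rewrite prednK // (leq_trans bt).
have := mg_triv G lt; have := esym (mg_bal G lt); rewrite addnC prednK // => bal c.
exact: (empty _ (fun e => eb e == eb (f i)) _ lt c bal).
Qed.

Import Order.TTheory GRing.Theory Num.Theory.
Local Open Scope ring_scope.

(** * Index and determinant of an integer matrix *)

Definition diag_part (m n rho : nat) (e : nat -> int) : 'M[int]_(m, n) :=
  \matrix_(i, j) (e i *+ ((i == j :> nat) && (i < rho)%N)).

Lemma smith_rank m n (M : 'M[int]_(m, n)) :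
  exists2 L, L \in unitmx & exists2 R, R \in unitmx & exists rho (e : nat -> int),
  [/\ (rho <= m)%N /\ (rho <= n)%N, forall i, e i != 0,
      M = L *m diag_part m n rho e *m R &
      \rank (map_mx intr M : 'M[rat]_(m, n)) = rho].
Proof.
have [L Lu [R Ru [d d_dvd defM]]] := int_Smith_normal_form M.
have d0 i j : (i <= j)%N -> d`_i = 0 -> d`_j = 0.
  move=> leij; case: (ltnP j (size d)) => [ltj|lej _]; last by rewrite nth_default.
  have /(_ i j) := @sorted_leq_nth _ dvdz (@dvdz_trans) dvdzz 0 d d_dvd.
  by rewrite !inE (leq_ltn_trans leij ltj) ltj => /(_ isT isT leij) /dvdzP[q ->] ->; rewrite mulr0.
(* By divisibility a zero entry is followed by zeros only, so the nonzero entries are the first [q];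
   past them [e] is set to 1, to be nonzero everywhere. *)
pose q := index 0 d; pose rho := minn q (minn m n).
pose e i := if (i < q)%N then d`_i else 1.
have dq i : (i < q)%N = (d`_i != 0).
  case: ltnP => [lti|lei]; apply/esym.
    by have /= -> := before_find 0 lti.
  apply/negbTE/negPn/eqP; apply: d0 lei _; rewrite /q.
  by have [d_0|nd] := boolP (0 \in d); [rewrite nth_index | rewrite memNindex ?nth_default].
have e0 i : e i != 0 by rewrite /e dq; case: ifP => // ->.
have defS : \matrix_(i < m, j < n) (d`_i *+ (i == j :> nat)) = diag_part m n rho e.
  apply/matrixP=> i j; rewrite !mxE; case: eqP => //= ij.
  have -> : (i < rho)%N = (i < q)%N by rewrite /rho !leq_min ltn_ord {2}ij ltn_ord !andbT.
  rewrite /e dq.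
  by case: eqP => [->|].
rewrite defS in defM.
have [lem len] : (rho <= m)%N /\ (rho <= n)%N by rewrite /rho; lia.
exists L => //; exists R => //; exists rho, e; split=> //.
rewrite defM !map_mxM; set Lq := map_mx _ L; set Rq := map_mx _ R.
have Uq k (X : 'M[int]_k) : X \in unitmx -> (map_mx intr X : 'M[rat]_k) \in unitmx.
  rewrite !unitmxE det_map_mx => /unitrP[y [_ yX]].
  by apply/unitrP; exists (y%:~R); rewrite -!rmorphM /= yX mulrC yX.
rewrite mxrankMfree ?row_free_unit ?Uq //.
rewrite (eqmxMfull _ (_ : row_full Lq)) ?row_full_unit ?Uq //.
have -> : map_mx intr (diag_part m n rho e) =
    diag_mx (\row_i (e i)%:~R) *m pid_mx rho :> 'M[rat]_(m, n).
  apply/matrixP=> i j; rewrite mul_diag_mx !mxE.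
  by case: (_ && _); rewrite ?mulr1 ?mulr0.
rewrite eqmxMfull ?rank_pid_mx // row_full_unit unitmxE det_diag unitfE.
by apply/prodf_neq0 => i _; rewrite mxE intr_eq0.
Qed.

Lemma diag_part_mul m n rho e (x : 'cV[int]_n) (i : 'I_m) (j : 'I_n) : (i < rho)%N -> i = j :> nat ->
  (diag_part m n rho e *m x) i 0 = e i * x j 0.
Proof.
move=> lti ij; rewrite mxE (bigD1 j) //= mxE ij eqxx -ij lti big1 ?addr0 // => k.
rewrite mxE => /negPf nk; case: eqP => //=; rewrite ?mulr0n ?mul0r // ij => /val_inj E.
by rewrite E eqxx in nk.
Qed.

Definition lattice_ker m n (M : 'M[int]_(m, n)) : set 'cV[int]_n := [set x | M *m x = 0]%classic.

Lemma smith_ker_basis m n k rho e (L : 'M[int]_m) (R : 'M[int]_n) :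
  L \in unitmx -> R \in unitmx -> (forall i, e i != 0) ->
  (rho <= m)%N -> n = (rho + k)%N ->
  is_lattice_basis (lattice_ker (L *m diag_part m n rho e *m R))
    (invmx R *m \matrix_(i < n, j < k) (i == rho + j :> nat)%N%:R).
Proof.
move=> Lu Ru e0 lem En; set E := \matrix_(i, j) _.
have ltj (j : 'I_k) : (rho + j < n)%N by rewrite En ltn_add2l.
have Ecoef (c : 'cV[int]_k) j : (E *m c) (Ordinal (ltj j)) 0 = c j 0.
  rewrite mxE (bigD1 j) //= mxE eqxx mul1r big1 ?addr0 // => j' /negPf nj.
  by rewrite mxE /= eqn_add2l eq_sym -[X in X%:R]/((j' == j) : nat) nj mul0r.
have Ecoef0 (c : 'cV[int]_k) (i : 'I_n) : (i < rho)%N -> (E *m c) i 0 = 0.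
  move=> lti; rewrite mxE big1 // => j _; rewrite mxE.
  by case: eqP => [Ei|]; rewrite ?mul0r //; move: lti; rewrite Ei; lia.
have lt_n (i : 'I_m) : (i < rho)%N -> (i < n)%N by move=> lti; rewrite En ltn_addr.
split=> [c|x].
  rewrite -mulmxA => /(congr1 (mulmx R)); rewrite mulmxA mulmxV // mul1mx mulmx0 => E0.
  by apply/colP=> j; rewrite -Ecoef E0 !mxE.
split=> [|[c ->]]; last first.
  rewrite /lattice_ker /= !mulmxA mulmxK // -!mulmxA -[RHS](mulmx0 _ L); congr (_ *m _).
  apply/colP=> i; rewrite mulmxA [RHS]mxE -mulmxA.
  have [lti|lei] := ltnP i rho.
    by rewrite (diag_part_mul _ _ lti (erefl : i = Ordinal (lt_n i lti) :> nat)) Ecoef0 ?mulr0.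
  by rewrite mxE big1 // => j _; rewrite mxE ltnNge lei andbF mul0r.
rewrite /lattice_ker /= -!mulmxA => /(congr1 (mulmx (invmx L))).
rewrite mulmx0 mulKmx // => S0.
exists (\col_j (R *m x) (Ordinal (ltj j)) 0).
rewrite -[LHS](mulKmx Ru) -mulmxA; congr (_ *m _); apply/colP=> i.
have [lti|lei] := ltnP i rho.
  rewrite Ecoef0 //; have ltm : (i < m)%N := leq_trans lti lem.
  have /colP/(_ (Ordinal ltm)) := S0; rewrite (diag_part_mul e (R *m x) (i := Ordinal ltm) (j := i) lti erefl) [RHS]mxE.
  by move/eqP; rewrite mulf_eq0 (negPf (e0 _)) => /eqP.
have lti : (i - rho < k)%N by have := ltn_ord i; lia.
have -> : i = Ordinal (ltj (Ordinal lti)) by apply: val_inj; rewrite /= subnKC.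
by rewrite Ecoef [RHS]mxE.
Qed.

Lemma lattice_ker_basis m n k (M : 'M[int]_(m, n)) :
  (\rank (map_mx intr M : 'M[rat]_(m, n)) + k)%N = n ->
  is_lattice_basis (lattice_ker M) (lattice_basis k (lattice_ker M)).
Proof.
have [L Lu [R Ru [rho [e [[lem len] e0 defM rk]]]]] := smith_rank M.
rewrite rk => rk_k; apply: xgetPex.
by eexists; rewrite defM; apply: smith_ker_basis.
Qed.

(** Makes determinants on a lattice independent, up to sign, of the choice made in
    [lattice_basis]. *)
Lemma lattice_basis_change n m (L : set 'cV[int]_n) (B B' : 'M[int]_(n, m)) :
  is_lattice_basis L B -> is_lattice_basis L B' ->
  exists2 U : 'M[int]_m, U \in unitmx & B' = B *m U.
Proof.
have sub (C C' : 'M[int]_(n, m)) : is_lattice_basis L C -> is_lattice_basis L C' ->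
    exists U : 'M[int]_m, C' = C *m U.
  move=> [_ LC] [_ LC'].
  have /fin_all_exists[u uP] j : exists u : 'cV[int]_m, col j C' = C *m u.
    by apply/LC/LC'; exists (delta_mx j 0); rewrite colE.
  exists (\matrix_(i, j) u j i 0); apply/matrixP=> i j.
  have /colP/(_ i) := uP j; rewrite !mxE => ->.
  by apply: eq_bigr => k _; rewrite mxE.
move=> bB bB'; have [U defB'] := sub _ _ bB bB'; have [V defB] := sub _ _ bB' bB.
exists U => //; suff UV : U *m V = 1%:M by case/mulmx1_unit: UV.
apply/matrixP=> i j; have [inj _] := bB.
have : B *m (col j (U *m V) - delta_mx j 0) = 0.
  by rewrite mulmxBr -colE !colE !mulmxA -defB' -defB subrr.
by move/inj/colP/(_ i); rewrite !mxE => /eqP; rewrite subr_eq0 => /eqP; rewrite eqxx andbT.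
Qed.

(** After the unimodular change by [L], the image is the product of the ideals generated by the
    [e i], and vectors of residues represent its cosets. *)
Lemma image_index_diag g n (L : 'M[int]_g) (R : 'M[int]_(g + n)) (e : nat -> int) :
  L \in unitmx -> R \in unitmx -> (forall i, e i != 0) ->
  image_index (L *m diag_part g (g + n) g e *m R) = (\prod_(i < g) `|e i|)%N.
Proof.
move=> Lu Ru e0; rewrite /image_index.
set A := L *m _ *m R.
pose coset y : set 'cV[int]_g := [set z | exists x : 'cV_(g + n), z = y + A *m x]%classic.
pose N := (\prod_(i < g) `|e i|)%N.
(* [N] bounds all the moduli, so that the residues live in one finite type. *)
pose F (i : 'I_g) : pred 'I_N.+1 := [pred t : 'I_N.+1 | (t < `|e i|)%N].
pose rep (phi : {ffun 'I_g -> 'I_N.+1}) := L *m \col_i (phi i : nat)%:Z.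
have leN (i : 'I_g) : (`|e i| <= N)%N.
  rewrite /N (bigD1 i) //= leq_pmulr // prodn_gt0 // => j.
  by rewrite absz_gt0.
have AE x : exists v : 'cV[int]_g, A *m x = L *m \col_i (e i * v i 0).
  exists (\col_i (R *m x) (lshift n i) 0); rewrite /A -!mulmxA; congr (_ *m _).
  by apply/colP=> i; rewrite (diag_part_mul _ _ (ltn_ord i) (erefl : i = lshift n i :> nat)) !mxE.
have AEr (v : 'cV[int]_g) : exists x, A *m x = L *m \col_i (e i * v i 0).
  exists (invmx R *m col_mx v 0); rewrite /A -!mulmxA mulKVmx //; congr (_ *m _).
  apply/colP=> i; rewrite (diag_part_mul _ _ (ltn_ord i) (erefl : i = lshift n i :> nat)).
  by rewrite col_mxEu !mxE.
have coset_eq y y' : (exists x, y = y' + A *m x) -> coset y = coset y'.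
  case=> x ->; apply/seteqP; split=> z /= [x' ->].
    by exists (x + x'); rewrite mulmxDr addrA.
  by exists (x' - x); rewrite mulmxBr -addrA [A *m x + _]addrC subrK.
have -> : [set K | exists y, K = coset y]%classic =
    [set` (imfset imfset_key (coset \o rep) (mem (family F)))%fset]%classic.
  apply/seteqP; split=> K /=; last by case/imfsetP=> phi /= _ ->; exists (rep phi).
  case=> y ->; pose v := invmx L *m y.
  have lt_e (i : 'I_g) : (`|(v i 0%R %% e i)%Z| < `|e i|)%N.
    by rewrite -ltz_nat gez0_abs ?modz_ge0 // ltz_mod.
  have lt_N (i : 'I_g) : (`|(v i 0%R %% e i)%Z| < N.+1)%N by rewrite ltnS ltnW // (leq_trans (lt_e i)).
  pose phi : {ffun 'I_g -> 'I_N.+1} := [ffun i => Ordinal (lt_N i)].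
  apply/imfsetP; exists phi; first by apply/familyP=> i; rewrite ffunE inE /= lt_e.
  apply: coset_eq => /=; have [x Ax] := AEr (\col_i (v i 0%R %/ e i)%Z); exists x.
  rewrite Ax /rep -mulmxDr -[LHS](mulKVmx Lu); congr (_ *m _); apply/colP=> i.
  rewrite !mxE ffunE /= gez0_abs ?modz_ge0 // -/v [LHS](divz_eq _ (e i)).
  by rewrite addrC mulrC -/v mxE.
rewrite set_fsetK card_in_imfset; last first.
  move=> phi phi' /familyP phiF /familyP phiF' /= E; apply/ffunP=> i; apply/val_inj.
  have : coset (rep phi) (rep phi) by exists 0; rewrite mulmx0 addr0.
  rewrite E => -[x]; have [v ->] := AE x.
  rewrite -mulmxDr => /(congr1 (mulmx (invmx L))); rewrite !mulKmx // => /colP/(_ i).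
  have := phiF i; have := phiF' i; rewrite !inE !mxE /=.
  move: (v i 0) => a; have [->|na] := eqVneq a 0; first by rewrite mulr0; lia.
  have : (`|e i| <= `|(e i * a)%R|)%N by rewrite abszM leq_pmulr ?absz_gt0.
  by move: (e i * a) => b; lia.
transitivity #|family F|.
  rewrite cardE; apply: perm_size; apply: uniq_perm; rewrite ?enum_uniq ?enum_finmem_uniq //.
rewrite card_family foldrE big_map big_enum /=; apply: eq_bigr => i _.
have lti := leN i.
have inj : injective (fun t : 'I_`|e i| => inord t : 'I_N.+1).
  move=> t u /(congr1 val); rewrite /= !inordK; try by rewrite ltnS (leq_trans _ lti) // ltnW.
  exact: val_inj.
rewrite -[RHS]card_ord -(card_image inj).
apply: eq_card => t; rewrite inE /=; apply/idP/imageP => [ltt|[u _ ->]].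
  by exists (Ordinal ltt) => //; apply: val_inj; rewrite /= inordK.
by rewrite inordK // ltnS (leq_trans _ lti) // ltnW.
Qed.

Lemma normz_unit (x y : int) : x * y = 1 -> `|y| = 1.
Proof.
move=> xy; have : (`|x| * `|y| == 1)%N by rewrite -abszM xy.
by rewrite muln_eq1 => /andP[_ /eqP y1]; rewrite -abszE y1.
Qed.

(** Generating all unit rows amounts to an integral left inverse, so the stack has determinant 1 or
    -1. *)
Lemma det_unimodular_stack g n (A0 : 'M[int]_(g, g + n)) (C0 : 'M[int]_(n, g + n)) D :
  (forall j, exists u : 'rV_(g + n), u *m col_mx A0 C0 = delta_mx 0 j) ->
  `|\det (col_mx (A0 *m D) (C0 *m D))| = `|\det D|.
Proof.
move=> surj; have [W WM] : exists W : 'M_(g + n), W *m col_mx A0 C0 = 1%:M.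
  have /fin_all_exists[u uP] := surj.
  exists (\matrix_j u j); apply/row_matrixP=> j.
  by rewrite row_mul rowK uP row1.
rewrite -mul_col_mx det_mulmx normrM (_ : `|\det (col_mx A0 C0)| = 1) ?mul1r //.
by apply: (@normz_unit (\det W)); rewrite -det_mulmx WM det1.
Qed.

Lemma rank_unimodular_stack g n N (A0 : 'M[int]_(g, N)) (C0 : 'M[int]_(n, N)) D :
  N = (g + n)%N ->
  (forall j, exists u : 'rV_(g + n), u *m col_mx A0 C0 = delta_mx 0 j) ->
  \det D != 0 -> \rank (map_mx intr (A0 *m D) : 'M[rat]_(g, N)) = g.
Proof.
move=> EN; subst N => surj detD.
set M := col_mx (A0 *m D) (C0 *m D).
have Mu : (map_mx intr M : 'M[rat]_(g + n)) \in unitmx.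
  by rewrite unitmxE det_map_mx unitfE intr_eq0 -normr_eq0 det_unimodular_stack // normr_eq0.
have := mxrank_unit Mu; rewrite map_col_mx -addsmxE.
have := mxrank_adds_leqif (map_mx intr (A0 *m D) : 'M[rat]_(g, g + n)) (map_mx intr (C0 *m D)).
case=> le _ rk; rewrite rk in le.
apply/eqP; rewrite eqn_leq rank_leq_row -(leq_add2r n) (leq_trans le) //.
by rewrite leq_add2l rank_leq_row.
Qed.

(** Multiplying the stacked matrix by the inverse of [R] from the Smith form of [A0 *m D] makes it
    block triangular: up to sign, one diagonal block has the index as determinant, and the other is
    [C0 *m D] on a basis of the kernel. Another basis changes at most the sign. *)
Lemma image_index_det g n N (A0 : 'M[int]_(g, N)) (C0 : 'M[int]_(n, N))
    (D : 'M[int]_N) (B : 'M[int]_(N, n)) : N = (g + n)%N ->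
  (forall j, exists u : 'rV_(g + n), u *m col_mx A0 C0 = delta_mx 0 j) ->
  \det D != 0 -> is_lattice_basis (lattice_ker (A0 *m D)) B ->
  (image_index (A0 *m D))%:Z * `|\det (C0 *m D *m B)| = `|\det D|.
Proof.
move=> EN surj detD; have rkA := rank_unimodular_stack EN surj detD.
subst N => bB; set M := col_mx (A0 *m D) (C0 *m D).
have detM : `|\det M| = `|\det D| by apply: det_unimodular_stack.
have [L Lu [R Ru [rho [e [_ e0 defA rk]]]]] := smith_rank (A0 *m D).
have {rk} Erho : rho = g by rewrite -rk.
subst rho; rewrite defA image_index_diag // -?defA.
have := smith_ker_basis (k := n) Lu Ru e0 (leqnn g) erefl; rewrite -defA => bB0.
set B0 := invmx R *m _ in bB0.
have [U Uu ->] := lattice_basis_change bB0 bB.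
have absU k (X : 'M[int]_k) : X \in unitmx -> `|\det X| = 1.
  by rewrite unitmxE => /unitrP[y [yX _]]; apply: normz_unit yX.
rewrite mulmxA det_mulmx normrM (absU _ U Uu) mulr1 -detM.
have MR0 : `|\det M| = `|\det (M *m invmx R)|.
  by rewrite det_mulmx normrM (absU _ (invmx R)) ?unitmx_inv // mulr1.
rewrite MR0 mul_col_mx defA mulmxK //.
pose Dg := diag_mx (\row_(i < g) e i).
have -> : diag_part g (g + n) g e = row_mx Dg 0.
  apply/matrixP=> i j; rewrite !mxE; case: splitP => k ->.
    by rewrite !mxE ltn_ord andbT.
  by rewrite mxE; case: eqP => //= E; have := ltn_ord i; rewrite E; lia.
rewrite mul_mx_row mulmx0 -[C0 *m D *m invmx R]hsubmxK -block_mxEv det_lblock normrM.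
rewrite [\det (L *m Dg)]det_mulmx normrM (absU _ L Lu) mul1r det_diag.
have -> : C0 *m D *m B0 = rsubmx (C0 *m D *m invmx R).
  rewrite /B0 mulmxA; set X := _ *m invmx R.
  have -> : (\matrix_(i < g + n, j < n) (i == (g + j)%N :> nat)%:R) = col_mx 0 1%:M :> 'M[int]_(g + n, n).
    apply/matrixP=> i j; rewrite !mxE; case: splitP => k ->; rewrite mxE.
      by case: eqP => // E; have := ltn_ord k; rewrite E; lia.
    by rewrite eqn_add2l.
  by rewrite -{1}[X]hsubmxK mul_row_col mulmx0 add0r mulmx1.
suff -> : (\prod_(i < g) `|e i|)%N = `|(\prod_i (\row_(i < g) e i) 0 i)%R|%N by rewrite abszE.
rewrite (big_morph absz abszM (erefl : `|1%R|%N = 1%N)).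
by apply: eq_bigr => i _; rewrite mxE.
Qed.

(** * Curves in a fibre of the branch map *)

(** For distinct heights and nonzero ends, the dimension clauses of [in_moduli] are derived from
    these conditions in [cell_dimE] and [regularE]. *)
Record in_fibre (R : realType) (r g : nat) (D : seq int) (p : 'rV[R]_r.+1)
    (a : ctype r) (C : curve R a) : Prop := InFibre {
  fibre_ctype : is_ctype g D a;
  fibre_cell : cell C;
  fibre_br : br C = p }.

Lemma foppK r (a : ctype r) : involutive (@fopp r a).
Proof. by case=> [[e b]|e] //=; rewrite negbK. Qed.

(** Selects one flag of each edge: the rising one of a bounded edge, and the only flag of an end,
    where [fopp] is the identity. *)
Definition primary r (a : ctype r) (f : flag a) := (0 < fdir f) || (fopp f == f).

Definition pflag r (a : ctype r) := {f : flag a | primary f}.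

Section Fibre.
Variables (R : realType) (r g : nat) (D : seq int) (p : 'rV[R]_r.+1).
Hypotheses (p_inj : injective (p ord0)) (D0 : 0 \notin D).

Section Time.
Variables (a : ctype r) (C : curve R a).

Definition time (v : 'I_(nvert a)) : nat := #|[set j | p ord0 j < hv C v]|.

(* The end of [f] at which [h] is smaller is the source of the edge. *)
Definition ftriple (f : flag a) : edge :=
  if fopp f == f then
    if fdir f < 0 then (0, time (fvert f), `|fdir f|)%N
    else ((time (fvert f)).+1, r.+1, `|fdir f|)%N
  else ((time (fvert f)).+1, time (fvert (fopp f)), `|fdir f|)%N.

Definition ptriple (z : pflag a) : edge := ftriple (val z).

End Time.

Variables (a : ctype r) (C : curve R a) (aC : in_fibre g D p C).

Let ct := fibre_ctype aC.

Lemma hv_lab i : hv C (lab a i) = p ord0 i.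
Proof. by rewrite -(fibre_br aC) mxE. Qed.

Lemma lab_inj : injective (lab a).
Proof. by move=> i j E; apply: p_inj; rewrite -!hv_lab E. Qed.

Lemma lab_surj v : exists i, lab a i = v.
Proof.
have [/card_gt0P[i]] := ctype_labels ct v.
by rewrite inE => /eqP <-; exists i.
Qed.

Lemma hv_inj : injective (hv C).
Proof.
move=> v w; have [i <-] := lab_surj v; have [j <-] := lab_surj w.
by rewrite !hv_lab => /p_inj ->.
Qed.

Lemma nlab1 (v : 'I_(nvert a)) : nlab v = 1%N.
Proof.
have [i <-] := lab_surj v; rewrite /nlab (_ : [set _ | _] = [set i]) ?cards1 //.
by apply/setP=> j; rewrite !inE (inj_eq lab_inj).
Qed.

(** With a single label the labelling rule reads 3 = val + 2k, and val > 1. *)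
Lemma valence3 (v : 'I_(nvert a)) : valence v = 3%N.
Proof.
have [_ [k]] := ctype_labels ct v; have := ctype_valence ct v.
by rewrite nlab1; lia.
Qed.

Lemma nvertE : nvert a = r.+1.
Proof.
rewrite -[LHS]card_ord -[RHS]card_ord -(card_imset _ lab_inj).
by apply: eq_card => v; have [i <-] := lab_surj v; rewrite imset_f.
Qed.

Lemma affine_flag e b : hv C (fvert (fopp (inl (e, b) : flag a))) -
  hv C (fvert (inl (e, b) : flag a)) = (fdir (inl (e, b) : flag a))%:~R * len C e.
Proof.
have [aff _] := fibre_cell aC; case: b => /=; last exact: aff.
by rewrite rmorphN mulNr -aff opprB.
Qed.

Lemma len_gt0 e : 0 < len C e.
Proof. by have [_] := fibre_cell aC; apply. Qed.

Lemma edir_neq0 (i : 'I_(nend a)) : edir i != 0.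
Proof.
apply: contraNneq D0 => <-; rewrite -(perm_mem (ctype_degree ct)).
by apply: map_f; rewrite mem_enum.
Qed.

(** A contracted edge joins vertices of equal height, hence is a loop. Balance makes the third flag
    contracted too; it is not an end, as 0 is not in [D], so it belongs to a second loop and the
    vertex has four flags. *)
Lemma dir_neq0 (e : 'I_(nbedge a)) : dir e != 0.
Proof.
apply/eqP=> e0; have [aff _] := fibre_cell aC.
have st : tgt e = src e.
  by apply: hv_inj; apply/eqP; rewrite -subr_eq0 aff e0 mul0r.
set v := src e in st; pose S := [set f : flag a | fvert f == v].
pose f0 : flag a := inl (e, false); pose f1 : flag a := inl (e, true).
have S0 : f0 \in S by rewrite inE.
have S1 : f1 \in S by rewrite inE /= st.
have n01 : f1 != f0 by apply/eqP=> -[].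
have := valence3 v; rewrite /valence -/S (cardsD1 f0) (cardsD1 f1) S0 !inE n01 /=.
rewrite {1}st eqxx /= => -[] /eqP/cards1P[f fE].
have /setP/(_ f) := fE; rewrite !inE eqxx => /and3P[nf1 nf0 fv].
have f2 : fdir f = 0.
  have := ctype_balanced ct v; rewrite (bigD1 f0) ?eqxx //= (bigD1 f1) ?n01 /= ?st ?eqxx //=.
  rewrite e0 oppr0 !add0r (bigD1 f) ?fv ?nf1 ?nf0 //= big1 ?addr0 // => f'.
  case/andP=> /andP[/andP[f'v n0] n1] n2; have /setP/(_ f') := fE.
  by rewrite !inE n1 n0 f'v (negPf n2).
case: f {fE} f2 nf1 nf0 fv => [[e' b]|i] /=; last by move/eqP; rewrite (negPf (edir_neq0 i)).
move=> e'0 nf1 nf0 fv.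
have e'0' : dir e' = 0 by case: b e'0 {nf1 nf0 fv} => //= /eqP; rewrite oppr_eq0 => /eqP.
have st' : tgt e' = src e'.
  by apply: hv_inj; apply/eqP; rewrite -subr_eq0 aff e'0' mul0r.
have v' : src e' = v by case: b fv {nf1 nf0 e'0} => /eqP; rewrite ?st'.
have ne : e' != e.
  by apply: contraNneq nf1 => E; case: b nf0 {fv e'0} => //=; rewrite E ?eqxx.
have := valence3 v; rewrite /valence -/S.
pose g0 : flag a := inl (e', false); pose g1 : flag a := inl (e', true).
have le4 : (4 <= #|S|)%N.
  have nfg b0 b1 : inl (e, b0) != inl (e', b1) :> flag a.
    by apply: contraNneq ne => -[->].
  have ng01 : g0 != g1 by apply/eqP=> -[].
  have <- : #|[:: f0; f1; g0; g1]| = 4%N.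
    by apply/card_uniqP; rewrite /= !inE eq_sym (negPf n01) !(negPf (nfg _ _)) (negPf ng01).
  apply/subset_leq_card/subsetP=> f; rewrite !inE => /or4P[] /eqP -> /=;
    by rewrite ?st ?st' ?v'.
by move=> c3; rewrite c3 in le4.
Qed.

Lemma fdir_neq0 f : fdir (a := a) f != 0.
Proof.
case: f => [[e []]|i] /=; rewrite ?oppr_eq0; by [apply: dir_neq0 | apply: edir_neq0].
Qed.

Lemma fdir_opp (f : flag a) : fopp f != f -> fdir (fopp f) = - fdir f.
Proof. by case: f => [[e []]|i] //=; rewrite ?opprK // eqxx. Qed.

Lemma hv_lt (f : flag a) : fopp f != f -> 0 < fdir f -> hv C (fvert f) < hv C (fvert (fopp f)).
Proof.
case: f => [[e b]|i] nf pf; last by rewrite eqxx in nf.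
by rewrite -subr_gt0 affine_flag mulr_gt0 ?len_gt0 // ltr0z.
Qed.

Lemma time_lt v w : (time C v < time C w)%N = (hv C v < hv C w).
Proof.
have sub v' w' : hv C v' <= hv C w' -> (time C v' <= time C w')%N.
  move=> le; apply/subset_leq_card/subsetP=> j; rewrite !inE => lt.
  exact: lt_le_trans lt le.
have [lt|le] := ltP (hv C v) (hv C w); last by rewrite ltnNge sub.
apply/proper_card/properP; split.
  by apply/subsetP=> j; rewrite !inE => ltj; apply: lt_trans ltj lt.
by have [i iE] := lab_surj v; exists i; rewrite !inE -hv_lab iE ?ltxx.
Qed.

Lemma time_inj : injective (time C).
Proof.
move=> v w E; apply/hv_inj/eqP; case: ltgtP => // lt.
  by have := time_lt v w; rewrite E ltnn lt.
by have := time_lt w v; rewrite E ltnn lt.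
Qed.

Lemma time_ltr v : (time C v < r.+1)%N.
Proof.
rewrite -[X in (_ < X)%N]card_ord -cardsT; apply/proper_card/properP; split.
  exact/subsetP.
by have [i iE] := lab_surj v; exists i; rewrite !inE // -hv_lab iE ltxx.
Qed.

Lemma time_surj k : (k < r.+1)%N -> exists v, time C v = k.
Proof.
move=> ltk; pose t v := Ordinal (time_ltr v).
have t_inj : injective t by move=> v w /(congr1 val) /time_inj.
have [|t' tK t'K] := inj_card_bij t_inj; first by rewrite !card_ord nvertE.
by exists (t' (Ordinal ltk)); have /(congr1 val) := t'K (Ordinal ltk).
Qed.

Local Notation F := (@ptriple a C).

Lemma ptriple_range z : [/\ eb (F z) <= et (F z), et (F z) <= r.+1 & 0 < ew (F z)]%N.
Proof.
rewrite /ptriple /ftriple; case: z => f /= pf.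
have := fdir_neq0 f; have [ef|nf] := boolP (fopp f == f).
  have lt := time_ltr (fvert f).
  by case: ifP => _ nz; split; rewrite /eb /et /ew /= ?absz_gt0 // ltnW.
have pf' : 0 < fdir f by move: pf; rewrite /primary (negPf nf) orbF.
move=> nz; split; rewrite /eb /et /ew /= ?absz_gt0 //.
  by rewrite time_lt hv_lt.
exact/ltnW/time_ltr.
Qed.

Lemma ptriple_out z v : (eb (F z) == (time C v).+1) = (fvert (val z) == v) && (0 < fdir (val z)).
Proof.
rewrite /ptriple /ftriple; case: z => f /= pf; have := fdir_neq0 f.
have [ef|nf] := boolP (fopp f == f).
  case: ltgtP => // lt _; rewrite /eb /= ?andbF // eqSS (inj_eq time_inj).
  by rewrite andbT.
move=> _; have -> : 0 < fdir f by move: pf; rewrite /primary (negPf nf) orbF.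
by rewrite /eb /= eqSS (inj_eq time_inj) andbT.
Qed.

Lemma ptriple_in z v : (et (F z) == time C v) =
  (fvert (fopp (val z)) == v) && (fdir (fopp (val z)) < 0).
Proof.
have lt := time_ltr v.
rewrite /ptriple /ftriple; case: z => f /= pf; have := fdir_neq0 f.
have [/eqP ef|nf] := boolP (fopp f == f).
  rewrite ef; case: ltgtP => // _ _; rewrite /et /= ?andbF ?andbT ?(inj_eq time_inj) //.
  by apply/eqP=> E; rewrite -E ltnn in lt.
move=> _; have pf' : 0 < fdir f by move: pf; rewrite /primary (negPf nf) orbF.
by rewrite fdir_opp // oppr_lt0 pf' /et /= (inj_eq time_inj) andbT.
Qed.

Lemma primary_in (f : flag a) : fdir f < 0 -> primary (fopp f).
Proof.
move=> nf; rewrite /primary foppK; have [/eqP ->|ne] := boolP (fopp f == f).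
  by rewrite eqxx orbT.
by rewrite fdir_opp // oppr_gt0 nf.
Qed.

Lemma sum_out v (G : flag a -> nat) :
  (\sum_(z in [set z | eb (F z) == (time C v).+1]) G (val z) =
   \sum_(f | (fvert f == v) && (0 < fdir f)%R) G f)%N.
Proof.
pose P : pred (flag a) := fun f => (fvert f == v) && (0 < fdir f).
rewrite (reindex_omap (val : pflag a -> flag a) insub) /=.
  by apply: eq_bigl => z; rewrite inE ptriple_out valK eqxx andbT.
by move=> f /andP[_ pf]; rewrite insubT // /primary pf.
Qed.

Lemma sum_in v (G : flag a -> nat) :
  (\sum_(z in [set z | et (F z) == time C v]) G (fopp (val z)) =
   \sum_(f | (fvert f == v) && (fdir f < 0)%R) G f)%N.
Proof.
rewrite (reindex_omap (fun z : pflag a => fopp (val z)) (fun f => insub (fopp f))) /=.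
  apply: eq_bigl => z; rewrite inE ptriple_in.
  by rewrite foppK valK eqxx andbT.
by move=> f /andP[_ nf]; rewrite insubT ?primary_in //= foppK.
Qed.

Lemma fdirP (f : flag a) : (fdir f < 0) = ~~ (0 < fdir f).
Proof. by have := fdir_neq0 f; case: ltgtP. Qed.

Lemma ptriple_triv v : (#|[set z | et (F z) == time C v]| +
  #|[set z | eb (F z) == (time C v).+1]| = 3)%N.
Proof.
rewrite -!sum1_card (sum_out v (fun=> 1%N)) (sum_in v (fun=> 1%N)) -(valence3 v).
rewrite /valence -sum1_card [RHS](bigID (fun f : flag a => fdir f < 0)) /=.
congr (_ + _)%N; apply: eq_bigl => f; rewrite inE // fdirP negbK //.
Qed.

Lemma ew_opp z : ew (F z) = `|fdir (fopp (val z))|%N.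
Proof.
rewrite /ptriple /ftriple; case: ifP => [/eqP ->|/negbT nf]; first by case: ifP.
by rewrite fdir_opp // abszN.
Qed.

Lemma ewE z : ew (F z) = `|fdir (val z)|%N.
Proof. by rewrite /ptriple /ftriple; case: ifP => //; case: ifP. Qed.

Lemma ptriple_bal v : (\sum_(z in [set z | et (F z) == time C v]) ew (F z) =
  \sum_(z in [set z | eb (F z) == (time C v).+1]) ew (F z))%N.
Proof.
rewrite (eq_bigr (fun z => `|fdir (fopp (val z))|%N)) => [|z _]; last exact: ew_opp.
rewrite [RHS](eq_bigr (fun z => `|fdir (val z)|%N)) => [|z _]; last exact: ewE.
rewrite (sum_in v (fun f => `|fdir f|%N)) (sum_out v (fun f => `|fdir f|%N)).
have := ctype_balanced ct v; rewrite (bigID (fun f : flag a => 0 < fdir f)) /=.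
rewrite (eq_bigr (fun f : flag a => (`|fdir f|%N)%:Z)) => [|f /andP[_ pf]]; last first.
  by rewrite gez0_abs // ltW.
rewrite [X in _ + X](eq_bigr (fun f : flag a => - (`|fdir f|%N)%:Z)) => [|f /andP[_]]; last first.
  by rewrite -fdirP => nf; rewrite ltz0_abs ?opprK.
rewrite sumrN -!(big_morph Posz PoszD (erefl 0%:Z)) => /eqP; rewrite subr_eq0 => /eqP[->].
by apply: eq_bigl => f; rewrite fdirP.
Qed.

End Fibre.

(** * Curves in a fibre correspond to their graphs *)

Section Fibre.
Variables (R : realType) (r g : nat) (D : seq int) (p : 'rV[R]_r.+1).
Hypotheses (p_inj : injective (p ord0)) (D0 : 0 \notin D).

Section Graph.
Variables (a : ctype r) (C : curve R a) (aC : in_fibre g D p C).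
Let ct := fibre_ctype aC.
Local Notation F := (@ptriple R r p a C).

Lemma primary_rep (f : flag a) : {z : pflag a | val z = f \/ val z = fopp f}.
Proof.
have [pf|npf] := boolP (primary f); first by exists (exist _ f pf); left.
have nf : fdir f < 0.
  rewrite (fdirP p_inj D0 aC); apply: contra npf => pf; by rewrite /primary pf.
by exists (exist _ (fopp f) (primary_in nf)); right.
Qed.

Lemma touches_time (z : pflag a) (f : flag a) : val z = f \/ val z = fopp f ->
  touches (time p C (fvert f)) (F z).
Proof.
move=> zf; rewrite /touches (ptriple_in p_inj D0 aC) (ptriple_out p_inj D0 aC).
rewrite !(fdirP p_inj D0 aC); have pz := valP z; move: pz; rewrite /primary.
case: zf => ->; rewrite ?foppK eqxx /=.
  by case: (boolP (0 < fdir f)) => [|nf /= /eqP ->]; rewrite ?orbT // eqxx nf.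
case: (boolP (0 < fdir f)) => //= pf.
have [/eqP ->|ne] := boolP (fopp f == f); first by rewrite !eqxx pf.
by rewrite (fdir_opp ne) oppr_gt0 ltNge (ltW pf) /= eq_sym (negPf ne).
Qed.

Lemma ptriple_conn (Q : pred edge) :
  (forall k e e', (k < r.+1)%N -> e \in codom F -> e' \in codom F ->
     touches k e -> touches k e' -> Q e = Q e') ->
  forall e e', e \in codom F -> e' \in codom F -> Q e = Q e'.
Proof.
move=> Qc.
(* The colour passes to the vertices: all edges at [v] have colour [b], and this spreads along
   adjacency. *)
pose QV v b := forall (z : pflag a) f, val z = f \/ val z = fopp f -> fvert f = v -> Q (F z) = b.
have QV_of z f : val z = f \/ val z = fopp f -> QV (fvert f) (Q (F z)).
  move=> zf z' f' z'f' E; apply: (Qc (time p C (fvert f))); rewrite ?codom_f //.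
  - exact: (time_ltr aC).
  - by rewrite -E; apply: touches_time.
  - exact: touches_time.
have step v w b : adj (a := a) predT v w -> QV v b -> QV w b.
  case/existsP=> f /and3P[_ /eqP fv /eqP fw] Qv.
  have [z zf] := primary_rep f; rewrite -(Qv z f) //.
  rewrite -fw; apply: QV_of; rewrite foppK; case: zf; by [right | left].
have conn v w b : connect (adj (a := a) predT) v w -> QV v b -> QV w b.
  case/connectP=> q + ->; elim: q v => //= x q IHq v /andP[vx xq] Qv.
  by apply: IHq xq _; apply: step vx Qv.
move=> _ _ /codomP[z ->] /codomP[z' ->].
apply: (conn _ _ _ (ctype_connected ct (fvert (val z')) (fvert (val z)))) => //.
- by apply: QV_of; left.
- by left.
Qed.

Lemma ptriple_ends (P : pred int) (q : pred edge) :
  (forall z : pflag a, q (F z) = (fopp (val z) == val z) && P (fdir (val z))) ->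
  perm_eq [seq ew e | e <- codom F & q e] [seq `|z|%N | z <- D & P z].
Proof.
move=> qP; rewrite filter_codom.
have -> : [seq ew (F z) | z <- enum [set z | q (F z)]] =
    [seq `|fdir f|%N | f <- [seq val z | z <- enum [set z | q (F z)]]].
  by rewrite -map_comp; apply: eq_map => z; apply: ewE.
rewrite perm_sym; have /(perm_filter P)/(perm_map absz) := ctype_degree ct.
rewrite perm_sym => /perm_trans; apply; rewrite filter_map -map_comp.
have -> : [seq (absz \o (fun i : 'I_(nend a) => edir i)) i | i <- enum 'I_(nend a) & preim (fun i : 'I_(nend a) => edir i) P i] =
    [seq `|fdir f|%N | f <- [seq inr i : flag a | i <- enum 'I_(nend a) & P (edir i)]].
  by rewrite -map_comp.
apply: perm_map; apply: uniq_perm.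
- by rewrite map_inj_uniq => [|i j []]; first exact/filter_uniq/enum_uniq.
- by rewrite map_inj_uniq ?enum_uniq //; apply: val_inj.
move=> f; apply/mapP/mapP => [[i]|[z]].
  rewrite mem_filter => /andP[Pi _] ->.
  have pi : primary (inr i : flag a) by rewrite /primary /= eqxx orbT.
  by exists (exist (fun f => primary f) _ pi); rewrite // mem_enum inE qP /= eqxx.
rewrite mem_enum inE qP => /andP[/eqP ez Pz] ->.
case: z ez Pz => [[[e b]|i] pz] /=; first by case: b {pz} => -[].
by move=> _ Pi; exists i; rewrite // mem_filter Pi mem_enum.
Qed.

Lemma ptriple_mgraph : mgraph r.+1 (neg_parts D) (pos_parts D) (codom F).
Proof.
split.
- by move=> e /codomP[z ->]; apply: (ptriple_range p_inj D0 aC).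
- move=> k /(time_surj p_inj aC)[v <-]; rewrite !count_codom.
  exact: (ptriple_triv p_inj D0 aC).
- move=> k /(time_surj p_inj aC)[v <-]; rewrite !sum_codom.
  exact: (ptriple_bal p_inj D0 aC).
- exact: ptriple_conn.
- apply: ptriple_ends => z; rewrite /ptriple /ftriple; case: ifP => //= _.
  by case: ifP.
apply: ptriple_ends => z; rewrite /ptriple /ftriple; case: ifP => //= _.
  rewrite (fdirP p_inj D0 aC); case: (0 < fdir _); rewrite /et //= ?eqxx //.
  by apply/eqP=> E; have := time_ltr aC (fvert (val z)); rewrite E ltnn.
by apply/eqP=> E; have := time_ltr aC (fvert (fopp (val z))); move: E; rewrite /et /= => ->; rewrite ltnn.
Qed.

(** Here [h] is a map of edges, given on their chosen flags; preserving the distinction between ends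
    and bounded edges is what allows the extension to opposite flags. *)
Lemma extend_flags (b : ctype r) (h : pflag a -> pflag b) :
  (forall z, (fopp (val (h z)) == val (h z)) = (fopp (val z) == val z)) ->
  exists phi : flag a -> flag b,
    (forall z, phi (val z) = val (h z)) /\ (forall f, phi (fopp f) = fopp (phi f)).
Proof.
move=> hend.
pose rep f := sval (primary_rep f).
pose phi f := if val (rep f) == f then val (h (rep f)) else fopp (val (h (rep f))).
have phi1 z : phi (val z) = val (h z).
  have [E|E] := svalP (primary_rep (val z)).
    by rewrite /phi /rep E eqxx; congr (val (h _)); apply: val_inj.
  have Ez : val (rep (val z)) = val z.
    rewrite /rep E; apply/eqP; apply: contraT => ne.
    have := valP (rep (val z)); have := valP z; rewrite /primary /rep E foppK (negPf ne).
    rewrite orbF eq_sym (negPf ne) orbF (fdir_opp ne) oppr_gt0 => p1 p2.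
    by have := lt_trans p1 p2; rewrite ltxx.
  by rewrite /phi Ez eqxx; congr (val (h _)); apply: val_inj.
have phi2 (z : pflag a) : phi (fopp (val z)) = fopp (phi (val z)).
  rewrite phi1; have [ez|nz] := boolP (fopp (val z) == val z).
    by rewrite (eqP ez) phi1; apply/esym/eqP; rewrite hend.
  have Ez : rep (fopp (val z)) = z.
    apply: val_inj; rewrite /rep; have [E|->] := svalP (primary_rep (fopp (val z))); last exact: foppK.
    have := valP (rep (fopp (val z))); have := valP z; rewrite /primary /rep E foppK (negPf nz).
    rewrite orbF eq_sym (negPf nz) orbF (fdir_opp nz) oppr_gt0 => p1 p2.
    by have := lt_trans p1 p2; rewrite ltxx.
  by rewrite /phi Ez eq_sym (negPf nz).
exists phi; split=> // f; have [z [zf|zf]] := primary_rep f.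
  by rewrite -zf.
by rewrite -[f in RHS]foppK -zf phi2 foppK.
Qed.

Lemma flen_end (f : flag a) : fopp f == f -> flen C f = +oo%E.
Proof. by case: f => [[e b]|i] //= /eqP[]; case: b. Qed.

(** A nonzero direction makes the length a function of the heights, so no continuous parameter is
    left in the fibre. *)
Lemma flenE (f : flag a) : fopp f != f ->
  flen C f = ((hv C (fvert (fopp f)) - hv C (fvert f)) / (fdir f)%:~R)%:E.
Proof.
have nz := fdir_neq0 p_inj D0 aC f; case: f nz => [[e b]|i] nz ne; last by rewrite eqxx in ne.
by rewrite (affine_flag aC) mulrC mulrA mulVf ?mul1r ?intr_eq0.
Qed.

End Graph.

Section Iso.
Variables (a : ctype r) (C : curve R a) (aC : in_fibre g D p C).
Variables (b : ctype r) (C' : curve R b) (bC : in_fibre g D p C').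

Lemma iso_perm : iso_curve C C' ->
  perm_eq (codom (@ptriple R r p a C)) (codom (@ptriple R r p b C')).
Proof.
case=> phiV [phiF [[bV [psiF FK KF]] [[h1 h2 h3] [h4 h5 h6]]]].
have tE v : time p C' (phiV v) = time p C v.
  by apply: eq_card => j; rewrite !inE h6.
have oE f : (fopp (phiF f) == phiF f) = (fopp f == f).
  by rewrite h2 (inj_eq (can_inj FK)).
have pE f : primary (phiF f) = primary f by rewrite /primary h4 oE.
have pE' f : primary (psiF f) = primary f by rewrite -pE KF.
apply/perm_codomP.
exists (fun z => exist (fun f => primary f) (phiF (val z)) (etrans (pE (val z)) (valP z))).
  exists (fun z => exist (fun f => primary f) (psiF (val z)) (etrans (pE' (val z)) (valP z))).
    by move=> z; apply: val_inj => /=.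
  by move=> z; apply: val_inj => /=.
by move=> z; rewrite /ptriple /ftriple /= oE !h1 h2 !h1 !tE !h4.
Qed.

(** Vertices have times at most [r], so a first entry 0 or a second entry r+1 can only come from an
    end, and tells the sign of its direction. *)
Lemma ptriple_decode (z : pflag a) (z' : pflag b) : ptriple p C' z' = ptriple p C z ->
  [/\ (fopp (val z') == val z') = (fopp (val z) == val z), fdir (val z') = fdir (val z),
      time p C' (fvert (val z')) = time p C (fvert (val z)) &
      time p C' (fvert (fopp (val z'))) = time p C (fvert (fopp (val z)))].
Proof.
rewrite /ptriple /ftriple; have := valP z; have := valP z'; rewrite /primary.
have := fdir_neq0 p_inj D0 aC (val z); have := fdir_neq0 p_inj D0 bC (val z').
have lt v := time_ltr aC v; have lt' v := time_ltr bC v.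
move: (val z) (val z') => f f' nf' nf.
have [/eqP ef|ef] := boolP (fopp f == f); have [/eqP ef'|ef'] := boolP (fopp f' == f').
- move=> _ _; rewrite ef ef'; case: ltgtP nf => // sf _; case: ltgtP nf' => // sf' _ [] // *;
    by split=> //; lia.
- rewrite orbF => pf' _; case: ifP => // _ [_ E _].
  by have := lt' (fvert (fopp f')); rewrite E ltnn.
- rewrite orbF => _ pf; case: ifP => // _ [_ E _].
  by have := lt (fvert (fopp f)); rewrite -E ltnn.
by rewrite !orbF => pf' pf [-> -> E]; split=> //; lia.
Qed.

End Iso.

Section PermIso.
Variables (a : ctype r) (C : curve R a) (aC : in_fibre g D p C).
Variables (b : ctype r) (C' : curve R b) (bC : in_fibre g D p C').

Lemma perm_iso :
  perm_eq (codom (@ptriple R r p a C)) (codom (@ptriple R r p b C')) -> iso_curve C C'.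
Proof.
case/perm_codomP=> h [h' hK h'K] hE.
have [vW vWP] : exists vW, forall v, time p C' (vW v) = time p C v.
  by apply: (@fin_all_exists _ _ (fun v w => time p C' w = time p C v)) => v;
    apply: (time_surj p_inj bC); apply: (time_ltr aC).
have [wV wVP] : exists wV, forall w, time p C (wV w) = time p C' w.
  by apply: (@fin_all_exists _ _ (fun w v => time p C v = time p C' w)) => w;
    apply: (time_surj p_inj aC); apply: (time_ltr bC).
have h'E z : ptriple p C (h' z) = ptriple p C' z by rewrite -hE h'K.
have tI := time_inj p_inj aC; have tI' := time_inj p_inj bC.
have hdec z := ptriple_decode aC bC (hE z).
have [phi [phi1 phi2]] := extend_flags aC (h := h) (fun z => let: And4 E _ _ _ := hdec z in E).
have h'dec z := ptriple_decode bC aC (h'E z).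
have [psi [psi1 psi2]] := extend_flags bC (h := h') (fun z => let: And4 E _ _ _ := h'dec z in E).
have repP f : exists z : pflag a, f = val z \/ f = fopp (val z).
  by have [z [E|E]] := primary_rep aC f; exists z; rewrite E ?foppK; [left|right].
have phiK : cancel phi psi.
  by move=> f; have [z [->|->]] := repP f; rewrite ?phi2 ?psi2 phi1 psi1 hK.
have psiK : cancel psi phi.
  move=> f; have [z zf] := primary_rep bC f.
  have [->|->] : f = val z \/ f = fopp (val z) by case: zf => ->; rewrite ?foppK; [left|right].
    by rewrite psi1 phi1 h'K.
  by rewrite psi2 phi2 psi1 phi1 h'K.
have labE i : lab b i = vW (lab a i).
  apply: tI'; rewrite vWP; apply: eq_card => j.
  by rewrite !inE (hv_lab aC) (hv_lab bC).
have hvE v : hv C' (vW v) = hv C v.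
  by have [i <-] := lab_surj aC v; rewrite -labE (hv_lab aC) (hv_lab bC).
have oE f : (fopp (phi f) == phi f) = (fopp f == f).
  by rewrite -phi2 (inj_eq (can_inj phiK)).
have vE f : fvert (phi f) = vW (fvert f).
  apply: tI'; rewrite vWP; have [z [->|->]] := repP f; rewrite ?phi2 phi1;
    by have [] := hdec z.
have dE f : fdir (phi f) = fdir f.
  have [z [->|->]] := repP f; first by rewrite phi1; have [] := hdec z.
  rewrite phi2 phi1; have [E1 E2 _ _] := hdec z.
  have [ez|nz] := boolP (fopp (val z) == val z).
    by rewrite (eqP ez) -E2; rewrite ez in E1; rewrite (eqP E1).
  by rewrite !fdir_opp ?E1 ?E2.
exists vW, phi; split; first split.
- exists wV => v; [apply: tI | apply: tI']; by rewrite ?wVP ?vWP ?wVP.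
- by exists psi.
split; split=> // f.
have [ef|nf] := boolP (fopp f == f); first by rewrite !flen_end ?oE.
by rewrite (flenE bC) ?oE // (flenE aC) // -phi2 !vE !hvE dE.
Qed.

End PermIso.
End Fibre.

(** * The multiplicity of a curve *)

Section Chains.
Variables (r : nat) (a : ctype r).
Hypothesis conn : forall v w, connect (adj (a := a) predT) v w.

Lemma bdry_delta e : bdry a *m delta_mx e 0 = delta_mx (tgt e) 0 - delta_mx (src e) 0 :> 'cV_(nvert a).
Proof.
apply/colP=> v; rewrite -colE !mxE !andbT.
by rewrite eq_sym [src e == v]eq_sym.
Qed.

Lemma chain_exists v w :
  exists c : 'cV[int]_(nbedge a), bdry a *m c = delta_mx w 0 - delta_mx v 0.
Proof.
have /connectP[q qP ->] := conn v w; elim: q v qP => [|x q IHq] v /=.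
  by move=> _; exists 0; rewrite mulmx0 subrr.
case/andP=> /existsP[f /and3P[_ /eqP fv /eqP fx]] /IHq[c cE].
have [c' c'E] : exists c' : 'cV[int]_(nbedge a), bdry a *m c' = delta_mx x 0 - delta_mx v 0.
  case: f fv fx => [[e b]|i] /= <- <-; last by exists 0; rewrite mulmx0 subrr.
  case: b; last by exists (delta_mx e 0); rewrite bdry_delta.
  by exists (- delta_mx e 0); rewrite mulmxN bdry_delta opprB.
by exists (c + c'); rewrite mulmxDr cE c'E addrA subrK.
Qed.

Lemma chain_toP v : bdry a *m chain_to v = delta_mx v 0 - delta_mx (lab a ord0) 0.
Proof.
rewrite /chain_to; case: xgetP => [c -> //|no].
by have [c cE] := chain_exists (lab a ord0) v; case: (no c).
Qed.

(** The rank is not full because the rows sum to zero. Conversely, chains from a base vertex to all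
    vertices write the identity as a matrix that factors through the boundary map plus one of rank
    at most 1. *)
Lemma rank_bdry : (\rank (map_mx intr (bdry a) : 'M[rat]_(nvert a, nbedge a))).+1 = nvert a.
Proof.
set B := map_mx _ _; set v0 := lab a ord0; pose V := nvert a.
have [c cP] : exists c : 'I_V -> 'cV[int]_(nbedge a), forall v, bdry a *m c v = delta_mx v 0 - delta_mx v0 0.
  by apply: (@fin_all_exists _ _ (fun v c => bdry a *m c = delta_mx v 0 - delta_mx v0 0)) => v;
    apply: chain_exists.
pose K : 'M[rat]_V := B *m \matrix_(e, v) (c v e 0)%:~R.
pose X : 'M[rat]_V := delta_mx v0 0 *m (const_mx 1 : 'rV_V).
have KX : 1%:M = K + X.
  apply/matrixP=> v w; have /colP/(_ v) := cP w; rewrite !mxE big_ord1 !mxE !andbT mulr1.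
  move/(congr1 (fun z : int => z%:~R : rat)); rewrite rmorph_sum rmorphB /= => E.
  rewrite (eq_bigr (fun e => (bdry a v e * c w e 0)%:~R)) => [|e _]; last by rewrite !mxE rmorphM.
  by rewrite E /= !rmorph_nat subrK.
apply/eqP; rewrite eqn_leq; apply/andP; split; last first.
  have : (V <= \rank K + \rank X)%N by rewrite -{1}(mxrank1 rat V) KX mxrank_add.
  have rX : (\rank X <= 1)%N by apply: leq_trans (mxrankM_maxl _ _) (rank_leq_col _).
  have rK : (\rank K <= \rank B)%N by apply: mxrankM_maxl.
  by move=> le; rewrite -addn1; apply: leq_trans le (leq_add rK rX).
have ker : (const_mx 1 : 'rV[rat]_V) *m B = 0.
  apply/rowP=> e; rewrite !mxE (eq_bigr (fun v => (tgt e == v)%:R - (src e == v)%:R)) => [|v _]; last first.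
    by rewrite !mxE mul1r rmorphB /= !rmorph_nat.
  rewrite sumrB (bigD1 (tgt e)) // [X in _ - X](bigD1 (src e)) //= !eqxx.
  by rewrite !big1 ?addr0 ?subrr // => v; rewrite eq_sym => /negPf ->.
have := mxrank_ker B; have : (0 < \rank (kermx B))%N.
  have /mxrankS : ((const_mx 1%R : 'rV[rat]_V) <= kermx B)%MS by apply/sub_kermxP.
  apply: leq_trans; rewrite lt0n mxrank_eq0; apply/eqP=> /rowP/(_ v0).
  by rewrite !mxE => /eqP; rewrite oner_eq0.
by move=> lt E; rewrite E subn_gt0 in lt.
Qed.

Lemma h1E : (h1 a + nvert a = (nbedge a).+1)%N.
Proof.
rewrite /h1 mxrank_ker -map_trmx mxrank_tr.
move: rank_bdry (rank_leq_col (map_mx intr (bdry a) : 'M[rat]_(nvert a, nbedge a))).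
by move: (\rank _) => q <- le; rewrite addnS subnK.
Qed.

Lemma cycle_basisP : is_lattice_basis (lattice_ker (bdry a)) (cycle_basis a).
Proof.
apply: lattice_ker_basis; rewrite /h1 mxrank_ker -map_trmx mxrank_tr subnKC //.
exact: rank_leq_col.
Qed.

End Chains.

Section Multiplicity.
Variables (r : nat) (a : ctype r).
Hypotheses (conn : forall v w, connect (adj (a := a) predT) v w)
  (lab_surj : forall v, exists i, lab a i = v) (nvertE : nvert a = r.+1)
  (dir0 : forall e : 'I_(nbedge a), dir e != 0).

(** The loop and branch matrices without the weights; [Dg] puts the weights back, with a 1 for the
    coordinate h(V_1). *)
Let A0 : 'M[int]_(h1 a, 1 + nbedge a) := row_mx 0 (cycle_basis a)^T.
Let C0 : 'M[int]_(r.+1, 1 + nbedge a) :=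
  \matrix_i row_mx (1%:M : 'M_1) (chain_to (lab a i))^T.
Let Dg : 'M[int]_(1 + nbedge a) := block_mx 1%:M 0 0 (dir_mx a).

Lemma loop_mxE : loop_mx a = A0 *m Dg.
Proof. by rewrite mul_row_block !mulmx0 mul0mx !add0r. Qed.

Lemma br_mxE : br_mx a = C0 *m Dg.
Proof.
apply/row_matrixP=> i; rewrite row_mul !rowK mul_row_block !mulmx0 mulmx1.
by rewrite addr0 add0r.
Qed.

Lemma det_Dg : \det Dg = \prod_(e < nbedge a) dir e.
Proof.
rewrite det_lblock det1 mul1r det_diag.
by apply: eq_bigr => e _; rewrite mxE.
Qed.

Lemma det_Dg_neq0 : \det Dg != 0.
Proof. by rewrite det_Dg; apply/prodf_neq0 => e _; apply: dir0. Qed.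

Lemma dimE : (1 + nbedge a = h1 a + r.+1)%N.
Proof. by rewrite -nvertE h1E. Qed.

(* Together with the cycles, the chains from V_1 to all vertices generate the
   lattice: an edge e is (chain to tgt e) - (chain to src e) + (a cycle). *)
Lemma stack_surj j : exists u : 'rV_(h1 a + r.+1), u *m col_mx A0 C0 = delta_mx 0 j.
Proof.
pose span (x : 'rV[int]_(1 + nbedge a)) := exists u : 'rV_(h1 a + r.+1), u *m col_mx A0 C0 = x.
have spanB x y : span x -> span y -> span (x - y).
  by case=> u <- [v <-]; exists (u - v); rewrite mulmxBl.
have spanD x y : span x -> span y -> span (x + y).
  by case=> u <- [v <-]; exists (u + v); rewrite mulmxDl.
have span_cycle z : bdry a *m z = 0 -> span (row_mx 0 z^T).
  case: (cycle_basisP a) => _ cb /cb[c ->]; exists (row_mx c^T 0).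
  by rewrite mul_row_col mul0mx addr0 mul_mx_row mulmx0 trmx_mul.
have span_chain v : span (row_mx 1%:M (chain_to v)^T).
  have [i <-] := lab_surj v; exists (row_mx 0 (delta_mx 0 i)).
  by rewrite mul_row_col mul0mx add0r -rowE rowK.
rewrite -/(span _); rewrite -[j]splitK; case: (split j) => /= [k|e].
  have -> : delta_mx 0 (lshift _ k) = row_mx 1%:M (chain_to (lab a ord0))^T -
      row_mx 0 (chain_to (lab a ord0))^T :> 'rV[int]_(1 + nbedge a).
    rewrite opp_row_mx add_row_mx subrr subr0 delta_mx_lshift; congr row_mx.
    by apply/rowP=> i; rewrite !mxE (ord1 i) (ord1 k).
  by apply: spanB (span_chain _) (span_cycle _ _); rewrite chain_toP // subrr.
pose z : 'cV[int]_(nbedge a) := delta_mx e 0 - chain_to (tgt e) + chain_to (src e).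
have -> : delta_mx 0 (rshift 1 e) = row_mx 1%:M (chain_to (tgt e))^T -
    row_mx 1%:M (chain_to (src e))^T + row_mx 0 z^T :> 'rV[int]_(1 + nbedge a).
  rewrite opp_row_mx !add_row_mx subrr add0r /z !linearD linearN /=.
  set c := (chain_to (tgt e))^T; set c' := (chain_to (src e))^T.
  have -> : c - c' + ((delta_mx e 0)^T - c + c') = delta_mx 0 e.
    rewrite trmx_delta (_ : _ - c + c' = delta_mx 0 e - (c - c')).
      by rewrite addrC subrK.
    by rewrite opprB addrA addrAC.
  by rewrite delta_mx_rshift.
apply: spanD (spanB _ _ (span_chain _) (span_chain _)) (span_cycle _ _).
rewrite mulmxDr mulmxBr bdry_delta !chain_toP // opprB.
have tele (V : zmodType) (x y w : V) : x - y + (w - x) + (y - w) = 0.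
  by rewrite (addrC (x - y)) (addrA (w - x)) subrK addrA subrK subrr.
exact: tele.
Qed.

Lemma rank_loop_mx : \rank (map_mx intr (loop_mx a) : 'M[rat]_(_, _)) = h1 a.
Proof. rewrite loop_mxE; exact: rank_unimodular_stack dimE stack_surj det_Dg_neq0. Qed.

Lemma cell_dimE : cell_dim a = r.+1.
Proof. by rewrite /cell_dim rank_loop_mx dimE addKn. Qed.

Lemma regularE : regular a.
Proof. by rewrite /regular cell_dimE dimE addKn. Qed.

Lemma index_detE : (image_index (loop_mx a))%:Z * `|br_det a| = (\prod_(e < nbedge a) `|dir e|)%N%:Z.
Proof.
have basis : is_lattice_basis (lattice_ker (loop_mx a)) (lattice_basis r.+1 (lattice_ker (loop_mx a))).
  by apply: lattice_ker_basis; rewrite rank_loop_mx dimE.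
rewrite /br_det br_mxE; rewrite loop_mxE in basis *.
rewrite (image_index_det dimE stack_surj det_Dg_neq0 basis) det_Dg.
by rewrite -abszE (big_morph absz abszM (erefl : `|1%R|%N = 1%N)).
Qed.

Lemma mult_brE : mult_br a = (\prod_(e < nbedge a) `|dir e|)%N%:R /
  (2 ^ (#|[set v | twin_vertex (a := a) v]| + #|[set q | twin_edges (a := a) q]|))%N%:R.
Proof.
pose d : rat := `|br_det a|%:~R; pose i : rat := (image_index (loop_mx a))%:R.
rewrite /mult_br /weight -/d -/i.
have E : i * d = (\prod_(e < nbedge a) `|dir e|)%N%:R.
  by rewrite /i /d !pmulrn -rmorphM index_detE.
by rewrite mulrAC [i * _ * d]mulrAC E -mulrA -exprD exprVn natrX.
Qed.

End Multiplicity.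

(** * The factors 1/2 and the automorphisms of the graph *)

Section Twins.
Variables (R : realType) (r g : nat) (D : seq int) (p : 'rV[R]_r.+1).
Hypotheses (p_inj : injective (p ord0)) (D0 : 0 \notin D).
Variables (a : ctype r) (C : curve R a) (aC : in_fibre g D p C).
Local Notation F := (@ptriple R r p a C).

(** Follows the order of the bounded edges used in [twin_edges], so that each pair listed there has
    its first edge in [lower]; the ends come after. *)
Definition edge_rank (z : pflag a) : nat :=
  match val z with inl (e, _) => e | inr i => nbedge a + i end.

Lemma edge_rank_inj : injective edge_rank.
Proof.
move=> [f pf] [f' pf']; rewrite /edge_rank /= => E; apply: val_inj => /=.
have side e b : primary (inl (e, b) : flag a) -> b = (dir e < 0).
  have := dir_neq0 p_inj D0 aC e; rewrite /primary /fopp.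
  rewrite (_ : (inl (e, ~~ b) == inl (e, b) :> flag a) = false) ?orbF; last first.
    by apply/eqP=> -[]; case: b.
  by case: b => /=; rewrite ?oppr_gt0; case: ltgtP.
case: f pf E => [[e b]|i]; case: f' pf' => [[e' b']|i'] pf' pf.
- by move=> /val_inj E; subst e'; rewrite (side e b) // (side e b').
- by have := ltn_ord e; lia.
- by have := ltn_ord e'; lia.
by move/addnI/val_inj => ->.
Qed.

Lemma no_loop e : src (c := a) e != tgt e.
Proof.
apply/eqP=> E; have [aff _] := fibre_cell aC; have := aff e.
rewrite E subrr => /esym/eqP; rewrite mulf_eq0 intr_eq0 (negPf (dir_neq0 p_inj D0 aC e)).
by rewrite gt_eqF // (len_gt0 aC).
Qed.

Lemma same_ptriple (z z' : pflag a) : (F z == F z') =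
  [&& (fopp (val z) == val z) == (fopp (val z') == val z'),
      fdir (val z) == fdir (val z'), fvert (val z) == fvert (val z') &
      fvert (fopp (val z)) == fvert (fopp (val z'))].
Proof.
apply/eqP/and4P => [E|[/eqP h1 /eqP h2 /eqP h3 /eqP h4]].
  have [h1 h2 h3 h4] := ptriple_decode p_inj D0 aC aC E.
  by rewrite h1 h2 (time_inj p_inj aC h3) (time_inj p_inj aC h4) !eqxx.
by rewrite /ptriple /ftriple h1 h2 h3 h4.
Qed.

Lemma component_end v k : evert k = v -> component (a := a) v (inr k) = [set inr k].
Proof.
move=> kv; apply/setP=> x; rewrite !inE; apply/connectP/eqP => [[q]|->]; last by exists [::].
elim: q => [_ ->//|y q IHq] /= /andP[+ yq] xE; rewrite /linked /= kv eqxx andbF orbF => /eqP yk.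
by rewrite yk in yq xE; apply: IHq.
Qed.

Lemma linked_sym v : connect_sym (linked (a := a) v).
Proof.
apply: sym_connect_sym => f f'; rewrite /linked; congr (_ || _).
  by apply/eqP/eqP => ->; rewrite foppK.
by rewrite eq_sym; case: eqP => // ->.
Qed.

(** Every vertex carries a label, and corresponding vertices of two components of the same type
    carry the same labels, hence coincide. So twin components contain no vertex, and each is a
    single end. *)
Lemma twin_vertexP v : twin_vertex (a := a) v <->
  exists i j : 'I_(nend a), [/\ i != j, edir i = edir j, evert i = v & evert j = v].
Proof.
split=> [/existsP[f /existsP[f' /andP[ne /existsP[phi /and3P[_ /eqP KL /forall_inP h]]]]]|].
  have memK x : (x \in component v f) = connect (linked v) f x by rewrite inE.
  have allv x : x \in component v f -> fvert x = v.
    move=> xK; apply/eqP; apply: contraT => xv.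
    have /and5P[_ _ _ _ /implyP/(_ xv)/forallP hl] := h x xK.
    have [i ix] := lab_surj aC (fvert x).
    have /eqP := hl i; rewrite ix eqxx => /eqP px.
    have link : linked v x (phi x) by rewrite /linked -px eqxx xv orbT.
    case/negP: ne; apply/eqP/setP=> y; rewrite !inE.
    have fx : connect (linked v) f (phi x).
      by apply: connect_trans (connect1 link); rewrite -memK.
    have f'x : connect (linked v) f' (phi x).
      have : phi x \in component v f' by rewrite -KL imset_f.
      by rewrite inE.
    have ff' : connect (linked v) f f'.
      by apply: connect_trans fx _; rewrite linked_sym.
    by rewrite (same_connect (@linked_sym v) ff').
  have fK : f \in component v f by rewrite memK connect0.
  have oK : fopp f \in component v f by rewrite memK connect1 // /linked eqxx.
  have fv := allv _ fK; have ov := allv _ oK.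
  (* A bounded edge with both flags at [v] would be a loop. *)
  case: f ne KL h memK allv fK oK fv ov => [[e b]|i] ne KL h memK allv fK oK fv ov.
    by case/negP: (no_loop e); case: b fv ov {ne KL h memK allv fK oK} => /= -> ->.
  have /and5P[/eqP h1 /eqP h2 /eqP h3 _ _] := h _ fK.
  case E: (phi (inr i)) h1 h2 h3 => [[e b]|j] /= h1 h2 h3.
    by case: h1; case: b {E h2 h3}.
  exists i, j; split=> //; last by apply/eqP; rewrite h3; apply/eqP.
  apply/eqP=> ij; case/negP: ne; rewrite -KL component_end // imset_set1 E ij.
  by rewrite eqxx.
case=> i [j [nij dij iv jv]].
apply/existsP; exists (inr i); apply/existsP; exists (inr j).
rewrite !component_end //; apply/andP; split.
  by rewrite (inj_eq set1_inj); apply: contraNneq nij => -[->].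
apply/existsP; exists [ffun=> inr j]; apply/and3P; split.
- by apply/dinjectiveP => x y /set1P -> /set1P ->.
- by rewrite imset_set1 ffunE.
apply/forall_inP=> x /set1P ->; rewrite !ffunE /= eqxx dij iv jv !eqxx /= andbT.
by apply/forall_inP=> x' /set1P ->; rewrite ffunE /= iv jv !eqxx.
Qed.

Lemma ptriple_fibre2 (z z' z'' : pflag a) :
  F z = F z' -> F z' = F z'' -> [|| z == z', z' == z'' | z'' == z].
Proof. exact: mgraph_fibre2 (isT : (0 < r.+1)%N) (ptriple_mgraph p_inj D0 aC) _ _ _. Qed.

Lemma primary_dir e : primary (inl (e, dir e < 0) : flag a).
Proof.
rewrite /primary /=; have := dir_neq0 p_inj D0 aC e.
by case: (ltgtP (dir e) 0) => [lt|gt|->]; rewrite ?eqxx ?oppr_gt0 ?lt ?gt.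
Qed.

Definition edge_flag e : pflag a := exist (fun f => primary f) _ (primary_dir e).

Lemma edge_flag_ends e : [set src e; tgt e] =
  [set fvert (val (edge_flag e)); fvert (fopp (val (edge_flag e)))].
Proof. by rewrite /=; case: (dir e < 0) => //=; rewrite setUC. Qed.

Lemma edge_flag_lt e :
  hv C (fvert (val (edge_flag e))) < hv C (fvert (fopp (val (edge_flag e)))).
Proof.
apply: (hv_lt aC); first by apply/eqP=> -[]; case: (_ < _).
by have := primary_dir e; rewrite /primary /= => /orP[//|/eqP[]]; case: (_ < _).
Qed.

Lemma edge_flag_dir e : fdir (val (edge_flag e)) = `|dir e|%N.
Proof. by rewrite /=; case: (ltP (dir e) 0) => h; [rewrite ltz0_abs | rewrite gez0_abs]. Qed.

Lemma edge_flagE (z : pflag a) e b : val z = inl (e, b) -> z = edge_flag e.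
Proof.
move=> zE; apply: edge_rank_inj; rewrite /edge_rank zE /=.
by case: (dir e < 0).
Qed.

Lemma edge_flag_bounded e : fopp (val (edge_flag e)) != val (edge_flag e).
Proof. by apply/eqP=> -[]; case: (_ < _). Qed.

Lemma set2_ordered (f f' h h' : 'I_(nvert a)) : hv C f < hv C f' -> hv C h < hv C h' ->
  [set f; f'] = [set h; h'] -> f = h /\ f' = h'.
Proof.
move=> ff' hh' E.
have : f \in [set h; h'] by rewrite -E !inE eqxx.
have : f' \in [set h; h'] by rewrite -E !inE eqxx orbT.
have : h' \in [set f; f'] by rewrite E !inE eqxx orbT.
rewrite !inE => /orP[]/eqP h'E /orP[]/eqP f'E /orP[]/eqP fE; subst; try by [].
all: try by rewrite ltxx in ff' *.
all: try by rewrite ltxx in hh' *.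
all: by have := lt_trans ff' hh'; rewrite ltxx.
Qed.

Lemma twin_edgesE e e' : twin_edges (a := a) (e, e') =
  (e < e')%N && (F (edge_flag e) == F (edge_flag e')).
Proof.
rewrite /twin_edges /= no_loop /=; congr (_ && _).
rewrite same_ptriple !edge_flag_dir (negPf (edge_flag_bounded e)) (negPf (edge_flag_bounded e')).
rewrite !edge_flag_ends eqxx andTb andbC; congr (_ && _).
apply/eqP/andP => [|[/eqP -> /eqP ->] //].
by move/(set2_ordered (edge_flag_lt e) (edge_flag_lt e')) => [-> ->].
Qed.

Lemma lowerP z : reflect (exists2 z', F z = F z' & (edge_rank z < edge_rank z')%N)
  (z \in lower F edge_rank).
Proof.
rewrite inE; apply: (iffP existsP) => [[z' /andP[/eqP E lt]]|[z' E lt]]; exists z' => //.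
by rewrite E eqxx.
Qed.

Lemma same_end (z z' : pflag a) : F z = F z' ->
  (fopp (val z) == val z) = (fopp (val z') == val z').
Proof. by move/eqP; rewrite same_ptriple => /and4P[/eqP ->]. Qed.

Lemma card_lower_bounded :
  #|[set z in lower F edge_rank | fopp (val z) != val z]| =
  #|[set q | twin_edges (a := a) q]|.
Proof.
rewrite -[RHS](card_in_imset (f := fun q : 'I_(nbedge a) * 'I_(nbedge a) => edge_flag q.1)).
  apply: eq_card => z; rewrite inE; apply/andP/imsetP => [[/lowerP[z' E lt] nz]|[[e e'] + ->]].
    have nz' := nz; rewrite (same_end E) in nz'.
    case Ez: (val z) nz => [[e b]|i]; last by rewrite eqxx.
    case Ez': (val z') nz' => [[e' b']|i]; last by rewrite eqxx.
    move=> _ _; exists (e, e'); last by rewrite (edge_flagE Ez).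
    rewrite inE twin_edgesE -(edge_flagE Ez) -(edge_flagE Ez') E eqxx andbT.
    by move: lt; rewrite /edge_rank Ez Ez'.
  rewrite inE twin_edgesE /= => /andP[lt /eqP E]; split; last exact: edge_flag_bounded.
  by apply/lowerP; exists (edge_flag e').
move=> [e1 e1'] [e2 e2']; rewrite !inE !twin_edgesE /= => /andP[lt1 /eqP E1] /andP[lt2 /eqP E2].
move/(congr1 edge_rank)/val_inj => e12; subst e2; congr (_, _).
have := ptriple_fibre2 (esym E1) E2.
by case/or3P=> /eqP/(congr1 edge_rank)/val_inj E //; subst; rewrite ltnn in lt1 lt2 *.
Qed.

(** A vertex carries at most one pair of equal ends: two pairs with the same triple would exceed the
    bound on fibres, and two with different triples would put four flags on a 3-valent vertex. *)
Lemma card_lower_ends :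
  #|[set z in lower F edge_rank | fopp (val z) == val z]| =
  #|[set v | twin_vertex (a := a) v]|.
Proof.
rewrite -(card_in_imset (f := fun z : pflag a => fvert (val z))).
  apply: eq_card => v; rewrite [in RHS]inE; apply/imsetP/idP => [[z + ->]|].
    rewrite inE => /andP[/lowerP[z' E lt] ez]; apply/twin_vertexP.
    have ez' := ez; rewrite (same_end E) in ez'.
    move: E => /eqP; rewrite same_ptriple => /and4P[_ /eqP dE /eqP vE _].
    move: lt dE vE ez ez'; rewrite /edge_rank.
    case: (val z) => [[e b]|i]; first by move=> _ _ _ /eqP[]; case: b.
    case: (val z') => [[e b]|j]; first by move=> _ _ _ _ /eqP[]; case: b.
    rewrite ltn_add2l => lt /= dE vE _ _; exists i, j; split=> //.
    by apply: contraTneq lt => ->; rewrite ltnn.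
  case/twin_vertexP=> i [j [nij dij iv jv]].
  have pe k : primary (inr k : flag a) by rewrite /primary /= eqxx orbT.
  wlog ltij : i j nij dij iv jv / (i < j)%N.
    move=> W; have [lt|lt|E] := ltngtP i j; first exact: (W i j).
      by apply: (W j i); rewrite // eq_sym.
    by rewrite (val_inj E) eqxx in nij.
  exists (exist (fun f => primary f) _ (pe i)) => //; rewrite inE /= eqxx andbT.
  apply/lowerP; exists (exist (fun f => primary f) _ (pe j)); last first.
    by rewrite /edge_rank /= ltn_add2l.
  by apply/eqP; rewrite same_ptriple /= !eqxx dij iv jv !eqxx.
move=> z1 z2; rewrite !inE -!/(lower F edge_rank) => /andP[/existsP[z1' /andP[/eqP E1 lt1]] ez1].
case/andP=> /existsP[z2' /andP[/eqP E2 lt2]] ez2 v12.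
apply/eqP; apply: contraT => n12.
have n11 : z1 != z1' by apply: contraTneq lt1 => ->; rewrite ltnn.
have n22 : z2 != z2' by apply: contraTneq lt2 => ->; rewrite ltnn.
have samev (z z' : pflag a) : F z = F z' -> fvert (val z') = fvert (val z).
  by move/eqP; rewrite same_ptriple => /and4P[_ _ /eqP ->].
have nF : F z1 <> F z2.
  move=> E12; have := ptriple_fibre2 (esym E1) E12; have := ptriple_fibre2 (esym E2) (esym E12).
  rewrite (negPf n12) [z2 == z1]eq_sym (negPf n12) ![z1' == z1]eq_sym ![z2' == z2]eq_sym.
  rewrite (negPf n11) (negPf n22) /= => /eqP z12 /eqP z21.
  by rewrite -z21 in lt1; rewrite -z12 in lt2; have := ltn_trans lt1 lt2; rewrite ltnn.
have nz (z z' : pflag a) : F z <> F z' -> z != z' by move=> h; apply: contra_notN h => /eqP ->.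
have uniq4 : uniq [:: z1; z1'; z2; z2'].
  by rewrite /= !inE !negb_or n11 n22 !nz -?E1 -?E2.
have := valence3 p_inj D0 aC (fvert (val z1)); have := card_uniqP uniq4.
rewrite /valence -(card_imset _ val_inj) => c4 c3.
have : (#|[set val x | x : pflag a in [:: z1; z1'; z2; z2']]| <= 3)%N.
  rewrite -c3; apply/subset_leq_card/subsetP=> _ /imsetP[x + ->]; rewrite !inE.
  by case/or4P=> /eqP ->; rewrite ?v12 ?(samev _ _ E1) ?(samev _ _ E2) ?v12.
by rewrite c4.
Qed.

Lemma card_lower : #|lower F edge_rank| =
  (#|[set v | twin_vertex (a := a) v]| + #|[set q | twin_edges (a := a) q]|)%N.
Proof.
rewrite -card_lower_ends -card_lower_bounded.
rewrite -(cardsID [set z : pflag a | fopp (val z) == val z]); congr (_ + _)%N.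
  by apply: eq_card => z; rewrite !inE.
by apply: eq_card => z; rewrite !inE andbC.
Qed.

Lemma card_autg_ptriple : #|autg F| =
  (2 ^ (#|[set v | twin_vertex (a := a) v]| + #|[set q | twin_edges (a := a) q]|))%N.
Proof. by rewrite /autg (card_twin_aut edge_rank_inj ptriple_fibre2) card_lower. Qed.

End Twins.

(** * The curve of a monodromy graph *)

Lemma perm_enum_val (T : eqType) (I : finType) (A : {set I}) (F : I -> T) :
  perm_eq [seq F (enum_val i) | i <- enum 'I_#|A|] [seq F j | j <- enum A].
Proof.
rewrite (map_comp F enum_val); apply/perm_map/uniq_perm.
- by rewrite map_inj_uniq ?enum_uniq //; apply: enum_val_inj.
- exact: enum_uniq.
move=> j; rewrite mem_enum; apply/mapP/idP => [[i _ ->]|jA]; first exact: enum_valP.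
by exists (enum_rank_in jA j); rewrite ?mem_enum ?enum_rankK_in.
Qed.

Section Construct.
Variables (R : realType) (r g : nat) (D : seq int) (p : 'rV[R]_r.+1).
Hypotheses (p_inj : injective (p ord0)) (D0 : 0 \notin D)
  (hr : (size D + 2 * g - 2)%N = r.+1).
Variables (I : finType) (f : I -> edge).
Hypothesis G : mgraph r.+1 (neg_parts D) (pos_parts D) (codom f).

Definition bounded : {set I} := [set i | (0 < eb (f i)) && (et (f i) < r.+1)]%N.

(** The vertices of the graph are numbered from 0 by height, so the vertex carrying a label is the
    rank of its coordinate in [p]. *)
Definition rank_lab (i : 'I_r.+1) : 'I_r.+1 := inord #|[set j | p ord0 j < p ord0 i]|.

Definition ctype_of : ctype r := {|
  nvert := r.+1;
  nbedge := #|bounded|;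
  nend := #|~: bounded|;
  src := fun e => inord (eb (f (enum_val e))).-1;
  tgt := fun e => inord (et (f (enum_val e)));
  dir := fun e => ew (f (enum_val e));
  evert := fun i => if eb (f (enum_val i)) == 0 then inord (et (f (enum_val i)))
                    else inord (eb (f (enum_val i))).-1;
  edir := fun i => if eb (f (enum_val i)) == 0 then - (ew (f (enum_val i)))%:Z
                   else ew (f (enum_val i));
  lab := rank_lab |}.

Local Notation a := ctype_of.

(** The default 0 is never taken, as [rank_lab] is a bijection. *)
Definition hv_of (v : 'I_r.+1) : R := odflt 0 (omap (p ord0) [pick i | rank_lab i == v]).

Definition curve_of : curve R a := {|
  hv := hv_of : 'I_(nvert a) -> R;
  len := fun e => (hv_of (tgt (c := a) e) - hv_of (src (c := a) e)) / (dir (c := a) e)%:~R |}.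

Lemma rank_labE i : rank_lab i = #|[set j | p ord0 j < p ord0 i]| :> nat.
Proof.
rewrite inordK // -[X in (_ < X)%N]card_ord -cardsT.
by apply/proper_card/properP; split; [exact/subsetP | exists i; rewrite !inE ?ltxx].
Qed.

Lemma rank_lab_lt i j : (rank_lab i < rank_lab j)%N = (p ord0 i < p ord0 j).
Proof.
rewrite !rank_labE; have sub i' j' : p ord0 i' <= p ord0 j' ->
    (#|[set j | (p ord0 j < p ord0 i')%R]| <= #|[set j | (p ord0 j < p ord0 j')%R]|)%N.
  move=> le; apply/subset_leq_card/subsetP=> k; rewrite !inE => lt.
  exact: lt_le_trans lt le.
have [lt|le] := ltP (p ord0 i) (p ord0 j); last by rewrite ltnNge sub.
apply/proper_card/properP; split.
  by apply/subsetP=> k; rewrite !inE => ltk; apply: lt_trans ltk lt.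
by exists i; rewrite !inE ?ltxx.
Qed.

Lemma rank_lab_inj : injective rank_lab.
Proof.
move=> i j E; apply/p_inj/eqP; case: ltgtP => // lt.
  by have := rank_lab_lt i j; rewrite E ltnn lt.
by have := rank_lab_lt j i; rewrite E ltnn lt.
Qed.

Lemma rank_lab_surj v : exists i, rank_lab i = v.
Proof.
have [k _ kK] := injF_bij rank_lab_inj.
by exists (k v).
Qed.

Lemma hv_of_lab i : hv_of (rank_lab i) = p ord0 i.
Proof.
rewrite /hv_of; case: pickP => [j /eqP/rank_lab_inj -> //|/(_ i)].
by rewrite eqxx.
Qed.

Lemma hv_of_lt v w : (hv_of v < hv_of w) = (v < w)%N.
Proof.
have [i <-] := rank_lab_surj v; have [j <-] := rank_lab_surj w.
by rewrite !hv_of_lab rank_lab_lt.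
Qed.

Lemma time_of v : time p curve_of v = v :> nat.
Proof.
have [i <-] := rank_lab_surj v; rewrite rank_labE; apply: eq_card => j.
by rewrite !inE /= hv_of_lab.
Qed.

Lemma range i : [/\ eb (f i) <= et (f i), et (f i) <= r.+1 & 0 < ew (f i)]%N.
Proof. exact: f_range G i. Qed.

Lemma boundedP (e : 'I_(nbedge a)) :
  (0 < eb (f (enum_val e)) <= et (f (enum_val e)))%N /\ (et (f (enum_val e)) < r.+1)%N.
Proof.
have := enum_valP e; rewrite inE => /andP[-> ->].
by have [-> _ _] := range (enum_val e).
Qed.

Lemma srcE e : src (c := a) e = (eb (f (enum_val e))).-1 :> nat.
Proof.
by rewrite /= inordK //; have [/andP[h1 h2] h3] := boundedP e; rewrite prednK // ltnW // (leq_ltn_trans h2).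
Qed.

Lemma tgtE e : tgt (c := a) e = et (f (enum_val e)) :> nat.
Proof. by rewrite /= inordK //; have [_] := boundedP e. Qed.

Lemma endP (i : 'I_(nend a)) :
  (eb (f (enum_val i)) = 0 /\ (et (f (enum_val i)) < r.+1)%N) \/
  ((0 < eb (f (enum_val i)))%N /\ et (f (enum_val i)) = r.+1).
Proof.
have := enum_valP i; rewrite !inE negb_and -leqNgt leqn0 -leqNgt.
have [b0 _|b_gt0 /=] := posnP; first by left; split=> //; apply: (no_through G).
by move=> le; right; split=> //; have [_ ts _] := range (enum_val i); apply/eqP; rewrite eqn_leq ts.
Qed.

Lemma evertE i : evert (c := a) i =
  (if eb (f (enum_val i)) == 0 then et (f (enum_val i)) else (eb (f (enum_val i))).-1) :> nat.
Proof.
rewrite /=; case: (endP i) => [[-> lt]|[b_gt0 ts]]; first by rewrite eqxx inordK.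
rewrite gtn_eqF // inordK // prednK //.
by have [bt _ _] := range (enum_val i); rewrite -ts.
Qed.

(** Reads counts at the vertices off the triples: an edge gives a falling flag at [et] unless it
    goes to plus infinity, and a rising flag at [eb - 1] unless it comes from minus infinity. *)
Lemma sum_flags (V : nmodType) (Phi : nat -> int -> V) :
  \sum_(x : flag a) Phi (fvert x) (fdir x) =
  \sum_(i : I) ((if (et (f i) < r.+1)%N then Phi (et (f i)) (- (ew (f i))%:Z) else 0) +
                (if (0 < eb (f i))%N then Phi (eb (f i)).-1 (ew (f i))%:Z else 0)).
Proof.
rewrite [RHS](bigID (mem bounded)) big_sumType; congr (_ + _).
  transitivity (\sum_(e < nbedge a) \sum_(b : bool)
      Phi (fvert (inl (e, b) : flag a)) (fdir (inl (e, b) : flag a))).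
    by rewrite pair_bigA; apply: eq_bigr => -[e b] _.
  rewrite [RHS](eq_bigl (mem bounded)) // [RHS]big_enum_val.
  apply: eq_bigr => e _; have [/andP[b_gt0 _] t_lt] := boundedP e.
  rewrite big_bool b_gt0 t_lt; transitivity (Phi (tgt (c := a) e) (- (ew (f (enum_val e)))%:Z) +
    Phi (src (c := a) e) (ew (f (enum_val e)))); first by [].
  by rewrite srcE tgtE.
rewrite [RHS](eq_bigl (mem (~: bounded))) => [|i]; last by rewrite !inE.
rewrite [RHS]big_enum_val; apply: eq_bigr => i _.
transitivity (Phi (evert (c := a) i) (edir (c := a) i)); first by [].
rewrite evertE /edir /=; case: (endP i) => [[b0 lt]|[b_gt0 ts]].
  by rewrite b0 eqxx lt ltnn addr0.
by rewrite ts ltnn add0r gtn_eqF // b_gt0.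
Qed.

Lemma valence_of (v : 'I_(nvert a)) : valence v = 3%N.
Proof.
have ltv : (v < r.+1)%N by exact: ltn_ord.
rewrite /valence -sum1_card big_mkcond.
rewrite (eq_bigr (fun x : flag a => if val (fvert x) == v :> nat then 1%N else 0%N)); last first.
  by move=> x _; rewrite inE.
rewrite (sum_flags (fun k _ => if k == v then 1%N else 0%N)).
rewrite big_split /= -(mg_triv G ltv) !count_codom -!sum1_card; congr (_ + _)%N.
  rewrite [RHS]big_mkcond; apply: eq_bigr => i _; rewrite inE.
  by case: eqP => [->|]; rewrite ?ltv ?if_same.
rewrite [RHS]big_mkcond; apply: eq_bigr => i _; rewrite inE.
by case: (eb (f i)) => [|b] //=; rewrite eqSS.
Qed.

Lemma balanced_of v : \sum_(x : flag a | fvert x == v) fdir x = 0.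
Proof.
have ltv : (v < r.+1)%N by exact: ltn_ord.
rewrite big_mkcond /= (eq_bigr (fun x : flag a => if val (fvert x) == v :> nat then fdir x else 0)) //.
rewrite (sum_flags (fun k z => if k == v then z else 0)) big_split /=.
have /(congr1 Posz) := mg_bal G ltv; rewrite !sum_codom !(big_morph Posz PoszD (erefl 0%:Z)) => bal.
apply/eqP; rewrite addrC addr_eq0 -sumrN; apply/eqP.
transitivity (\sum_(i in [set i | eb (f i) == v.+1]) (ew (f i))%:Z).
  rewrite [RHS]big_mkcond; apply: eq_bigr => i _; rewrite inE.
  by case: (eb (f i)) => [|b] //=; rewrite eqSS.
rewrite -bal big_mkcond; apply: eq_bigr => i _; rewrite inE.
by case: eqP => [->|]; rewrite ?ltv ?opprK ?if_same ?oppr0.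
Qed.

Lemma connected_of (v w : 'I_(nvert a)) : connect (adj (a := a) predT) v w.
Proof.
pose W (k : nat) := connect (adj (a := a) predT) v (inord k).
have W_edge i : (0 < eb (f i))%N -> (et (f i) < r.+1)%N -> W (eb (f i)).-1 = W (et (f i)).
  move=> b_gt0 t_lt; have iB : i \in bounded by rewrite inE b_gt0 t_lt.
  pose e : 'I_(nbedge a) := enum_rank_in iB i.
  have eE : enum_val e = i by apply: enum_rankK_in.
  have [srcE' tgtE'] : src (c := a) e = inord (eb (f i)).-1 /\ tgt (c := a) e = inord (et (f i)).
    by rewrite /= eE.
  apply/idP/idP => /connect_trans; apply; apply: connect1; apply/existsP.
    by exists (inl (e, false)); rewrite /= -srcE' -tgtE' !eqxx.
  by exists (inl (e, true)); rewrite /= -srcE' -tgtE' !eqxx.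
(* An edge is coloured by whether one of its vertices can be reached from [v]; if it has two
   vertices, they give the same answer by [W_edge]. *)
pose Q : pred edge := fun e => if (0 < eb e)%N then W (eb e).-1 else W (et e).
have Q_touch k i : (k < r.+1)%N -> touches k (f i) -> Q (f i) = W k.
  move=> ltk; rewrite /touches /Q => /orP[]/eqP E; last by rewrite E.
  by case: ifP => [b_gt0|_]; rewrite ?W_edge ?E.
have touch k : (k < r.+1)%N -> exists i, touches k (f i).
  move=> ltk; have := mg_triv G ltk; rewrite !count_codom.
  case: (set_0Vmem [set i | et (f i) == k]) => [->|[i]]; last first.
    by rewrite inE => ti _; exists i; rewrite /touches ti.
  rewrite cards0 add0n => c3; have /card_gt0P[i] : (0 < #|[set i | eb (f i) == k.+1]|)%N by rewrite c3.
  by rewrite inE => bi; exists i; rewrite /touches bi orbT.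
have [i iv] := touch v (ltn_ord v); have [j jw] := touch w (ltn_ord w).
have := @mg_conn _ _ _ _ G Q _ _ _ (codom_f f i) (codom_f f j).
rewrite (Q_touch _ _ (ltn_ord v) iv) (Q_touch _ _ (ltn_ord w) jw) /W !inord_val connect0 => <- //.
move=> k _ _ ltk /codomP[i' ->] /codomP[j' ->] ti tj.
by rewrite (Q_touch k) // (Q_touch k).
Qed.

Lemma degree_of : perm_eq [seq edir (c := a) i | i <- enum 'I_(nend a)] D.
Proof.
pose phi (e : edge) : int := if eb e == 0 then - (ew e)%:Z else ew e.
apply: perm_trans (perm_enum_val (~: bounded) (fun j => phi (f j))) _.
have split2 (q1 q2 : pred I) (A : {set I}) : (forall i, i \in A -> q2 i = ~~ q1 i) ->
    perm_eq (enum A) ([seq i <- enum A | q1 i] ++ [seq i <- enum A | q2 i]).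
  move=> q12; rewrite perm_sym (_ : [seq i <- enum A | q2 i] = [seq i <- enum A | ~~ q1 i]).
    exact/permPl/perm_filterC.
  by apply: eq_in_filter => i; rewrite mem_enum => /q12.
have endsP i : i \in ~: bounded -> (et (f i) == r.+1) = ~~ (eb (f i) == 0).
  move=> iE; pose k : 'I_(nend a) := enum_rank_in iE i.
  have kE : enum_val k = i by apply: enum_rankK_in.
  by have := endP k; rewrite kE => -[[-> lt]|[b_gt0 ->]]; [rewrite eqxx ltn_eqF | rewrite eqxx gtn_eqF].
apply: perm_trans (perm_map _ (split2 _ _ _ endsP)) _; rewrite map_cat.
have Dneg : [seq z <- D | z < 0] = [seq - (n%:Z) | n <- neg_parts D].
  rewrite -map_comp -[LHS]map_id; apply/eq_in_map => z; rewrite mem_filter => /andP[z0 _].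
  by rewrite /= ltz0_abs ?opprK.
have Dpos : [seq z <- D | ~~ (z < 0)] = [seq n%:Z | n <- pos_parts D].
  rewrite -map_comp (_ : [seq z <- D | ~~ (z < 0)] = [seq z <- D | 0 < z]).
    rewrite -[LHS]map_id; apply/eq_in_map => z; rewrite mem_filter => /andP[z0 _].
    by rewrite /= gtz0_abs.
  apply: eq_in_filter => z zD; case: ltgtP => // z0.
  by move: D0; rewrite -z0 zD.
have Dsplit : perm_eq ([seq z <- D | z < 0] ++ [seq z <- D | ~~ (z < 0)]) D.
  exact/permPl/perm_filterC.
apply: perm_trans Dsplit; rewrite Dneg Dpos.
have part (q : pred edge) (L : seq nat) (F : nat -> int) :
    (forall i, q (f i) -> i \notin bounded /\ phi (f i) = F (ew (f i))) ->
    perm_eq [seq ew e | e <- codom f & q e] L ->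
    perm_eq [seq phi (f i) | i <- enum (~: bounded) & q (f i)] [seq F n | n <- L].
  move=> qP /(perm_map F); apply: perm_trans; rewrite filter_codom -map_comp.
  rewrite (_ : [seq i <- enum (~: bounded) | q (f i)] = enum [set i | q (f i)]).
    rewrite (_ : [seq phi (f i) | i <- _] = [seq (F \o (fun z => ew (f z))) i | i <- enum [set i | q (f i)]]) //.
    by apply/eq_in_map => i; rewrite mem_enum inE => /qP[].
  rewrite /enum_mem -filter_predI; apply: eq_filter => i /=; rewrite !inE.
  by case qi: (q (f i)) => //=; have [] := qP i qi; rewrite inE.
apply: perm_cat.
  apply: (part (fun e => eb e == 0)) (mg_in G) => i /eqP b0.
  by rewrite inE b0 /phi b0 eqxx.
apply: (part (fun e => et e == r.+1)) (mg_out G) => i /eqP ts.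
rewrite inE ts ltnn andbF /phi; split=> //; case: eqP => // b0.
by have := no_through G (isT : 0 < r.+1)%N b0; rewrite ts ltnn.
Qed.

Lemma nend_of : nend a = size D.
Proof. by rewrite -(perm_size degree_of) size_map -cardE card_ord. Qed.

(** Counting flags in two ways gives 3(r+1) = 2E + n with n = r + 3 - 2g; by the Euler
    characteristic the genus is then exactly g. *)
Lemma nbedge_of : nbedge a = (r + g)%N.
Proof.
have cflag : (\sum_(x : flag a) 1 = nbedge a * 2 + nend a)%N.
  by rewrite sum1_card card_sum card_prod card_bool !card_ord.
have : (\sum_(x : flag a) 1 = 3 * r.+1)%N.
  rewrite (partition_big (@fvert r a) predT) //= (eq_bigr (fun=> 3%N)) => [|v _].
    by rewrite sum_nat_const card_ord mulnC.
  rewrite -[RHS](valence_of v) /valence -[RHS]sum1_card.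
  by apply: eq_bigl => x; rewrite inE.
by rewrite cflag nend_of; move: hr; lia.
Qed.

Lemma is_ctype_of : is_ctype g D a.
Proof.
split.
- exact: connected_of.
- by have := h1E connected_of; rewrite nbedge_of /=; lia.
- by move=> v; rewrite valence_of.
- move=> v; have [i iv] := rank_lab_surj v.
  have -> : nlab v = 1%N.
    rewrite /nlab (_ : [set _ | _] = [set i]) ?cards1 //.
    by apply/setP=> j; rewrite !inE -iv (inj_eq rank_lab_inj).
  by split=> //; exists 0; rewrite valence_of.
- exact: balanced_of.
- exact: degree_of.
Qed.

Lemma curve_of_in_fibre : in_fibre g D p curve_of.
Proof.
have dir_gt0 e : (0 : R) < (dir (c := a) e)%:~R.
  by rewrite ltr0z /=; have [_ _] := range (enum_val e).
split; [exact: is_ctype_of | split=> e | ].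
- by rewrite mulrC divfK // gt_eqF.
- rewrite divr_gt0 // subr_gt0 hv_of_lt srcE tgtE.
  by have [/andP[h1 h2] h3] := boundedP e; rewrite prednK.
by apply/rowP=> i; rewrite mxE /= hv_of_lab (ord1 0).
Qed.

Lemma ptriple_of : perm_eq (codom (ptriple p curve_of)) (codom f).
Proof.
apply/perm_codomP.
pose k (z : pflag a) : I := match val z with inl (e, _) => enum_val e | inr j => enum_val j end.
have aC := curve_of_in_fibre.
have side (e : 'I_(nbedge a)) b : primary (inl (e, b) : flag a) -> b = false.
  have ne : inl (e, ~~ b) != inl (e, b) :> flag a by apply/eqP=> -[]; case: b.
  rewrite /primary /= (negPf ne) orbF; case: b {ne} => //.
  by rewrite oppr_gt0 ltz_nat ltn0.
have fk z : f (k z) = ptriple p curve_of z.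
  case: z => [[[e b]|j] pz].
    have /= b0 := side _ _ pz; subst b.
    have -> : ptriple p curve_of (exist (fun x => primary x) (inl (e, false)) pz) =
        ((time p curve_of (src (c := a) e)).+1, time p curve_of (tgt (c := a) e), ew (f (enum_val e))).
      rewrite /ptriple /ftriple; case: eqP => //.
    have -> : k (exist (fun x => primary x) (inl (e, false)) pz) = enum_val e by [].
    rewrite !time_of srcE tgtE prednK; last by have [/andP[]] := boundedP e.
    by case: (f _) => [[b t] w].
  have -> : k (exist (fun x => primary x) (inr j) pz) = enum_val j by [].
  rewrite /ptriple /ftriple [val _]/=; have [_ _ w_gt0] := range (enum_val j).
  have dE : fdir (inr j : flag a) = edir (c := a) j by [].
  have vE : fvert (inr j : flag a) = evert (c := a) j by [].
  rewrite ?dE ?vE eqxx !time_of evertE.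
  case: (endP j) => [[b0 lt]|[b_gt0 ts]].
    rewrite /edir /= b0 eqxx oppr_lt0 ltz_nat w_gt0 abszN.
    by move: b0; case: (f _) => [[b t] w]; rewrite /eb /et /ew /= => ->.
  rewrite /edir /= gtn_eqF // ltz_nat ltn0 prednK //.
  by move: ts; case: (f _) => [[b t] w]; rewrite /eb /et /ew /= => ->.
have k_inj : injective k.
  move=> [[[e b]|j] pz] [[[e' b']|j'] pz']; rewrite /k /= => E; apply: val_inj => /=.
  - move/enum_val_inj: E => E; subst e'.
    by rewrite (side _ _ pz) (side _ _ pz').
  - by have := enum_valP j'; rewrite -E inE enum_valP.
  - by have := enum_valP j; rewrite E inE enum_valP.
  - by move/enum_val_inj: E => ->.
have k_surj i : exists z, k z = i.
  have [iB|iB] := boolP (i \in bounded).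
    pose e : 'I_(nbedge a) := enum_rank_in iB i.
    have pe : primary (inl (e, false) : flag a).
      by rewrite /primary /= ltz_nat; have [_ _ ->] := range (enum_val e).
    by exists (exist (fun x => primary x) _ pe); rewrite /k /= enum_rankK_in.
  have iE : i \in ~: bounded by rewrite inE.
  pose j : 'I_(nend a) := enum_rank_in iE i.
  have pj : primary (inr j : flag a) by rewrite /primary /= eqxx orbT.
  by exists (exist (fun x => primary x) _ pj); rewrite /k /= enum_rankK_in.
exists k => //; apply: inj_card_bij => //.
rewrite -(card_imset _ k_inj) -cardsT; apply/subset_leq_card/subsetP=> i _.
by have [z <-] := k_surj i; apply: imset_f.
Qed.

End Construct.

(** * The degree of the branch map *)

Lemma sum_parts (D : seq int) :
  \sum_(z <- D) z = (sumn (pos_parts D))%:Z - (sumn (neg_parts D))%:Z.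
Proof.
elim: D => [|z D IH]; first by rewrite big_nil.
by rewrite big_cons IH /pos_parts /neg_parts /=; case: ltgtP => /= z0; lia.
Qed.

Lemma size_parts (D : seq int) : 0 \notin D ->
  (size D = size (neg_parts D) + size (pos_parts D) /\
   size D <= sumn (neg_parts D) + sumn (pos_parts D))%N.
Proof.
elim: D => [|z D IH] //; rewrite inE negb_or => /andP[z0 /IH[E le]].
by rewrite /pos_parts /neg_parts /= in E le *; move: z0; case: ltgtP => //= z0 _; lia.
Qed.

(** Sorting by a total order picks one list in each class of [perm_eq], so that isomorphism classes
    of graphs become values. *)
Definition edge_le (x y : edge) := (pickle x <= pickle y)%N.

Lemma perm_sort_edge (L L' : seq edge) : (sort edge_le L == sort edge_le L') = perm_eq L L'.
Proof.
apply/eqP/idP => [E|/(@perm_sortP _ edge_le _ _ _)]; last first.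
  apply=> [x y|y x z|x y /anti_leq/(pcan_inj pickleK) //]; first exact: leq_total.
  exact: leq_trans.
by rewrite -(perm_sort edge_le L) E perm_sort.
Qed.

Section Multiplicity.
Variables (R : realType) (r g : nat) (D : seq int) (p : 'rV[R]_r.+1).
Hypotheses (p_inj : injective (p ord0)) (D0 : 0 \notin D).
Variables (a : ctype r) (C : curve R a) (aC : in_fibre g D p C).

Lemma prod_ptriple :
  (\prod_(z : pflag a | (0 < eb (ptriple p C z)) && (et (ptriple p C z) < r.+1)) ew (ptriple p C z) =
   \prod_(e < nbedge a) `|dir e|)%N.
Proof.
pose h (e : 'I_(nbedge a)) := edge_flag p_inj D0 aC e.
have hE e : exists b, val (h e) = inl (e, b).
  rewrite /h /edge_flag; eexists; reflexivity.
have h_inj : injective h.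
  move=> e e' E; have [b hb] := hE e; have [b' hb'] := hE e'.
  by move: hb'; rewrite -E hb => -[].
transitivity (\prod_(z in [set h e | e : 'I_(nbedge a)]) ew (ptriple p C z))%N; last first.
  rewrite big_imset => [|e e' _ _]; last exact: h_inj.
  apply: eq_bigr => e _; rewrite ewE edge_flag_dir; exact: absz_nat.
apply: eq_bigl => z; apply/idP/imsetP => [|[e _ ->]]; last first.
  by rewrite /ptriple /ftriple (negPf (edge_flag_bounded _ _ _ _)) /eb /et /= (time_ltr aC).
case zE: (val z) => [[e b]|j]; first by move=> _; exists e; rewrite // /h -(edge_flagE p_inj D0 aC zE).
rewrite /ptriple /ftriple zE eqxx; case: ifP => //= _.
by rewrite /et /= ltnn.
Qed.

(** The powers of 2 in the tropical weight and the labellings in the Hurwitz count come from the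
    same automorphism group, so a curve accounts for exactly the factorizations with its graph. *)
Lemma mult_br_fibre (d : nat) : (0 < d)%N -> sumn (neg_parts D) = d ->
  mult_br a = #|[set sg : {ffun 'I_r.+2 -> 'S_d} | good_path (neg_parts D) (pos_parts D) sg &&
    perm_eq (codom (@ctriple r.+1 d sg)) (codom (ptriple p C))]|%:R / (d`!)%:R.
Proof.
move=> d_gt0 dE; have conn := ctype_connected (fibre_ctype aC).
rewrite (mult_brE conn (lab_surj aC) (nvertE p_inj aC) (dir_neq0 p_inj D0 aC)).
rewrite -(card_autg_ptriple p_inj D0 aC) -prod_ptriple.
have := card_good_paths_of d_gt0 (ltn0Sn r) (ptriple_mgraph p_inj D0 aC) dE.
move=> /(congr1 (fun n : nat => n%:R : rat)); rewrite !natrM => E.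
have aut0 : (#|autg (ptriple p C)|%:R : rat) != 0.
  by rewrite pnatr_eq0 (card_autg_ptriple p_inj D0 aC) -lt0n expn_gt0.
have fact0 : (d`!%:R : rat) != 0 by rewrite pnatr_eq0 -lt0n fact_gt0.
by apply/eqP; rewrite eqr_div // E mulrC.
Qed.
End Multiplicity.

Theorem theorem5p28 (R : realType) (g r : nat) (D : seq int)
  (hD : D <> [::])
  (hD0 : 0 \notin D)
  (hDsum : \sum_(z <- D) z = 0)
  (hr : (size D + 2 * g - 2)%N = r.+1) :
  degree_br_is R r g D
    (hurwitz g (sumn (pos_parts D)) (neg_parts D) (pos_parts D)).
Proof.
set d := sumn (pos_parts D); set eta := neg_parts D; set nu := pos_parts D.
have [sizeD sumD] := size_parts hD0.
have d_eta : sumn eta = d.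
  by apply/eqP; rewrite -eqz_nat -subr_eq0 -oppr_eq0 opprB -sum_parts hDsum.
(* Every entry of [D] contributes at least 1 to the two sums, whose total is 2d. *)
have d_gt0 : (0 < d)%N.
  move: hD sumD; rewrite -/eta -/nu -/d d_eta; case: (D) => //= z D' _.
  by rewrite addnn -double_gt0; apply: leq_ltn_trans.
have sE : (2 * g + size eta + size nu - 2)%N = r.+1 by rewrite -addnA [(2 * g + _)%N]addnC -sizeD.
rewrite /hurwitz sE (card_monodromy _ _ _ d_gt0).
move=> p p_inj.
pose good := [set sg : {ffun 'I_r.+2 -> 'S_d} | good_path eta nu sg].
(* The representatives of the fibre are indexed by the graphs of the factorizations, each listed
   once as a sorted list. *)
pose key (sg : {ffun 'I_r.+2 -> 'S_d}) := sort edge_le (codom (@ctriple r.+1 d sg)).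
pose keys := undup [seq key sg | sg <- enum good].
have keyP j : (j < size keys)%N -> exists2 sg, sg \in good & nth [::] keys j = key sg.
  move=> ltj; have := mem_nth [::] ltj; rewrite mem_undup => /mapP[sg].
  by rewrite mem_enum; exists sg.
pose L (j : 'I_(size keys)) := nth [::] keys j.
pose f (j : 'I_(size keys)) (i : 'I_(size (L j))) : edge := tnth (in_tuple (L j)) i.
have codom_tnth j : codom (f j) = L j by rewrite -[RHS]/(tval (in_tuple (L j))) codomE map_tnth_enum.
have G j : mgraph r.+1 eta nu (codom (f j)).
  rewrite codom_tnth; have [sg gsg] := keyP j (ltn_ord j); rewrite -/(L j) => ->.
  rewrite inE in gsg; apply: mgraph_perm (good_mgraph gsg).
  by rewrite perm_sym perm_sort.
pose a j := ctype_of (R := R) p (f j).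
pose C j : curve R (a j) := curve_of p (f j).
have aC j : in_fibre g D p (C j) := curve_of_in_fibre p_inj hD0 hr (G j).
have CE j : perm_eq (codom (ptriple p (C j))) (L j).
  by rewrite -codom_tnth; exact: (ptriple_of p_inj hD0 hr (G j)).
have sortL j : sort edge_le (L j) = L j.
  have [sg _] := keyP j (ltn_ord j); rewrite -/(L j) => ->; apply/eqP.
  by rewrite perm_sort_edge perm_sort.
exists (size keys), a, C.
have fib_dim j : cell_dim (a j) = r.+1.
  exact: (cell_dimE (ctype_connected (fibre_ctype (aC j))) (lab_surj (aC j))
    (nvertE p_inj (aC j)) (dir_neq0 p_inj hD0 (aC j))).
split=> //.
- move=> j; split; last exact: fibre_br (aC j).
  split; [exact: fibre_ctype (aC j) | exact: fibre_cell (aC j) | | by rewrite fib_dim ltnn].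
  move=> _; exact: (regularE (ctype_connected (fibre_ctype (aC j))) (lab_surj (aC j))
    (nvertE p_inj (aC j)) (dir_neq0 p_inj hD0 (aC j))).
- move=> j k /(iso_perm p) E; apply/val_inj/eqP.
  rewrite -(nth_uniq [::] (ltn_ord j) (ltn_ord k) (undup_uniq _)) -/(L j) -/(L k).
  rewrite -(sortL j) -(sortL k) perm_sort_edge.
  by apply: perm_trans (perm_trans E (CE k)); rewrite perm_sym.
- move=> b C' [ctb cb _ _] brb; have bC := InFibre ctb cb brb.
  (* The number of factorizations with the graph of [C'] is positive, because the product of the
     nonzero weights is; one of them provides the index. *)
  have := card_good_paths_of d_gt0 (ltn0Sn r) (ptriple_mgraph p_inj hD0 bC) d_eta.
  case: (set_0Vmem [set sg : {ffun 'I_r.+2 -> 'S_d} | good_path eta nu sg &&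
      perm_eq (codom (@ctriple r.+1 d sg)) (codom (ptriple p C'))]) => [->|[sg]].
    rewrite cards0 mul0n (prod_ptriple p_inj hD0 bC) => /eqP; rewrite eq_sym muln_eq0 gtn_eqF ?fact_gt0 //=.
    rewrite gtn_eqF // prodn_gt0 // => e; rewrite absz_gt0; exact: (dir_neq0 p_inj hD0 bC).
  rewrite inE => /andP[gsg sgC'] _.
  have : key sg \in keys by rewrite mem_undup map_f // mem_enum inE.
  case/(nthP [::])=> j ltj E; exists (Ordinal ltj).
  apply: (perm_iso p_inj hD0 bC (aC _)).
  rewrite perm_sym in sgC'; apply: (perm_trans sgC'); rewrite perm_sym.
  by apply: (perm_trans (CE _)); rewrite /L /= E perm_sort.
under eq_bigr => j _ do rewrite (mult_br_fibre p_inj hD0 (aC j) d_gt0 d_eta).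
rewrite -mulr_suml -natr_sum; congr (_%:R / _).
under eq_bigr => j _ do rewrite -sum1_card.
(* Each factorization is counted by one index only, that of its own graph. *)
rewrite (exchange_big_dep (mem good)) => [|j sg _]; last by rewrite !inE => /andP[].
rewrite -sum1_card; apply: eq_bigr => sg gsg; have : key sg \in keys.
  by rewrite mem_undup map_f // mem_enum.
case/(nthP [::])=> j0 ltj0 E; rewrite (big_pred1 (Ordinal ltj0)) // => j; rewrite !inE in gsg *.
rewrite gsg /= -(inj_eq val_inj) /= -(nth_uniq [::] (ltn_ord j) ltj0 (undup_uniq _)) E -/(L j) -sortL.
by rewrite perm_sort_edge perm_sym (permPl (CE j)).
Qed.
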